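(* Consider the (relaxed) joint inventory placement, assortment personalization and order fulfillment problem described in the context, with an arbitrary choice model $\phi$ satisfying the stated assumptions and arbitrary (possibly non-stationary) arrival probabilities $\lambda_{jt}$. Let $K^{\min}=\min_{\ell\in\mathcal L}K^\ell$ and $C_{\min}=\min_{i\in\mathcal N}C_i$. Then one can compute in polynomial time a $\beta$-approximation, where $$\beta=1-2\max\left(\sqrt{\frac{nm}{K^{\min}}},\ \sqrt{\frac{Lm}{C_{\min}}}\right);$$ that is, a feasible inventory placement $\boldsymbol c$ and a (randomized) assortment and fulfillment policy whose expected total profit starting from $\boldsymbol c$ is at least $\beta\cdot\mathrm{OPT}^*$.
   Context: Setting. Products $\mathcal N=\{1,\dots,n\}$, customer types $\mathcal M=\{1,\dots,m\}$, warehouses $\mathcal L=\{1,\dots,L\}$, time periods $\mathcal T=\{1,\dots,T\}$. In each period $t$ at most one customer arrives; a type-$j$ customer arrives with probability $\lambda_{jt}\ge 0$ (with $\sum_{j}\lambda_{jt}\le 1$), independently across periods. If a type-$j$ customer is offered the assortment $S\subseteq\mathcal N$, she chooses product $i$ with probability $\phi_{ij}(S)$ and nothing with probability $1-\sum_{i}\phi_{ij}(S)\geq 0$; choices are independent across periods. Assumptions on $\phi$: $\phi_{kj}(S)=0$ if $k\notin S$; weak substitutability: $\phi_{ij}(S\cup\{k\})\le\phi_{ij}(S)$ for all $S$, $i\in S$, $k\notin S$. Serving product $i$ to a type-$j$ customer from warehouse $\ell$ gives profit $r_{ij}^\ell\in\mathbb R$ (possibly negative). Fixed-placement (relaxed)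 problem. A virtual warehouse $L+1$ with infinite stock of each product and profits $r_{ij}^{L+1}=0$ is added; $\mathcal L_+=\mathcal L\cup\{L+1\}$. Start with inventory $c_i^\ell$ of product $i$ at warehouse $\ell\in\mathcal L$. On the arrival of a type-$j$ customer in period $t$, the policy (knowing the type, the period and the history/current inventory $\boldsymbol x$, and possibly randomizing) offers an assortment $S\subseteq\mathcal N$ and decides, for each $i\in S$, a warehouse $f(i)\in\mathcal L_+$ from which $i$ is served if chosen, where $f(i)\in\mathcal L$ is allowed only if $x_i^{f(i)}>0$. If product $i$ is chosen, the profit $r_{ij}^{f(i)}$ is earned and, when $f(i)\in\mathcal L$, the stock $x_i^{f(i)}$ decreases by one. $J_1^*(\boldsymbol c)$ denotes the maximum expected total profit over the $T$ periods among all such policies. Joint problem. Warehouse $\ell$ has storage capacity $K^\ell$ (a positive integer) and product $i$ has total supply $C_i$ (a positive integer or $+\infty$). A placement $\boldsymbol c=(c_i^\ell)\in\mathbb Z_+^{nL}$ is feasible if $\sum_{i\in\mathcal N}c_i^\ell\le K^\ell$ for all $\ell\in\mathcal L$ and $\sum_{\ell\in\mathcal L}c_i^\ell\le C_i$ for all $i\in\mathcal N$. $\mathrm{OPT}^*$ is the maximum of $J_1^*(\boldsymbol c)$ over feasible placements $\boldsymbol c$. Computational model. There is a polynomial-time oracle which, given a customer type $j$ and per-product rewards $(\rho_i)_{i\in\mathcal N}$, returns $S\subseteq\mathcal N$ maximizing $\sum_{i\in S}\rho_i\phi_{ij}(S)$. Polynomial time is with respect to the input size (including $n,m,L,T$).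 *)

(* Defs.v *)
From HB Require Import structures.
From mathcomp Require Import all_boot all_order all_algebra.
From mathcomp Require Import all_classical all_reals.

Set Implicit Arguments.
Unset Strict Implicit.
Unset Printing Implicit Defensive.

Import Order.TTheory GRing.Theory Num.Theory.
Local Open Scope ring_scope.

(* [n] products, [m] customer types, [L] warehouses, [T] periods.
   [supply i = None] stands for an infinite total supply of product [i]. *)
Record problem (F : Type) (n m L T : nat) := Problem {
  arrival : 'I_m -> 'I_T -> F;
  choice_prob : 'I_n -> 'I_m -> {set 'I_n} -> F;
  reward : 'I_n -> 'I_m -> 'I_L -> F;
  capacity : 'I_L -> nat;
  supply : 'I_n -> option nat
}.

Definition map_problem (F G : Type) (g : F -> G) (n m L T : nat)
    (I : problem F n m L T) : problem G n m L T :=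
  {| arrival j t := g (arrival I j t);
     choice_prob i j S := g (choice_prob I i j S);
     reward i j l := g (reward I i j l);
     capacity := capacity I;
     supply := supply I |}.

Record valid_problem (F : numDomainType) (n m L T : nat)
    (I : problem F n m L T) : Prop := ValidProblem {
  arrival_ge0 : forall j t, 0 <= arrival I j t;
  arrival_sum : forall t, \sum_j arrival I j t <= 1;
  choice_ge0 : forall i j S, 0 <= choice_prob I i j S;
  choice_sum : forall j S, \sum_i choice_prob I i j S <= 1;
  choice_notin : forall i j (S : {set 'I_n}), i \notin S -> choice_prob I i j S = 0;
  weak_substitutability : forall (S : {set 'I_n}) i j k, i \in S -> k \notin S ->
    choice_prob I i j (k |: S) <= choice_prob I i j S;
  capacity_gt0 : forall l, (0 < capacity I l)%N;
  supply_gt0 : forall i s, supply I i = Some s -> (0 < s)%N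
}.

Definition placement (n L : nat) := 'I_n -> 'I_L -> nat.

Definition feasible_placement (F : Type) (n m L T : nat) (I : problem F n m L T)
    (c : placement n L) : Prop :=
  (forall l, (\sum_i c i l <= capacity I l)%N) /\
  (forall i s, supply I i = Some s -> (\sum_l c i l <= s)%N).

(* An offered assortment [S] with the warehouse assigned to each product;
   [None] is the virtual warehouse.  The values outside [S] are irrelevant. *)
Definition action (n L : nat) : finType :=
  ({set 'I_n} * {ffun 'I_n -> option 'I_L})%type.

(* What happens in one period: [None] if nobody arrives, and otherwise the type
   of the customer, the action taken and the chosen product, if any. *)
Definition event (n m L : nat) : finType :=
  option ('I_m * action n L * option 'I_n).

(* The events of the past periods in chronological order, so that
   [size h] is the current period. *)
Definition history (n m L : nat) := seq (event n m L).

Definition served (n m L : nat) (i : 'I_n) (l : 'I_L) (e : event n m L) : bool :=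
  if e is Some (_, (_, f), Some i') then (i' == i) && (f i == Some l) else false.

Definition inventory (n m L : nat) (c : placement n L) (h : history n m L)
    (i : 'I_n) (l : 'I_L) : nat :=
  (c i l - count (served i l) h)%N.

Definition action_ok (n m L : nat) (c : placement n L) (h : history n m L)
    (a : action n L) : Prop :=
  forall i l, i \in a.1 -> a.2 i = Some l -> (0 < inventory c h i l)%N.

Section Model.
Variables (R : realType) (n m L T : nat) (I : problem R n m L T).

(* A randomized, history-dependent policy: the probability of each action. *)
Definition policy := history n m L -> 'I_m -> action n L -> R.

Definition admissible (c : placement n L) (pi : policy) : Prop :=
  forall h j, (size h < T)%N ->
    [/\ forall a, 0 <= pi h j a,
        \sum_a pi h j a = 1 &
        forall a, 0 < pi h j a -> action_ok c h a].

(* Conditional probability of the event [e] in period [t], given the history. *)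
Definition event_prob (pi : policy) (t : 'I_T) (h : history n m L)
    (e : event n m L) : R :=
  match e with
  | None => 1 - \sum_j arrival I j t
  | Some (j, a, o) =>
      arrival I j t * pi h j a *
      (if o is Some i then choice_prob I i j a.1
       else 1 - \sum_i choice_prob I i j a.1)
  end.

Definition event_profit (e : event n m L) : R :=
  if e is Some (j, (_, f), Some i) then
    if f i is Some l then reward I i j l else 0
  else 0.

Definition path_prob (pi : policy) (h : T.-tuple (event n m L)) : R :=
  \prod_(t < T) event_prob pi t (take t h) (tnth h t).

Definition path_profit (h : T.-tuple (event n m L)) : R :=
  \sum_(t < T) event_profit (tnth h t).

Definition expected_profit (pi : policy) : R :=
  \sum_(h : T.-tuple (event n m L)) path_prob pi h * path_profit h.

Local Open Scope classical_set_scope.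

Definition J1_opt (c : placement n L) : R :=
  sup [set expected_profit pi | pi in [set pi | admissible c pi]].

Definition OPT : R :=
  sup [set J1_opt c | c in [set c | feasible_placement I c]].

Local Close Scope classical_set_scope.

Definition K_min : \bar R :=
  \big[Order.min/+oo%E]_(l < L) (capacity I l)%:R%:E.

Definition C_min : \bar R :=
  \big[Order.min/+oo%E]_(i < n)
    (if supply I i is Some s then s%:R%:E else +oo%E).

(* In [\bar R] the inverse of [+oo] is 0. *)
Definition beta : R :=
  1 - 2 * Num.max (Num.sqrt (fine ((n * m)%:R%:E / K_min)%E))
                  (Num.sqrt (fine ((L * m)%:R%:E / C_min)%E)).

Definition is_approximation (b : R) (c : placement n L) (pi : policy) : Prop :=
  [/\ feasible_placement I c, admissible c pi &
      b * OPT <= expected_profit pi].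

(* The policy that draws a fresh seed uniformly from {0, ..., D-1} whenever a
   customer arrives and then takes the action [act h j seed]. *)
Definition seeded_policy (D : nat)
    (act : history n m L -> 'I_m -> 'I_D -> action n L) : policy :=
  fun h j a => #|[set u : 'I_D | act h j u == a]|%:R / D%:R.

End Model.

(* Programs of a random access machine over the rationals, under the logarithmic
   cost criterion: every operation costs at least the number of bits of the
   values (and of the addresses) that it handles, so that a polynomial bound on
   the cost also bounds the sizes of all numbers that occur. *)

Definition bit_length (q : rat) : nat :=
  ((trunc_log 2 `|numq q|).+1 + (trunc_log 2 `|denq q|).+1)%N.

(* The memory consists of arrays, named by a number, with any number of indices. *)
Definition memory := nat -> seq nat -> rat.

Definition update (mu : memory) (x : nat) (idx : seq nat) (v : rat) : memory :=
  fun y idx' => if (y == x) && (idx' == idx) then v else mu y idx'.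

Inductive operator := OpAdd | OpSub | OpMul | OpDiv | OpLeq | OpEq.

Definition apply_op (o : operator) (u v : rat) : rat :=
  match o with
  | OpAdd => u + v
  | OpSub => u - v
  | OpMul => u * v
  | OpDiv => u / v
  | OpLeq => (u <= v)%R%:R
  | OpEq => (u == v)%:R
  end.

Inductive expr :=
  | Cst of rat
  | Get of nat & seq expr
  | Floor of expr
  | Op of operator & expr & expr.

(* Index values are truncated to natural numbers (negative ones to 0). *)
Fixpoint eval (mu : memory) (e : expr) : rat :=
  match e with
  | Cst q => q
  | Get x es => mu x (map (fun e' => Num.truncn (eval mu e')) es)
  | Floor e1 => (Num.floor (eval mu e1))%:~R
  | Op o e1 e2 => apply_op o (eval mu e1) (eval mu e2)
  end.

Fixpoint eval_cost (mu : memory) (e : expr) : nat :=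
  (bit_length (eval mu e) +
   match e with
   | Cst _ => 0
   | Get _ es => sumn (map (eval_cost mu) es)
   | Floor e1 => eval_cost mu e1
   | Op _ e1 e2 => eval_cost mu e1 + eval_cost mu e2
   end)%N.

(* [QueryAssort x e y] asks for an optimal assortment for customer type [e] and the
   rewards y[0], ..., y[n-1], and stores its indicator vector in x[0], ..., x[n-1].
   [QueryChoice x e1 e2 y] stores in x[] the probability that a customer of type [e2]
   chooses product [e1] when offered the assortment with indicator vector
   y[0], ..., y[n-1]. *)
Inductive program :=
  | Skip
  | Assign of nat & seq expr & expr
  | Seq of program & program
  | If of expr & program & program
  | While of expr & program
  | QueryAssort of nat & expr & nat
  | QueryChoice of nat & expr & expr & nat.

(* The value of [f] at the number [x], or 0 if [x] is out of bounds. *)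
Definition at_ord (k : nat) (f : 'I_k -> rat) (x : nat) : rat :=
  oapp f 0 (insub x).

Section Execution.
Variables (n m : nat).
Variables (opt : 'I_m -> {ffun 'I_n -> rat} -> {set 'I_n}).
Variables (phi : 'I_n -> 'I_m -> {set 'I_n} -> rat).

Definition rewards_at (mu : memory) (y : nat) : {ffun 'I_n -> rat} :=
  [ffun i : 'I_n => mu y [:: val i]].

Definition set_at (mu : memory) (y : nat) : {set 'I_n} :=
  [set i : 'I_n | mu y [:: val i] != 0].

Definition assort_update (mu : memory) (x j y : nat) : memory :=
  fun z idx =>
    if (z == x) && (size idx == 1%N) && (head 0%N idx < n)%N then
      at_ord (fun j' => at_ord (fun i => (i \in opt j' (rewards_at mu y))%:R)
                               (head 0%N idx)) j
    else mu z idx.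

Definition choice_value (mu : memory) (i j y : nat) : rat :=
  at_ord (fun j' => at_ord (fun i' => phi i' j' (set_at mu y)) i) j.

(* [exec p mu k mu']: started in [mu], [p] halts in [mu'] at cost [k]. *)
Inductive exec : program -> memory -> nat -> memory -> Prop :=
  | ExecSkip mu : exec Skip mu 1 mu
  | ExecAssign mu x es e :
      exec (Assign x es e) mu
        (1 + sumn (map (eval_cost mu) es) + eval_cost mu e)
        (update mu x (map (fun e' => Num.truncn (eval mu e')) es) (eval mu e))
  | ExecSeq p q mu1 mu2 mu3 k1 k2 :
      exec p mu1 k1 mu2 -> exec q mu2 k2 mu3 ->
      exec (Seq p q) mu1 (1 + k1 + k2) mu3
  | ExecIf e p q mu mu' k :
      exec (if eval mu e != 0 then p else q) mu k mu' ->
      exec (If e p q) mu (1 + eval_cost mu e + k) mu'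
  | ExecWhileStop e p mu :
      eval mu e = 0 -> exec (While e p) mu (1 + eval_cost mu e) mu
  | ExecWhileStep e p mu1 mu2 mu3 k1 k2 :
      eval mu1 e != 0 -> exec p mu1 k1 mu2 -> exec (While e p) mu2 k2 mu3 ->
      exec (While e p) mu1 (1 + eval_cost mu1 e + k1 + k2) mu3
  | ExecQueryAssort mu x e y :
      exec (QueryAssort x e y) mu
        (1 + eval_cost mu e + \sum_(i < n) (1 + bit_length (mu y [:: val i])))
        (assort_update mu x (Num.truncn (eval mu e)) y)
  | ExecQueryChoice mu x e1 e2 y (i := Num.truncn (eval mu e1))
        (j := Num.truncn (eval mu e2)) :
      exec (QueryChoice x e1 e2 y) mu
        (1 + eval_cost mu e1 + eval_cost mu e2 +
         \sum_(i' < n) (1 + bit_length (mu y [:: val i'])) +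
         bit_length (choice_value mu i j y))
        (update mu x [::] (choice_value mu i j y)).

End Execution.

Definition assortment_oracle (n m L T : nat) (I : problem rat n m L T)
    (opt : 'I_m -> {ffun 'I_n -> rat} -> {set 'I_n}) : Prop :=
  forall j (rho : {ffun 'I_n -> rat}) (S : {set 'I_n}),
    \sum_(i in S) rho i * choice_prob I i j S <=
    \sum_(i in opt j rho) rho i * choice_prob I i j (opt j rho).

(* The choice probabilities are accessed through the oracles, so they contribute
   the size of the longest one. *)
Definition input_size (n m L T : nat) (I : problem rat n m L T) : nat :=
  (n + m + L + T +
   \sum_j \sum_t bit_length (arrival I j t) +
   \sum_i \sum_j \sum_l bit_length (reward I i j l) +
   \sum_l bit_length (capacity I l)%:R +
   \sum_i bit_length (odflt 0 (supply I i))%:R +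
   \max_i \max_j \max_(S : {set 'I_n}) bit_length (choice_prob I i j S))%N.

Definition in_products := 0%N.
Definition in_types := 1%N.
Definition in_warehouses := 2%N.
Definition in_periods := 3%N.
Definition in_arrival := 4%N.
Definition in_reward := 5%N.
Definition in_capacity := 6%N.
Definition in_supply := 7%N.

(* An infinite supply is represented by 0. *)
Definition input_memory (n m L T : nat) (I : problem rat n m L T) : memory :=
  fun x idx =>
    if (x == in_products) && (idx == [::]) then n%:R
    else if (x == in_types) && (idx == [::]) then m%:R
    else if (x == in_warehouses) && (idx == [::]) then L%:R
    else if (x == in_periods) && (idx == [::]) then T%:R
    else if x == in_arrival then
      if idx is [:: j; t] then
        at_ord (fun j => at_ord (fun t => arrival I j t) t) j
      else 0
    else if x == in_reward then
      if idx is [:: i; j; l] then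
        at_ord (fun i => at_ord (fun j => at_ord (fun l => reward I i j l) l) j) i
      else 0
    else if x == in_capacity then
      if idx is [:: l] then at_ord (fun l => (capacity I l)%:R) l else 0
    else if x == in_supply then
      if idx is [:: i] then at_ord (fun i => (odflt 0%N (supply I i))%:R) i else 0
    else 0.

Definition out_placement := 8%N.
Definition out_seeds := 9%N.

Definition in_now := 10%N.
Definition in_type := 11%N.
Definition in_seed := 12%N.
Definition past_type := 13%N.
Definition past_offer := 14%N.
Definition past_warehouse := 15%N.
Definition past_choice := 16%N.

(* In the arrays below 0 means no customer, no product or the virtual warehouse;
   types, products and warehouses are shifted by one. *)
Definition past_type_value (n m L : nat) (e : event n m L) : rat :=
  if e is Some (j, _, _) then (val j).+1%:R else 0.

Definition past_offer_value (n m L : nat) (e : event n m L) (i : 'I_n) : rat :=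
  if e is Some (_, (A, _), _) then (i \in A)%:R else 0.

Definition past_warehouse_value (n m L : nat) (e : event n m L) (i : 'I_n) : rat :=
  if e is Some (_, (_, f), _) then
    if f i is Some l then (val l).+1%:R else 0
  else 0.

Definition past_choice_value (n m L : nat) (e : event n m L) : rat :=
  if e is Some (_, _, Some i) then (val i).+1%:R else 0.

(* The memory [mu] left by the placement program, together with the history, the
   type of the arriving customer and the random seed of the current period. *)
Definition query_memory (n m L : nat) (mu : memory) (h : history n m L)
    (j : 'I_m) (u : nat) : memory :=
  fun x idx =>
    if x == in_now then (size h)%:R
    else if x == in_type then (val j)%:R
    else if x == in_seed then u%:R
    else if x == past_type then
      if idx is [:: s] then past_type_value (nth None h s) else 0
    else if x == past_offer then
      if idx is [:: s; i] then at_ord (past_offer_value (nth None h s)) i else 0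
    else if x == past_warehouse then
      if idx is [:: s; i] then at_ord (past_warehouse_value (nth None h s)) i
      else 0
    else if x == past_choice then
      if idx is [:: s] then past_choice_value (nth None h s) else 0
    else mu x idx.

Definition out_offer := 17%N.
Definition out_warehouse := 18%N.

Definition output_action (n L : nat) (mu : memory) : action n L :=
  (set_at n mu out_offer,
   [ffun i : 'I_n =>
      [pick l : 'I_L | mu out_warehouse [:: val i] == (val l).+1%:R]]).

(* The program [plan] computes the placement [c] and the number [D] of seeds from
   the input at cost at most [B]; from the memory thus obtained, the program
   [act] computes the policy [a] at cost at most [B] in each period. *)
Definition computes (n m L T : nat) (I : problem rat n m L T)
    (opt : 'I_m -> {ffun 'I_n -> rat} -> {set 'I_n})
    (plan act : program) (B : nat) (c : placement n L) (D : nat)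
    (a : history n m L -> 'I_m -> 'I_D -> action n L) : Prop :=
  exists (k : nat) (mu : memory),
    [/\ exec opt (choice_prob I) plan (input_memory I) k mu /\ (k <= B)%N,
        forall i l, mu out_placement [:: val i; val l] = (c i l)%:R,
        mu out_seeds [::] = D%:R &
        forall h j (u : 'I_D), (size h < T)%N ->
          exists (k' : nat) (mu' : memory),
            [/\ exec opt (choice_prob I) act (query_memory mu h j u) k' mu',
                (k' <= B)%N & output_action n L mu' = a h j u]].

(* Main.v *)
Require Import Defs.
From mathcomp Require Import all_boot all_order all_algebra.
From mathcomp Require Import all_classical all_reals.
From mathcomp Require Import zify ring lra.

(** Charging a price for every unit of stock bounds OPT by the dual value
    [sum of prices * capacities + sum_j Lambda_j * max_S sum_i phi_ij(S) (r - price)^+],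
    where [Lambda_j] is the expected number of customers of type [j].  A lazy subgradient
    method with [N = O(T^6 (L + n))] rounds minimizes it up to a factor [1 + O(1/T)]: the
    price of a resource in round [s] is proportional to the positive
    part of (cumulative sales / capacity - s), and the sum of the squares of these positive
    parts is a Lyapunov function.  The value of the relaxation without stock constraints is
    at most [T] times the dual value and serves as the scale of the step size.  Averaging
    the assortments and warehouses chosen in the [N] rounds, which the policy does by
    drawing a round at random, gives a primal solution that uses the capacities up to a
    factor [1 + 1/(16 T)].

    The stock is reserved for triples (product, type, warehouse).  Let [b <= T] be the
    largest number with [b^2 n m <= K^l] and [b^2 L m <= C_i] for all [l] and [i].  A triple
    with mean demand [y] gets about [(1 - 1/b) y + b] units, so that the buffers take a
    fraction [1/b] of each capacity, and since the variance of the demand is at most [y], a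
    fraction of at most [1/(4 (b - 1))] of it is lost.  The total loss [5/(4 b) + O(1/T)] is
    at most [2/(b + 1) <= 1 - beta] when [2 <= b < T].  For [b <= 1] and [b < T], [beta] is
    not positive; for [b = T] all prices stay 0, no stock runs out, and the solution is
    exactly optimal.

    All numbers that the program computes are values of expressions with polynomially many
    operations on the input, hence have polynomially many bits. *)

Set Implicit Arguments.
Unset Strict Implicit.
Unset Printing Implicit Defensive.

Import Order.TTheory GRing.Theory Num.Theory.
Local Open Scope ring_scope.

(** * Sizes of rational numbers *)

(** The price of a unit is a sum of one part per warehouse and one part per product. The stock of
    every feasible placement is therefore paid for by the same total of capacities, and a single
    dual value bounds the profit of all placements and all history-dependent policies at once.

    The error of the subgradient method is additive and proportional to the scale of its step size;
    a scale that may exceed the optimum by a factor [T] is paid for by powers of [T] in the number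
    of rounds.

    An iterative method over the rationals could square its numbers in every round. Here the prices
    of a round act on later rounds only through discrete decisions, the assortments returned by the
    oracle and the chosen warehouses. The cumulative sales thus remain sums of at most [N] products
    of an arrival total and a choice probability, and the prices are a fixed formula in these sums.

    A general choice model need not have an assortment whose choice probabilities are the average
    over the rounds; hence the draw of a round at random. *)

Definition small (b : nat) (q : rat) : bool :=
  (`|numq q| <= 2 ^ b)%N && (`|denq q| <= 2 ^ b)%N.

Lemma small_le b b' q : (b <= b')%N -> small b q -> small b' q.
Proof.
move=> le_b /andP[hn hd]; have h : (2 ^ b <= 2 ^ b')%N by rewrite leq_exp2l.
by apply/andP; split; [exact: leq_trans hn h | exact: leq_trans hd h].
Qed.

Lemma small_bit_length b q : small b q -> (bit_length q <= 2 * b.+1)%N.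
Proof.
have tl k : (k <= 2 ^ b)%N -> (trunc_log 2 k <= b)%N.
  move=> hk; case: (posnP k) => [->|k0]; first by rewrite trunc_log0.
  rewrite -(@leq_exp2l 2) //; apply: leq_trans hk; exact: trunc_logP.
by case/andP=> /tl hn /tl hd; rewrite /bit_length; lia.
Qed.

Lemma bit_length_small q : small (bit_length q) q.
Proof.
have tl k : (k <= 2 ^ (trunc_log 2 k).+1)%N by apply/ltnW/trunc_log_ltn.
rewrite /small /bit_length; apply/andP; split.
  by apply: leq_trans (tl _) _; rewrite leq_exp2l // leq_addr.
by apply: leq_trans (tl _) _; rewrite leq_exp2l // leq_addl.
Qed.

(** Reduction divides numerator and denominator by a common factor, so any unreduced representation
    bounds the size. The arithmetic lemmas below use the obvious common denominators. *)
Lemma small_frac b (x y : int) : y != 0 ->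
  (`|x| <= 2 ^ b)%N -> (`|y| <= 2 ^ b)%N -> small b (x%:~R / y%:~R).
Proof.
move=> y0; rewrite /small; case: divqP y0 => [_|k q k0 _]; first by [].
rewrite !abszM => hn hd; have k1 : (0 < `|k|)%N by rewrite absz_gt0.
apply/andP; split; [apply: leq_trans hn | apply: leq_trans hd].
all: by rewrite leq_pmull.
Qed.

Lemma small_int b (x : int) : (`|x| <= 2 ^ b)%N -> small b x%:~R.
Proof.
move=> hx; rewrite -[x%:~R]divr1 -[1]/(1%:~R); apply: small_frac => //.
by rewrite expn_gt0.
Qed.

Lemma small_nat b k : (k <= 2 ^ b)%N -> small b k%:R.
Proof. by move=> hk; rewrite -[k%:R]/(k%:Z%:~R); apply: small_int. Qed.

Lemma small_natS k b : (k <= b)%N -> small b k%:R.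
Proof. by move=> h; apply: small_nat; apply: leq_trans h _; apply/ltnW/ltn_expl. Qed.

Lemma small0 b : small b 0.
Proof. by apply: (@small_nat b 0). Qed.

Lemma small_bool b (c : bool) : small b c%:R.
Proof. by apply: small_nat; case: c; rewrite // expn_gt0. Qed.

Lemma smallN b q : small b (- q) = small b q.
Proof. by rewrite /small numqN denqN abszN. Qed.

Lemma smallD b1 b2 u v : small b1 u -> small b2 v -> small (b1 + b2).+1 (u + v).
Proof.
case/andP=> n1 d1 /andP[n2 d2].
have -> : u + v = (numq u * denq v + numq v * denq u)%:~R
                  / (denq u * denq v)%:~R.
  rewrite -{1}(divq_num_den u) -{1}(divq_num_den v) !rmorphD !rmorphM /=.
  by field; rewrite !intr_eq0 !denq_neq0.
apply: small_frac; first by rewrite mulf_neq0 ?denq_neq0.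
  have h1 : (`|(numq u * denq v)%R| <= 2 ^ (b1 + b2))%N.
    by rewrite abszM expnD leq_mul.
  have h2 : (`|(numq v * denq u)%R| <= 2 ^ (b1 + b2))%N.
    by rewrite abszM addnC expnD leq_mul.
  by rewrite expnS; move: h1 h2; lia.
rewrite abszM; apply: leq_trans (leq_mul d1 d2) _.
by rewrite -expnD leq_exp2l.
Qed.

Lemma smallB b1 b2 u v : small b1 u -> small b2 v -> small (b1 + b2).+1 (u - v).
Proof. by move=> h1 h2; apply: smallD; rewrite ?smallN. Qed.

Lemma smallM b1 b2 u v : small b1 u -> small b2 v -> small (b1 + b2) (u * v).
Proof.
case/andP=> n1 d1 /andP[n2 d2].
have -> : u * v = (numq u * numq v)%:~R / (denq u * denq v)%:~R.
  rewrite -{1}(divq_num_den u) -{1}(divq_num_den v) !rmorphM /=.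
  by field; rewrite !intr_eq0 !denq_neq0.
apply: small_frac; first by rewrite mulf_neq0 ?denq_neq0.
all: by rewrite abszM expnD leq_mul.
Qed.

Lemma smallV b u : small b u -> small b u^-1.
Proof.
case: (eqVneq u 0) => [->|u0]; first by rewrite invr0.
case/andP=> n1 d1; rewrite -(divq_num_den u) invf_div.
by apply: small_frac => //; rewrite numq_eq0.
Qed.

Lemma small_div b1 b2 u v : small b1 u -> small b2 v -> small (b1 + b2) (u / v).
Proof. by move=> h1 /smallV; apply: smallM. Qed.

Lemma small_floor b u : small b u -> small b.+1 (Num.floor u)%:~R.
Proof.
case/andP=> hn hd; apply: small_int.
have hu : `|u| <= `|numq u|%:~R.
  rewrite -[u in leLHS]divq_num_den normrM normfV -!intr_norm.
  rewrite ler_pdivrMr ?ltr0z ?normr_gt0 ?denq_neq0 //.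
  by rewrite -intrM ler_int; have := denq_gt0 u; nia.
have := floor_itv u; case/andP=> h1 h2.
have h3 : - `|numq u| - 1 < Num.floor u.
  rewrite -(ltr_int rat); move: h1 h2 hu; rewrite ler_norml => h1 h2 /andP[h3 h4].
  by rewrite rmorphB rmorphN /=; move: h2; rewrite rmorphD /=; lra.
have h4 : Num.floor u <= `|numq u|.
  by rewrite -(ler_int rat); apply: le_trans h1 _; move: hu; rewrite ler_norml => /andP[].
rewrite expnS; have : (0 < 2 ^ b)%N by rewrite expn_gt0.
by move: hn h3 h4; lia.
Qed.

Lemma small_apply_op o b1 b2 u v :
  small b1 u -> small b2 v -> small (b1 + b2).+1 (apply_op o u v).
Proof.
move=> h1 h2; case: o => /=; try exact: small_bool.
- exact: smallD.
- exact: smallB.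
- exact: small_le (leqnSn _) (smallM h1 h2).
- exact: small_le (leqnSn _) (small_div h1 h2).
Qed.

Lemma small_sum (I : Type) (r : seq I) (P : pred I) (F : I -> rat) b :
  (forall i, P i -> small b (F i)) ->
  small (size r * b.+1) (\sum_(i <- r | P i) F i).
Proof.
move=> hF; elim: r => [|i r IH]; first by rewrite big_nil small0.
rewrite big_cons mulSn; case: ifP => [Pi|_].
  by rewrite addSn; apply: smallD (hF _ Pi) IH.
by apply: small_le IH; rewrite leq_addl.
Qed.

Lemma small_sum_ord k (P : pred 'I_k) (F : 'I_k -> rat) b :
  (forall i, P i -> small b (F i)) -> small (k * b.+1) (\sum_(i | P i) F i).
Proof.
move=> hF; have := small_sum (index_enum 'I_k) hF.
by rewrite /index_enum -[locked_with _ _]enumT size_enum_ord.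
Qed.

(** * Values and costs of expressions over a memory of bounded numbers *)

Definition small_memory (B : nat) (mu : memory) := forall x idx, small B (mu x idx).

Lemma small_update B mu x idx v :
  small_memory B mu -> small B v -> small_memory B (update mu x idx v).
Proof. by move=> h hv y idx'; rewrite /update; case: ifP. Qed.

(** The value of a [Get] does not grow with its index expressions; they are counted so that the
    weight of an expression dominates that of each subexpression, as [eval_cost_le] requires. *)
Fixpoint expr_weight (e : expr) : nat :=
  match e with
  | Cst q => bit_length q
  | Get _ es => (sumn (map expr_weight es)).+1
  | Floor e1 => (expr_weight e1).+1
  | Op _ e1 e2 => (expr_weight e1 + expr_weight e2).+1
  end.

Fixpoint expr_nodes (e : expr) : nat :=
  match e with
  | Cst q => 1
  | Get _ es => (sumn (map expr_nodes es)).+1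
  | Floor e1 => (expr_nodes e1).+1
  | Op _ e1 e2 => (expr_nodes e1 + expr_nodes e2).+1
  end.

Lemma small_eval B mu e :
  small_memory B mu -> small (expr_weight e * B.+1) (eval mu e).
Proof.
move=> hmu; elim: e => [q|x es|e IH|o e1 IH1 e2 IH2] /=.
- by apply: small_le (bit_length_small q); rewrite leq_pmulr.
- by apply: small_le (hmu _ _); rewrite mulSn; lia.
- by apply: small_le (small_floor IH); rewrite mulSn; lia.
- by apply: small_le (small_apply_op _ IH1 IH2); rewrite mulSn mulnDl; lia.
Qed.

(* The list of subexpressions in [Get] makes the generated induction principle too weak. *)
Lemma eval_cost_le B mu : small_memory B mu ->
  forall e, (eval_cost mu e <= expr_nodes e * (2 * (expr_weight e * B.+1).+1))%N.
Proof.
move=> hmu; fix IH 1; case=> [q|x es|e|o e1 e2] /=.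
- by rewrite addn0 mul1n; apply: small_bit_length; apply: (small_eval (Cst q) hmu).
- rewrite mulSn; apply: leq_add.
    exact: small_bit_length (small_eval (Get x es) hmu).
  elim: es => [//|e es IHes] /=; rewrite mulnDl; apply: leq_add.
    apply: leq_trans (IH e) _; rewrite leq_mul2l leq_mul2l /= ltnS leq_mul2r /=.
    by apply/orP; right; lia.
  apply: leq_trans IHes _; rewrite leq_mul2l leq_mul2l /= ltnS leq_mul2r /=.
  by apply/orP; right; lia.
- rewrite mulSn; apply: leq_add.
    exact: small_bit_length (small_eval (Floor e) hmu).
  apply: leq_trans (IH e) _; rewrite leq_mul2l leq_mul2l /= ltnS leq_mul2r /=.
  by apply/orP; right; lia.
- rewrite mulSn; apply: leq_add.
    exact: small_bit_length (small_eval (Op o e1 e2) hmu).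
  rewrite mulnDl; apply: leq_add.
    apply: leq_trans (IH e1) _; rewrite leq_mul2l leq_mul2l /= ltnS leq_mul2r /=.
    by apply/orP; right; lia.
  apply: leq_trans (IH e2) _; rewrite leq_mul2l leq_mul2l /= ltnS leq_mul2r /=.
  by apply/orP; right; lia.
Qed.

Lemma at_ord_val k (f : 'I_k -> rat) (i : 'I_k) : at_ord f i = f i.
Proof. by rewrite /at_ord; case: insubP => [j _ /val_inj ->|]; rewrite ?ltn_ord. Qed.

(** * Programs with bounded loops *)

(* [For x y p] runs [p] with the scalar [x] equal to 0, 1, ..., up to the value of
   the scalar [y], excluded. *)
Inductive cmd :=
  | Do of nat & seq expr & expr
  | Then of cmd & cmd
  | For of nat & nat & cmd
  | AskAssort of nat & expr & nat
  | AskChoice of nat & expr & expr & nat.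

(** The machine compares only by [<=] and equality, so [x < y] is tested as [x + 1 <= y]. *)
Definition for_test (x y : nat) : expr :=
  Op OpLeq (Op OpAdd (Get x [::]) (Cst 1)) (Get y [::]).
Definition for_incr (x : nat) : expr := Op OpAdd (Get x [::]) (Cst 1).

Fixpoint compile (p : cmd) : program :=
  match p with
  | Do x es e => Assign x es e
  | Then p q => Seq (compile p) (compile q)
  | For x y p =>
      Seq (Assign x [::] (Cst 0))
          (While (for_test x y) (Seq (compile p) (Assign x [::] (for_incr x))))
  | AskAssort x e y => QueryAssort x e y
  | AskChoice x e1 e2 y => QueryChoice x e1 e2 y
  end.

Fixpoint writes (p : cmd) : seq nat :=
  match p with
  | Do x _ _ => [:: x]
  | Then p q => writes p ++ writes q
  | For x _ p => x :: writes p
  | AskAssort x _ _ => [:: x]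
  | AskChoice x _ _ _ => [:: x]
  end.

Definition expr_bound (B : nat) (e : expr) : nat :=
  (expr_nodes e * (2 * (expr_weight e * B.+1).+1))%N.

(* [B] bounds the sizes of the numbers in memory and [M] the lengths of the loops. *)
Fixpoint cost_bound (B M : nat) (p : cmd) : nat :=
  match p with
  | Do _ es e => (1 + sumn (map (expr_bound B) es) + expr_bound B e)%N
  | Then p q => (1 + cost_bound B M p + cost_bound B M q)%N
  | For x y p =>
      (1 + (1 + expr_bound B (Cst 0)) + (1 + expr_bound B (for_test x y) +
       M * (1 + expr_bound B (for_test x y) +
            (1 + cost_bound B M p + (1 + expr_bound B (for_incr x))))))%N
  | AskAssort _ e _ => (1 + expr_bound B e + M * (1 + 2 * B.+1))%N
  | AskChoice _ e1 e2 _ =>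
      (1 + expr_bound B e1 + expr_bound B e2 + M * (1 + 2 * B.+1) + 2 * B.+1)%N
  end.

Lemma updateE mu x idx v idx' :
  update mu x idx v x idx' = if idx' == idx then v else mu x idx'.
Proof. by rewrite /update eqxx. Qed.

Lemma updateN mu x idx v y idx' :
  (y == x) = false -> update mu x idx v y idx' = mu y idx'.
Proof. by rewrite /update => ->. Qed.

Lemma small_at_ord b k (f : 'I_k -> rat) x :
  (forall i, small b (f i)) -> small b (at_ord f x).
Proof. by move=> hf; rewrite /at_ord; case: insub => [i|] /=; rewrite ?small0. Qed.

Section Runs.
Variables (n m : nat).
Variables (opt : 'I_m -> {ffun 'I_n -> rat} -> {set 'I_n}).
Variables (phi : 'I_n -> 'I_m -> {set 'I_n} -> rat).
Variables (B M : nat).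
Hypotheses (n_le : (n <= M)%N) (M_le : (M <= B)%N).

Definition frame (ws : seq nat) (mu mu' : memory) :=
  forall z idx, (z \in ws) = false -> mu' z idx = mu z idx.

(** Total correctness together with the cost bound, the size bound on the memory and the frame
    condition. After the rules below, a proof about a command only has to deal with values and their
    sizes. *)
Definition runs (p : cmd) (mu : memory) (Q : memory -> Prop) : Prop :=
  exists k mu', [/\ exec opt phi (compile p) mu k mu', (k <= cost_bound B M p)%N,
                    small_memory B mu', frame (writes p) mu mu' & Q mu'].

Lemma runs_conseq p mu (Q Q' : memory -> Prop) :
  runs p mu Q ->
  (forall mu', small_memory B mu' -> frame (writes p) mu mu' -> Q mu' -> Q' mu') ->
  runs p mu Q'.
Proof.
by move=> [k [mu' [h1 h2 h3 h4 h5]]] h; exists k, mu'; split=> //; apply: h.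
Qed.

Lemma runs_Then p q mu (P Q : memory -> Prop) :
  runs p mu P ->
  (forall mu', small_memory B mu' -> frame (writes p) mu mu' -> P mu' ->
    runs q mu' Q) ->
  runs (Then p q) mu Q.
Proof.
move=> [k1 [mu1 [h1 h2 h3 h4 h5]]] h.
have [k2 [mu2 [g1 g2 g3 g4 g5]]] := h mu1 h3 h4 h5.
exists (1 + k1 + k2)%N, mu2; split=> //=.
- exact: ExecSeq h1 g1.
- by rewrite leq_add // leq_add2l.
- move=> z idx; rewrite mem_cat => /negbT; rewrite negb_or => /andP[z1 z2].
  by rewrite g4 ?h4 //; apply/negbTE.
Qed.

Lemma sum_expr_cost mu es : small_memory B mu ->
  (sumn (map (eval_cost mu) es) <= sumn (map (expr_bound B) es))%N.
Proof.
by move=> hmu; elim: es => //= e es IH; apply: leq_add => //; apply: eval_cost_le.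
Qed.

Lemma runs_Do x es e mu (Q : memory -> Prop) :
  small_memory B mu -> small B (eval mu e) ->
  Q (update mu x [seq Num.truncn (eval mu e') | e' <- es] (eval mu e)) ->
  runs (Do x es e) mu Q.
Proof.
move=> hmu hv hQ; eexists _, _; split; [exact: ExecAssign| | | |exact: hQ] => /=.
- by rewrite leq_add ?eval_cost_le // leq_add2l sum_expr_cost.
- exact: small_update.
- by move=> z idx; rewrite inE => hz; rewrite updateN.
Qed.

Lemma runs_Do_then x es e q mu (Q : memory -> Prop) :
  small_memory B mu -> small B (eval mu e) ->
  (forall mu', small_memory B mu' ->
    mu' = update mu x [seq Num.truncn (eval mu e') | e' <- es] (eval mu e) ->
    runs q mu' Q) ->
  runs (Then (Do x es e) q) mu Q.
Proof.
move=> hmu hv hQ.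
apply: (runs_Then (P := fun mu' =>
    mu' = update mu x [seq Num.truncn (eval mu e') | e' <- es] (eval mu e))).
  exact: runs_Do.
by move=> mu' s1 _ e1; apply: hQ.
Qed.

Lemma query_cost mu y : small_memory B mu ->
  (\sum_(i < n) (1 + bit_length (mu y [:: val i])) <= M * (1 + 2 * B.+1))%N.
Proof.
move=> hmu; apply: (@leq_trans (\sum_(i < n) (1 + 2 * B.+1))%N).
  by apply: leq_sum => i _; rewrite leq_add2l small_bit_length.
by rewrite sum_nat_const card_ord leq_mul2r n_le orbT.
Qed.

Lemma runs_AskAssort x e y mu (j : 'I_m) (Q : memory -> Prop) :
  small_memory B mu -> eval mu e = (val j)%:R ->
  (forall mu', frame [:: x] mu mu' ->
    (forall i : 'I_n, mu' x [:: val i] = (i \in opt j (rewards_at n mu y))%:R) ->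
    Q mu') ->
  runs (AskAssort x e y) mu Q.
Proof.
move=> hmu hj hQ; eexists _, _; split; [exact: ExecQueryAssort| | | |] => /=.
- by rewrite leq_add ?query_cost // leq_add2l eval_cost_le.
- move=> z idx; rewrite /assort_update; case: ifP => // _.
  by do 2 (apply: small_at_ord => ?); exact: small_bool.
- by move=> z idx; rewrite inE /assort_update => ->.
- apply: hQ; first by move=> z idx; rewrite inE /assort_update => ->.
  by move=> i; rewrite /assort_update /= eqxx ltn_ord hj natrK /at_ord !valK.
Qed.

Lemma runs_AskChoice x e1 e2 y mu (i : 'I_n) (j : 'I_m) (Q : memory -> Prop) :
  small_memory B mu -> eval mu e1 = (val i)%:R -> eval mu e2 = (val j)%:R ->
  small B (phi i j (set_at n mu y)) ->
  Q (update mu x [::] (phi i j (set_at n mu y))) ->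
  runs (AskChoice x e1 e2 y) mu Q.
Proof.
move=> hmu hi hj hs hQ; eexists _, _; split; [exact: ExecQueryChoice| | | |] => /=.
all: have hc : choice_value phi mu (Num.truncn (eval mu e1))
  (Num.truncn (eval mu e2)) y = phi i j (set_at n mu y)
  by rewrite hi hj !natrK /choice_value /at_ord !valK.
all: rewrite ?hc //.
- apply: leq_add; last exact: small_bit_length.
  by apply: leq_add; rewrite ?query_cost // leq_add ?leq_add2l ?eval_cost_le.
- exact: small_update.
- by move=> z idx; rewrite inE => hz; rewrite updateN.
Qed.

(** [Inv k] describes the memory after [k] iterations with the counter already set to [k], which
    explains the updates of [x] in the premises. As the body writes neither [x] nor [y], the test
    always compares [k] with [K]. *)
Lemma runs_For x y p mu Q K (Inv : nat -> memory -> Prop) :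
  x \notin writes p -> y \notin x :: writes p ->
  (K <= M)%N -> small_memory B mu -> mu y [::] = K%:R ->
  Inv 0%N (update mu x [::] 0) ->
  (forall k mu', (k < K)%N -> small_memory B mu' ->
     frame (x :: writes p) mu mu' -> mu' x [::] = k%:R -> Inv k mu' ->
     runs p mu' (fun mu2 => Inv k.+1 (update mu2 x [::] k.+1%:R))) ->
  (forall mu', small_memory B mu' -> frame (x :: writes p) mu mu' -> Inv K mu' ->
     Q mu') ->
  runs (For x y p) mu Q.
Proof.
move=> xp yp K_le hmu hy inv0 step hQ.
set body := Seq (compile p) (Assign x [::] (for_incr x)).
set tc := expr_bound B (for_test x y).
set ic := (1 + cost_bound B M p + (1 + expr_bound B (for_incr x)))%N.
have y_x : (y == x) = false by apply/negbTE; move: yp; rewrite inE negb_or => /andP[].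
(* Induction on the number [d] of iterations that remain. *)
have loop d : forall k mu1, (k + d = K)%N -> small_memory B mu1 ->
    frame (x :: writes p) mu mu1 -> mu1 x [::] = k%:R -> Inv k mu1 ->
    exists c mu', [/\ exec opt phi (While (for_test x y) body) mu1 c mu',
      (c <= 1 + tc + d * (1 + tc + ic))%N, small_memory B mu',
      frame (x :: writes p) mu mu' & Inv K mu'].
  elim: d => [|d IH] k mu1 hk s1 f1 x1 i1.
    move: hk; rewrite addn0 => hk; exists (1 + eval_cost mu1 (for_test x y))%N, mu1.
    split=> //; last by rewrite -hk.
      apply: ExecWhileStop; rewrite /for_test /= x1 f1 ?hy; last exact/negbTE.
      by rewrite hk natr1 ler_nat ltnn.
    by rewrite mul0n addn0 leq_add2l eval_cost_le.
  have kK : (k < K)%N by rewrite -hk; lia.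
  have [c1 [mu2 [e1 l1 s2 f2 i2]]] := step k mu1 kK s1 f1 x1 i1.
  have x2 : mu2 x [::] = k%:R by rewrite f2 //; apply/negbTE.
  set mu3 := update mu2 x [::] k.+1%:R.
  have s3 : small_memory B mu3.
    by apply: small_update => //; apply: small_natS; apply: leq_trans M_le;
      apply: leq_trans K_le.
  have f3 : frame (x :: writes p) mu mu3.
    move=> z idx hz; move: (hz); rewrite inE => /negbT; rewrite negb_or => /andP[z1 z2].
    by rewrite /mu3 updateN ?f2 ?f1 //; apply/negbTE.
  have [||c2 [mu4 [e4 l4 s4 f4 i4]]] := IH k.+1 mu3 _ s3 f3 _ i2.
  - by rewrite -hk; lia.
  - by rewrite /mu3 updateE.
  have hb : exec opt phi body mu1
      (1 + c1 + (1 + 0 + eval_cost mu2 (for_incr x)))%N mu3.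
    apply: (ExecSeq e1).
    have := ExecAssign opt phi mu2 x [::] (for_incr x).
    by rewrite /= /mu3 x2 natr1.
  exists (1 + eval_cost mu1 (for_test x y) +
    (1 + c1 + (1 + 0 + eval_cost mu2 (for_incr x))) + c2)%N, mu4; split=> //.
    apply: ExecWhileStep hb e4.
    rewrite /for_test /= x1 f1 ?hy; last exact/negbTE.
    by rewrite natr1 ler_nat kK.
  have h1 := eval_cost_le s1 (for_test x y); have h2 := eval_cost_le s2 (for_incr x).
  rewrite mulSn; move: l1 l4 h1 h2; rewrite -/(expr_bound B _) -/(expr_bound B _).
  by rewrite -/tc /ic addn0; lia.
have s0 : small_memory B (update mu x [::] 0) by apply: small_update => //; apply: small0.
have f0 : frame (x :: writes p) mu (update mu x [::] 0).
  by move=> z idx; rewrite inE => /negbT; rewrite negb_or => /andP[/negbTE z1 _]; rewrite updateN.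
have [||c [mu' [e1 l1 s1 f1 i1]]] := loop K 0%N _ _ s0 f0 _ inv0.
- by rewrite add0n.
- by rewrite updateE.
exists (1 + (1 + 0 + eval_cost mu (Cst 0)) + c)%N, mu'; split=> //; last exact: hQ.
  by apply: ExecSeq e1; apply: (ExecAssign opt phi mu x [::] (Cst 0)).
apply: leq_add.
  by rewrite leq_add2l addn0 leq_add2l eval_cost_le.
by apply: leq_trans l1 _; rewrite leq_add2l leq_mul2r K_le orbT.
Qed.

End Runs.

(** * Polynomial bounds *)

(** The value at 0 is excluded because [c * 0 ^ k] vanishes for positive [k]; input sizes are
    positive. *)
Definition poly_bounded (f : nat -> nat) : Prop :=
  exists c k, forall z, (0 < z)%N -> (f z <= c * z ^ k)%N.

Lemma poly_bounded_cst c : poly_bounded (fun=> c).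
Proof. by exists c, 0%N => z _; rewrite expn0 muln1. Qed.

Lemma poly_bounded_id : poly_bounded id.
Proof. by exists 1%N, 1%N => z _; rewrite expn1 mul1n. Qed.

Lemma poly_boundedD f g :
  poly_bounded f -> poly_bounded g -> poly_bounded (fun z => (f z + g z)%N).
Proof.
move=> [c [k hf]] [c' [k' hg]]; exists (c + c')%N, (k + k')%N => z z0.
rewrite mulnDl; apply: leq_add.
  by apply: leq_trans (hf z z0) _; rewrite leq_mul2l leq_pexp2l ?leq_addr ?orbT.
by apply: leq_trans (hg z z0) _; rewrite leq_mul2l leq_pexp2l ?leq_addl ?orbT.
Qed.

Lemma poly_boundedM f g :
  poly_bounded f -> poly_bounded g -> poly_bounded (fun z => (f z * g z)%N).
Proof.
move=> [c [k hf]] [c' [k' hg]]; exists (c * c')%N, (k + k')%N => z z0.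
by rewrite expnD mulnACA leq_mul ?hf ?hg.
Qed.

Lemma poly_boundedX f k : poly_bounded f -> poly_bounded (fun z => (f z ^ k)%N).
Proof.
move=> hf; elim: k => [|k IH]; first exact: poly_bounded_cst.
have [c [k' h]] := poly_boundedM hf IH.
by exists c, k' => z z0; rewrite expnS h.
Qed.

Lemma poly_boundedS f : poly_bounded f -> poly_bounded (fun z => (f z).+1).
Proof. exact: (poly_boundedD (poly_bounded_cst 1)). Qed.

Ltac poly_tac := repeat match goal with
  | |- poly_bounded (fun z => ?c) => exact (poly_bounded_cst c)
  | |- poly_bounded (fun z => z) => exact poly_bounded_id
  | |- poly_bounded (fun z => addn (@?f z) (@?g z)) => apply (@poly_boundedD f g)
  | |- poly_bounded (fun z => muln (@?f z) (@?g z)) => apply (@poly_boundedM f g)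
  | |- poly_bounded (fun z => expn (@?f z) ?k) => apply (@poly_boundedX f k)
  | |- poly_bounded (fun z => S (@?f z)) => apply (@poly_boundedS f)
  | |- poly_bounded (fun z => ?f z) => change (poly_bounded f); assumption
  end.

Lemma poly_bounded_expr_bound (B : nat -> nat) e :
  poly_bounded B -> poly_bounded (fun z => expr_bound (B z) e).
Proof. by move=> hB; rewrite /expr_bound; poly_tac. Qed.

Lemma poly_bounded_cost (B M : nat -> nat) p : poly_bounded B -> poly_bounded M ->
  poly_bounded (fun z => cost_bound (B z) (M z) p).
Proof.
move=> hB hM; have he := fun e => @poly_bounded_expr_bound B e hB.
have hs es : poly_bounded (fun z => sumn (map (expr_bound (B z)) es)).
  by elim: es => [|e es IH] /=; poly_tac; [exact: he | exact: IH].
elim: p => [x es e|p IHp q IHq|x y p IH|x e y|x e1 e2 y];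
  rewrite [cost_bound]lock -lock; cbn [cost_bound].
all: do ?[exact: he | exact: hs | exact: poly_bounded_id | exact: poly_bounded_cst
  | assumption | apply: poly_boundedD | apply: poly_boundedM | apply: poly_boundedS].
Qed.

Lemma poly_bounded_exponent f : poly_bounded f ->
  exists d, forall z, (0 < z)%N -> (f z <= d * z ^ d)%N.
Proof.
move=> [c [k h]]; exists (c + k)%N => z z0; apply: leq_trans (h z z0) _.
by apply: leq_mul; rewrite ?leq_addr // leq_pexp2l ?leq_addl.
Qed.

(** * Conditional expectation along a policy *)

Section Expectation.
Variables (R : realType) (n m L T : nat) (I : problem R n m L T).
Implicit Types (pi : policy R n m L) (h : history n m L) (e : event n m L).

(** [event_prob] takes its period as an ordinal; the value 0 for histories of length at least [T]
    makes the recursion below total. *)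
Definition step_prob pi h e : R :=
  oapp (fun t : 'I_T => event_prob I pi t h e) 0 (insub (size h)).

(* The conditional expectation of [F] of the history after [k] more periods. *)
Fixpoint expect pi (k : nat) (F : history n m L -> R) h : R :=
  if k is k'.+1 then
    \sum_e step_prob pi h e * expect pi k' F (rcons h e)
  else F h.

(** Splitting off the first event turns the sum over whole paths into nested one-step expectations,
    on which the martingale arguments work. *)
Lemma expect_paths pi F k g :
  expect pi k F g =
  \sum_(h : k.-tuple (event n m L))
    (\prod_(t < k) step_prob pi (g ++ take t h) (tnth h t)) * F (g ++ h).
Proof.
elim: k g => [|k IH] g /=.
  rewrite (big_pred1 (nil_tuple _)) => [|h]; last by apply/esym/eqP/val_inj; case: h => [[]].
  by rewrite big_ord0 mul1r cats0.
transitivity (\sum_(p : event n m L * k.-tuple (event n m L))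
   (\prod_(t < k.+1) step_prob pi (g ++ take t (p.1 :: p.2)) (tnth [tuple of p.1 :: p.2] t))
     * F (g ++ p.1 :: p.2)).
  rewrite -(pair_bigA _ (fun e (h : k.-tuple _) =>
    (\prod_(t < k.+1) step_prob pi (g ++ take t (e :: h)) (tnth [tuple of e :: h] t))
     * F (g ++ e :: h))) /=.
  apply: eq_bigr => e _; rewrite IH big_distrr /=; apply: eq_bigr => h _.
  rewrite big_ord_recl /= cats0 tnth0 mulrA cat_rcons; congr (_ * _ * _).
  
  by apply: eq_bigr => t _; rewrite tnthS cat_rcons.
rewrite (reindex (fun h : k.+1.-tuple (event n m L) => (thead h, [tuple of behead h]))) /=.
  apply: eq_bigr => h _; case/tupleP: h => e h /=; rewrite theadE.
  by congr (_ * _); apply: eq_bigr => t _; congr step_prob; rewrite !(tnth_nth e).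
exists (fun p : event n m L * k.-tuple (event n m L) => [tuple of p.1 :: p.2]) => [h _|[e h] _] /=.
  by rewrite -tuple_eta.
by rewrite theadE; congr pair; apply/val_inj.
Qed.

Definition profit_of h : R := \sum_(e <- h) event_profit I e.

Lemma expected_profitE pi :
  expected_profit I pi = expect pi T profit_of [::].
Proof.
rewrite expect_paths /expected_profit; apply: eq_bigr => h _; congr (_ * _).
  apply: eq_bigr => t _; rewrite /step_prob /= size_takel; last first.
    by rewrite size_tuple ltnW.
  by rewrite valK.
by rewrite cat0s /profit_of big_tuple.
Qed.

End Expectation.

(** * Weak duality *)

Lemma sum_option (V : nmodType) (A : finType) (F : option A -> V) :
  \sum_e F e = F None + \sum_a F (Some a).
Proof.
rewrite (bigD1 None) //=; congr (_ + _).
rewrite (reindex_omap Some id) /=; last by case.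
by apply: eq_bigl => a; rewrite eqxx.
Qed.

Section Duality.
Variables (R : realType) (n m L T : nat) (I : problem R n m L T).
Hypothesis validI : valid_problem I.
Implicit Types (pi : policy R n m L) (h : history n m L) (e : event n m L).

Let phi := choice_prob I.
Let lam := arrival I.

Definition stochastic pi : Prop := forall h j, (size h < T)%N ->
  (forall a, 0 <= pi h j a) /\ \sum_a pi h j a = 1.

Lemma admissible_proper c pi : admissible T c pi -> stochastic pi.
Proof. by move=> hpi h j hT; case: (hpi h j hT). Qed.

Lemma step_prob_ge0 pi h e : stochastic pi -> (size h < T)%N -> 0 <= step_prob I pi h e.
Proof.
move=> hpi hT; rewrite /step_prob insubT /=; case: e => [[[j a] o]|] /=.
  have [p0 _] := hpi h j hT; apply: mulr_ge0.
    by apply: mulr_ge0 => //; apply: arrival_ge0.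
  by case: o => [i|]; rewrite ?subr_ge0; [apply: choice_ge0 | apply: choice_sum].
by rewrite subr_ge0; apply: arrival_sum.
Qed.

Lemma sum_step_prob pi h (hT : (size h < T)%N) (G : event n m L -> R) :
  \sum_e step_prob I pi h e * G e =
  (1 - \sum_j lam j (Ordinal hT)) * G None +
  \sum_j lam j (Ordinal hT) * \sum_a pi h j a *
    ((1 - \sum_i phi i j a.1) * G (Some (j, a, None)) +
     \sum_i phi i j a.1 * G (Some (j, a, Some i))).
Proof.
rewrite sum_option; congr (_ + _); first by rewrite /step_prob insubT.
pose F j (a : action n L) o := step_prob I pi h (Some (j, a, o)) * G (Some (j, a, o)).
transitivity (\sum_(p : 'I_m * action n L) \sum_o F p.1 p.2 o).
  by rewrite pair_bigA /=; apply: eq_bigr => -[[j a] o].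
transitivity (\sum_j \sum_a \sum_o F j a o).
  by rewrite [RHS]pair_bigA /=; apply: eq_bigr => -[j a].
apply: eq_bigr => j _; rewrite big_distrr /=; apply: eq_bigr => a _.
rewrite sum_option mulrA mulrDr /F /step_prob insubT /=; congr (_ + _).
  by rewrite !mulrA.
by rewrite big_distrr /=; apply: eq_bigr => i _; rewrite !mulrA.
Qed.

Lemma step_prob_total pi h : stochastic pi -> (size h < T)%N ->
  \sum_e step_prob I pi h e = 1.
Proof.
move=> hpi hT; have := sum_step_prob pi hT (fun=> 1).
under eq_bigr do rewrite mulr1.
move=> ->; rewrite mulr1.
under [X in _ + X]eq_bigr => j _.
  under eq_bigr => a _.
    rewrite mulr1; under [X in _ * (_ + X)]eq_bigr do rewrite mulr1.
    rewrite subrK mulr1; over.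
  rewrite (proj2 (hpi h j hT)) mulr1; over.
by rewrite subrK.
Qed.

Lemma expectZ pi (a : R) F k h :
  expect I pi k (fun h => a * F h) h = a * expect I pi k F h.
Proof.
elim: k h => [//|k IH] h /=; rewrite big_distrr /=; apply: eq_bigr => e _.
by rewrite IH mulrCA.
Qed.

Lemma expect_sum pi (J : Type) (r : seq J) (F : J -> history n m L -> R) k h :
  expect I pi k (fun h => \sum_(x <- r) F x h) h = \sum_(x <- r) expect I pi k (F x) h.
Proof.
elim: k h => [//|k IH] h /=; rewrite exchange_big /=; apply: eq_bigr => e _.
by rewrite IH big_distrr.
Qed.

(** A submartingale starts below its expected final value. The invariant [P] has to survive only the
    events of nonzero probability, which lets a proof restrict attention to the histories that the
    policy can produce. *)
Lemma expect_ge pi (P : history n m L -> Prop) (Phi F : history n m L -> R) :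
  stochastic pi ->
  (forall h e, P h -> (size h < T)%N -> step_prob I pi h e != 0 -> P (rcons h e)) ->
  (forall h, P h -> (size h < T)%N ->
     Phi h <= \sum_e step_prob I pi h e * Phi (rcons h e)) ->
  (forall h, P h -> size h = T -> Phi h <= F h) ->
  forall k h, (size h + k)%N = T -> P h -> Phi h <= expect I pi k F h.
Proof.
move=> hpi hP hstep hend; elim=> [|k IH] h hk Ph /=; first by apply: hend => //; lia.
have hT : (size h < T)%N by lia.
apply: le_trans (hstep h Ph hT) _; apply: ler_sum => e _.
have [->|e0] := eqVneq (step_prob I pi h e) 0; first by rewrite !mul0r.
apply: ler_wpM2l; first exact: step_prob_ge0.
by apply: IH; [rewrite size_rcons; lia | apply: hP].
Qed.

Lemma expect_le pi (Phi F : history n m L -> R) :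
  stochastic pi ->
  (forall h, (size h < T)%N ->
     \sum_e step_prob I pi h e * Phi (rcons h e) <= Phi h) ->
  (forall h, size h = T -> F h <= Phi h) ->
  expect I pi T F [::] <= Phi [::].
Proof.
move=> hpi hstep hend.
have hN : expect I pi T F [::] = - expect I pi T (fun h => -1 * F h) [::].
  by rewrite expectZ mulN1r opprK.
rewrite hN lerNl.
apply: (@expect_ge _ (fun=> True) (fun h => - Phi h)) => // h _ hT.
  rewrite lerNl -sumrN; apply: le_trans (hstep h hT).
  by apply: ler_sum => e _; rewrite mulrN opprK.
by rewrite mulN1r lerN2 hend.
Qed.

Lemma profit_rcons h e : profit_of I (rcons h e) = profit_of I h + event_profit I e.
Proof. by rewrite /profit_of -cats1 big_cat big_seq1. Qed.

Lemma inventory_rcons (c : placement n L) h e i l :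
  inventory c (rcons h e) i l = (inventory c h i l - served i l e)%N.
Proof. by rewrite /inventory -cats1 count_cat /= addn0 subnDA. Qed.

(* With prices [p] per unit of stock, profit so far plus the value of the remaining stock
   plus the best price-adjusted profit of the remaining customers is a supermartingale. *)
Lemma weak_duality c pi (p : 'I_n -> 'I_L -> R) (g : 'I_n -> 'I_m -> R)
    (best : 'I_m -> R) :
  admissible T c pi ->
  (forall i l, 0 <= p i l) -> (forall i j, 0 <= g i j) ->
  (forall i j l, reward I i j l - p i l <= g i j) ->
  (forall j S, \sum_i phi i j S * g i j <= best j) ->
  expected_profit I pi <=
  \sum_i \sum_l p i l * (c i l)%:R + \sum_j (\sum_t lam j t) * best j.
Proof.
move=> hpi p0 g0 hg hbest; rewrite expected_profitE.
pose stock h := \sum_i \sum_l p i l * (inventory c h i l)%:R.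
pose Phi h := profit_of I h + stock h +
  \sum_(t < T | (size h <= t)%N) \sum_j lam j t * best j.
have -> : \sum_i \sum_l p i l * (c i l)%:R + \sum_j (\sum_t lam j t) * best j
  = Phi [::].
  rewrite /Phi /profit_of big_nil add0r; congr (_ + _).
    by apply: eq_bigr => i _; apply: eq_bigr => l _; rewrite /inventory /= subn0.
  rewrite exchange_big /=; apply: eq_bigr => j _.
  by rewrite big_distrl.
have best0 j : 0 <= best j.
  apply: le_trans _ (hbest j finset.set0); apply: sumr_ge0 => i _.
  by apply: mulr_ge0 => //; apply: choice_ge0.
apply: expect_le; first exact: admissible_proper hpi.
- move=> h hT; rewrite sum_step_prob.
  pose rest := \sum_(t < T | (size h < t)%N) \sum_j lam j t * best j.
  have Phi_h : Phi h = profit_of I h + stock h + rest +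
      \sum_j lam j (Ordinal hT) * best j.
    rewrite /Phi -[RHS]addrA; congr (_ + _).
    rewrite (bigD1 (Ordinal hT)) //= addrC; congr (_ + _).
    by apply: eq_bigl => t; rewrite [in RHS]ltn_neqAle andbC eq_sym.
  pose base := profit_of I h + stock h + rest.
  have Phi0 e : event_profit I e = 0 -> (forall i l, ~~ served i l e) ->
      Phi (rcons h e) = base.
    move=> e0 es; rewrite /Phi profit_rcons e0 addr0 size_rcons; congr (_ + _ + _).
    apply: eq_bigr => i _; apply: eq_bigr => l _.
    by rewrite inventory_rcons (negbTE (es i l)) subn0.
  rewrite Phi0 //.
  have hsum j : \sum_a pi h j a *
     ((1 - \sum_i phi i j a.1) * Phi (rcons h (Some (j, a, None))) +
      \sum_i phi i j a.1 * Phi (rcons h (Some (j, a, Some i)))) <= base + best j.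
    have [q0 q1 qok] := hpi h j hT.
    have -> : base + best j = \sum_a pi h j a * (base + best j).
      by rewrite -big_distrl /= q1 mul1r.
    apply: ler_sum => a _.
    have [->|pa] := eqVneq (pi h j a) 0; first by rewrite !mul0r.
    have aok : action_ok c h a by apply: qok; rewrite lt_def pa q0.
    apply: ler_wpM2l => //.
    rewrite Phi0; [|by case: (a)|by case: (a)].
    (* A purchase changes the potential by the reward minus the price of the unit, hence by at most
       [g i j], and [best j] bounds the expectation of this over the choice. *)
    apply: (@le_trans _ _ ((1 - \sum_i phi i j a.1) * base +
       \sum_i phi i j a.1 * (base + g i j))); last first.
      have -> : \sum_i phi i j a.1 * (base + g i j) =
          (\sum_i phi i j a.1) * base + \sum_i phi i j a.1 * g i j.
        by rewrite big_distrl -big_split /=; apply: eq_bigr => i _; rewrite mulrDr.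
      by have := hbest j a.1; lra.
    apply: lerD => //; apply: ler_sum => i _.
    have [ia|ia] := boolP (i \in a.1); last by rewrite /phi choice_notin ?mul0r.
    apply: ler_wpM2l; first exact: choice_ge0.
    case: a ia aok {pa} => S f /= iS aok.
    case fi: (f i) => [l|]; last first.
      by rewrite Phi0 /= ?fi ?lerDl // => i' l'; case: eqP => // <-; rewrite fi.
    rewrite /Phi profit_rcons /= fi size_rcons -/rest.
    have hinv : (0 < inventory c h i l)%N by apply: aok.
    have -> : stock (rcons h (Some (j, (S, f), Some i))) = stock h - p i l.
      apply/eqP; rewrite eq_sym subr_eq eq_sym /stock; apply/eqP.
      rewrite (bigD1 i) //= [in RHS](bigD1 i) //= addrAC; congr (_ + _); last first.
        apply: eq_bigr => i' i'i; apply: eq_bigr => l' _.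
        by rewrite inventory_rcons /= eq_sym (negbTE i'i) subn0.
      rewrite (bigD1 l) //= [in RHS](bigD1 l) //= addrAC; congr (_ + _); last first.
        apply: eq_bigr => l' l'l.
        by rewrite inventory_rcons /= fi (inj_eq Some_inj) [l == l']eq_sym (negbTE l'l) andbF subn0.
      (* By [hinv] the truncated subtraction in the inventory is a genuine decrement, so exactly one
         price is lost. *)
      rewrite inventory_rcons /= fi !eqxx /= natrB // mulrBr mulr1; lra.
    by have := hg i j l; rewrite /base; lra.
  apply: (@le_trans _ _ ((1 - \sum_j lam j (Ordinal hT)) * base +
      \sum_j lam j (Ordinal hT) * (base + best j))).
    by apply: lerD => //; apply: ler_sum => j _; apply: ler_wpM2l => //; apply: arrival_ge0.
  have -> : \sum_j lam j (Ordinal hT) * (base + best j) =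
     (\sum_j lam j (Ordinal hT)) * base + \sum_j lam j (Ordinal hT) * best j.
    by rewrite big_distrl -big_split /=; apply: eq_bigr => j _; rewrite mulrDr.
  by rewrite Phi_h /base; lra.
- move=> h hT; rewrite /Phi -addrA lerDl; apply: addr_ge0.
    by do 2 (apply: sumr_ge0 => ? _); apply: mulr_ge0.
  apply: sumr_ge0 => t _; apply: sumr_ge0 => j _; apply: mulr_ge0 => //.
  exact: arrival_ge0.
Qed.

End Duality.

(** * Policies with reserved stock *)

Definition sold_in (n m L : nat) (i : 'I_n) (j : 'I_m) (l : 'I_L) (e : event n m L) :=
  if e is Some (j', (_, f), Some i') then [&& i' == i, j' == j & f i == Some l]
  else false.

Definition sold (n m L : nat) (i : 'I_n) (j : 'I_m) (l : 'I_L) (h : history n m L) :=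
  count (sold_in i j l) h.

Lemma sum_pred1 (V : pzSemiRingType) (J : finType) (F : J -> V) (x : J) :
  \sum_y F y * (x == y)%:R = F x.
Proof.
rewrite (bigD1 x) //= eqxx mulr1 big1 ?addr0 // => y /negbTE.
by rewrite eq_sym => ->; rewrite mulr0.
Qed.

Lemma count_served (n m L : nat) (i : 'I_n) (l : 'I_L) (h : history n m L) :
  count (served i l) h = (\sum_j sold i j l h)%N.
Proof.
elim: h => [|e h IH] /=; first by rewrite big1.
rewrite big_split /= -IH; congr addn.
case: e => [[[j' [A f]] [i'|]]|] /=; try by rewrite big1.
case: (i' == i) => /=; last by rewrite big1.
rewrite (bigD1 j') //= eqxx /= big1 ?addn0 // => j /negbTE.
by rewrite eq_sym => ->.
Qed.

Section Reservation.
Variables (R : realType) (n m L T : nat) (I : problem R n m L T).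
Hypothesis validI : valid_problem I.
Variables (D : nat) (offer : 'I_D -> 'I_m -> {set 'I_n}).
Variables (source : 'I_D -> 'I_m -> 'I_n -> option 'I_L).
Variables (quota : 'I_n -> 'I_m -> 'I_L -> nat).
Hypothesis D_gt0 : (0 < D)%N.

Definition quota_placement : placement n L := fun i l => (\sum_j quota i j l)%N.

(** [admissible] quantifies over all histories, including those that the policy never produces and
    in which other types may have exceeded their quotas; hence the test of the actual inventory. *)
Definition available (h : history n m L) i j l : bool :=
  (sold i j l h < quota i j l)%N && (0 < inventory quota_placement h i l)%N.

(* Stock is reserved for each customer type; a product whose reserved stock is used up
   is still offered but served virtually. *)
Definition reserve_action (h : history n m L) (j : 'I_m) (u : 'I_D) : action n L :=
  (offer u j, [ffun i => if source u j i is Some l then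
                 if available h i j l then Some l else None else None]).

Definition reserve_policy : policy R n m L := seeded_policy R reserve_action.

Lemma seeded_sum (act : history n m L -> 'I_m -> 'I_D -> action n L) h j
    (G : action n L -> R) :
  \sum_a seeded_policy R act h j a * G a = D%:R^-1 * \sum_u G (act h j u).
Proof.
under [in RHS]eq_bigr => u _ do rewrite -(sum_pred1 G (act h j u)).
rewrite exchange_big big_distrr /=; apply: eq_bigr => a _.
have -> : seeded_policy R act h j a = D%:R^-1 * \sum_u (act h j u == a)%:R.
  rewrite /seeded_policy -sum1_card natr_sum mulrC big_mkcond /=; congr (_ * _).
  by apply: eq_bigr => u _; rewrite inE; case: eqP.
by rewrite -big_distrr /= mulrAC mulrA.
Qed.

Lemma reserve_admissible : admissible T quota_placement reserve_policy.
Proof.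
move=> h j hT; split.
- by move=> a; rewrite /reserve_policy /seeded_policy divr_ge0.
- have := seeded_sum reserve_action h j (fun=> 1).
  under eq_bigr do rewrite mulr1.
  move=> ->; rewrite sumr_const card_ord mulVf // pnatr_eq0; lia.
- move=> a; rewrite /reserve_policy /seeded_policy => ha i l.
  have [u hu] : exists u, reserve_action h j u = a.
    case: (pickP [pred u | reserve_action h j u == a]) => [u /eqP|h0]; first by exists u.
    by move: ha; rewrite (eq_card0 (A := [set u | _])) ?mul0r ?ltxx // => u; rewrite inE; exact: h0.
  rewrite -hu /= ffunE => _; case: source => // l'.
  by case: ifP => // /andP[_ h0] [<-].
Qed.

Let phi := choice_prob I.
Let lam := arrival I.

(** The probability that an arriving customer of type [j] would buy [i] from [l] if stock never ran
    out. *)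
Definition assigned i j l : R :=
  D%:R^-1 * \sum_u phi i j (offer u j) * (source u j i == Some l)%:R.

Definition demand i j l : R := (\sum_t lam j t) * assigned i j l.

Lemma assigned_ge0 i j l : 0 <= assigned i j l.
Proof.
apply: mulr_ge0; first by rewrite invr_ge0.
by apply: sumr_ge0 => u _; apply: mulr_ge0 => //; apply: choice_ge0.
Qed.

Lemma sold_step h (hT : (size h < T)%N) i j l :
  \sum_e step_prob I reserve_policy h e * (sold_in i j l e)%:R =
  (available h i j l)%:R * (lam j (Ordinal hT) * assigned i j l).
Proof.
rewrite sum_step_prob mulr0 add0r (bigD1 j) //= [X in _ + X]big1 ?addr0; last first.
  move=> j' /negbTE j'j; rewrite big1 ?mulr0 // => -[S f] _ /=.
  rewrite mulr0 add0r big1 ?mulr0 // => i' _.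
  by rewrite j'j andbF mulr0.
rewrite mulrCA; congr (_ * _).
rewrite /reserve_policy seeded_sum mulrCA; congr (_ * _).
rewrite big_distrr /=; apply: eq_bigr => u _.
rewrite mulr0 add0r (bigD1 i) //= [X in _ + X]big1 ?addr0; last first.
  by move=> i' /negbTE ->; rewrite mulr0.
rewrite !eqxx /= ffunE mulrCA; congr (_ * _).
case: source => [l'|]; last by rewrite mulr0.
rewrite (inj_eq Some_inj); case: (eqVneq l' l) => [->|l'l].
  by case: ifP => _; rewrite ?eqxx ?mulr1.
by rewrite mulr0; case: ifP => // _; rewrite (inj_eq Some_inj) (negbTE l'l).
Qed.

Lemma sold_rcons i j l (h : history n m L) e :
  sold i j l (rcons h e) = (sold i j l h + sold_in i j l e)%N.
Proof. by rewrite /sold -cats1 count_cat /= addn0. Qed.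

Definition within_quota (h : history n m L) := forall i j l, (sold i j l h <= quota i j l)%N.

(** The other types have consumed at most their own quotas of the common stock, so a unit reserved
    for type [j] is still physically there. *)
Lemma available_within h i j l : within_quota h ->
  available h i j l = (sold i j l h < quota i j l)%N.
Proof.
move=> hq; rewrite /available; case: ltnP => //= hlt.
rewrite /inventory count_served /quota_placement subn_gt0.
rewrite (bigD1 j) //= [in ltnRHS](bigD1 j) //= -addSn leq_add //.
by apply: leq_sum => j' _; apply: hq.
Qed.

Lemma reserve_proper : stochastic T reserve_policy.
Proof. exact: admissible_proper reserve_admissible. Qed.

Lemma within_quota_rcons h e : within_quota h -> (size h < T)%N ->
  step_prob I reserve_policy h e != 0 -> within_quota (rcons h e).
Proof.
move=> hq hT e0 i j l; rewrite sold_rcons.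
case es: (sold_in i j l e); last by rewrite addn0.
rewrite addn1 -(available_within _ _ _ hq).
(* Without available stock the total probability of such a sale is 0, and so is each of its
   nonnegative terms. *)
apply: contraNT e0 => hav.
have := sold_step hT i j l; rewrite (negbTE hav) mul0r => h0.
have pos e' : true -> 0 <= step_prob I reserve_policy h e' * (sold_in i j l e')%:R.
  by move=> _; apply: mulr_ge0 => //; exact: step_prob_ge0 reserve_proper hT.
by have /(_ e isT) := psumr_eq0P pos h0; rewrite es mulr1 => ->; rewrite eqxx.
Qed.

Lemma sold_step_fun h (hT : (size h < T)%N) i j l (psi : nat -> R) :
  within_quota h ->
  \sum_e step_prob I reserve_policy h e * psi (sold i j l (rcons h e)) =
  let x := sold i j l h in
  if (x < quota i j l)%N then
    psi x + lam j (Ordinal hT) * assigned i j l * (psi x.+1 - psi x)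
  else psi x.
Proof.
move=> hq /=; set x := sold i j l h.
transitivity (\sum_e step_prob I reserve_policy h e * psi x +
   \sum_e step_prob I reserve_policy h e * (sold_in i j l e)%:R * (psi x.+1 - psi x)).
  rewrite -big_split /=; apply: eq_bigr => e _; rewrite sold_rcons -/x.
  by case: (sold_in i j l e); rewrite ?addn1 ?addn0 ?mulr1 ?mulr0 ?mul0r ?addr0 //; lra.
rewrite -!big_distrl /= (step_prob_total _ reserve_proper hT) mul1r sold_step.
rewrite available_within // -/x; case: ifP => _; first by rewrite mul1r.
by rewrite !mul0r addr0.
Qed.

Lemma sold_lower i j l (psi : nat -> nat -> R) :
  (forall x, (x <= quota i j l)%N -> psi T x <= x%:R) ->
  (forall (t : 'I_T) x, (x < quota i j l)%N ->
     psi t x <= psi t.+1 x + lam j t * assigned i j l * (psi t.+1 x.+1 - psi t.+1 x)) ->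
  (forall t, (t <= T)%N -> (quota i j l <= t)%N ->
     psi t (quota i j l) <= (quota i j l)%:R) ->
  psi 0%N 0%N <= expect I reserve_policy T (fun h => (sold i j l h)%:R) [::].
Proof.
move=> h1 h2 h3; set q := quota i j l in h1 h2 h3 *.
pose Psi t x := if (x < q)%N then psi t x else q%:R.
have Psi_ge t x : (t <= T)%N -> (x <= t)%N -> (x <= q)%N -> psi t x <= Psi t x.
  move=> tT xt xq; rewrite /Psi; case: ltnP => // qx.
  have -> : x = q by lia.
  by apply: h3 => //; apply: leq_trans xt.
apply: (@le_trans _ _ (Psi 0%N (sold i j l [::]))); first exact: Psi_ge.
apply: (expect_ge (P := fun h => within_quota h)
  (Phi := fun h => Psi (size h) (sold i j l h)) validI reserve_proper).
- exact: within_quota_rcons.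
- move=> h hq hT; under eq_bigr do rewrite size_rcons.
  rewrite (sold_step_fun hT _ _ _ (Psi (size h).+1) hq) /= -/q.
  have xh : (sold i j l h <= size h)%N by apply: count_size.
  rewrite {1}/Psi; case: ltnP => // xq; last by rewrite /Psi ltnNge xq.
  apply: le_trans (h2 (Ordinal hT) _ xq) _ => /=.
  have -> : Psi (size h).+1 (sold i j l h) = psi (size h).+1 (sold i j l h).
    by rewrite /Psi xq.
  rewrite lerD2l; apply: ler_wpM2l.
    by apply: mulr_ge0; [apply: arrival_ge0 | apply: assigned_ge0].
  by rewrite lerD2r; apply: Psi_ge => //; lia.
- move=> h hq hT; rewrite hT /Psi; case: ltnP => xq; first by apply: h1; apply: hq.
  by rewrite ler_nat.
- by [].
- by move=> i' j' l'.
Qed.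

Let tail i j l t : R := \sum_(s < T | (t <= s)%N) lam j s * assigned i j l.

Lemma tail_step i j l (t : 'I_T) :
  tail i j l t = lam j t * assigned i j l + tail i j l t.+1.
Proof.
rewrite /tail (bigD1 t) //=; congr (_ + _).
by apply: eq_bigl => s; rewrite [in RHS]ltn_neqAle andbC eq_sym.
Qed.

Lemma tail0 i j l : tail i j l 0 = demand i j l.
Proof. by rewrite /tail /demand big_distrl. Qed.

Lemma tail_end i j l : tail i j l T = 0.
Proof. by rewrite /tail big1 // => s; rewrite leqNgt ltn_ord. Qed.

Lemma tail_ge0 i j l t : 0 <= tail i j l t.
Proof.
apply: sumr_ge0 => s _; apply: mulr_ge0; first exact: arrival_ge0.
exact: assigned_ge0.
Qed.

(** A quota of at least [T] can be reached only at the end, where no demand remains, so the expected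
    sales are the full demand. *)
Lemma sold_ample i j l : (T <= quota i j l)%N ->
  demand i j l <= expect I reserve_policy T (fun h => (sold i j l h)%:R) [::].
Proof.
move=> hq; rewrite -tail0 -[leLHS]add0r.
apply: (sold_lower (psi := fun t x => x%:R + tail i j l t)).
- by move=> x _; rewrite tail_end addr0.
- by move=> t x _; rewrite tail_step -natr1; lra.
- move=> t tT qt; have -> : t = T by lia.
  by rewrite tail_end addr0.
Qed.

(* [psi] is the expectation of [gam * (Z - (Z - mu)^2 / (4 b))], a lower bound on
   [min(Z, quota)], where [Z] is the current number of sales plus the remaining demand,
   with the variance of the latter bounded by its mean. *)
Lemma sold_buffered i j l (gam b : R) :
  0 <= gam <= 1 -> 0 < b -> gam * demand i j l + b <= (quota i j l)%:R ->
  gam * (1 - (4 * b)^-1) * demand i j l <=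
  expect I reserve_policy T (fun h => (sold i j l h)%:R) [::].
Proof.
move=> /andP[g0 g1] b0 hq; set mu := demand i j l in hq *.
pose v := (4 * b)^-1; have v0 : 0 < v by rewrite invr_gt0; lra.
have vb : v * (4 * b) = 1 by rewrite mulVf //; lra.
pose psi t (x : nat) : R :=
  gam * ((x%:R + tail i j l t) - ((x%:R + tail i j l t - mu) ^+ 2 + tail i j l t) * v).
have -> : gam * (1 - v) * mu = psi 0%N 0%N.
  by rewrite /psi tail0 -/mu; ring.
apply: sold_lower.
- move=> x _; rewrite /psi tail_end !addr0.
  have h1 : 0 <= (x%:R - mu) ^+ 2 * v by rewrite mulr_ge0 ?sqr_ge0 // ltW.
  have h2 : (0 : R) <= x%:R by [].
  by nra.
- move=> t x _; rewrite /psi tail_step -natr1.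
  set q := lam j t * _; set r := tail _ _ _ _.
  (* The variance of this period is [q - q ^+ 2] while the remaining demand, which stands for the
     variance, falls by [q]; the difference is the slack. *)
  have : 0 <= gam * v * q ^+ 2 by rewrite mulr_ge0 ?sqr_ge0 // mulr_ge0 // ltW.
  by lra.
- move=> t tT qt; rewrite /psi.
  have := tail_ge0 i j l t; set r := tail _ _ _ _ => r0.
  have gq : gam * (mu + b) <= (quota i j l)%:R by apply: le_trans hq; nra.
  apply: le_trans gq; apply: ler_wpM2l => //.
  set z := _ + r; rewrite lerBlDr -subr_ge0.
  (* The concave parabola [z - (z - mu) ^+ 2 / (4 b)] has its maximum [mu + b] at [z = mu + 2 b];
     this choice of [v] makes the cap equal to demand plus buffer. *)
  have -> : mu + b + ((z - mu) ^+ 2 + r) * v - z = (z - mu - 2 * b) ^+ 2 * v + r * v.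
    have : b * (1 - v * (4 * b)) = 0 by rewrite vb; ring.
    have : (z - mu) * (1 - v * (4 * b)) = 0 by rewrite vb; ring.
    move=> e1 e2; apply/eqP; rewrite -subr_eq0; apply/eqP.
    transitivity (b * (1 - v * (4 * b)) - (z - mu) * (1 - v * (4 * b))); first by ring.
    by rewrite e1 e2 subrr.
  by rewrite addr_ge0 // mulr_ge0 ?sqr_ge0 // ltW.
Qed.

Lemma profit_sold (h : history n m L) :
  profit_of I h = \sum_i \sum_j \sum_l reward I i j l * (sold i j l h)%:R.
Proof.
elim: h => [|e h IH].
  rewrite /profit_of big_nil big1 // => i _; rewrite big1 // => j _.
  by rewrite big1 // => l _; rewrite mulr0.
rewrite /profit_of big_cons -/(profit_of I h) IH.
under [RHS]eq_bigr => i _.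
  under eq_bigr => j _.
    under eq_bigr => l _ do rewrite /= natrD mulrDr.
    rewrite big_split /=; over.
  rewrite big_split /=; over.
rewrite big_split /=; congr (_ + _).
case: e => [[[j [S f]] [i|]]|] /=; try by
  rewrite big1 // => ? _; rewrite big1 // => ? _; rewrite big1 // => ? _; rewrite mulr0.
rewrite (bigD1 i) //= [X in _ + X]big1 ?addr0; last first.
  move=> i' /negbTE i'i; rewrite big1 // => j' _; rewrite big1 // => l _.
  by rewrite eq_sym i'i mulr0.
rewrite (bigD1 j) //= [X in _ + X]big1 ?addr0; last first.
  move=> j' /negbTE j'j; rewrite big1 // => l _.
  by rewrite (eq_sym j) j'j andbF mulr0.
rewrite !eqxx /=; case: (f i) => [l|]; last by rewrite big1 // => l _; rewrite mulr0.
under eq_bigr do rewrite (inj_eq Some_inj).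
by rewrite sum_pred1.
Qed.

Lemma reserve_profit (ratio : R) :
  (forall u j i l, source u j i = Some l -> 0 <= reward I i j l) ->
  (forall i j l, ratio * demand i j l <=
     expect I reserve_policy T (fun h => (sold i j l h)%:R) [::]) ->
  ratio * \sum_i \sum_j \sum_l reward I i j l * demand i j l <=
  expected_profit I reserve_policy.
Proof.
move=> hsrc hsold; rewrite expected_profitE.
have -> : expect I reserve_policy T (profit_of I) [::] =
  \sum_i \sum_j \sum_l reward I i j l *
     expect I reserve_policy T (fun h => (sold i j l h)%:R) [::].
  rewrite (funext profit_sold).
  rewrite expect_sum; apply: eq_bigr => i _; rewrite expect_sum; apply: eq_bigr => j _.
  by rewrite expect_sum; apply: eq_bigr => l _; rewrite expectZ.
rewrite big_distrr /=; apply: ler_sum => i _.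
rewrite big_distrr /=; apply: ler_sum => j _.
rewrite big_distrr /=; apply: ler_sum => l _.
rewrite mulrCA; have [r0|r0] := leP 0 (reward I i j l); first exact: ler_wpM2l.
(* A triple with negative reward is never a source. Its demand is 0, and it remains to see that its
   expected sales are at most 0: with rate 0 they never leave their initial value in expectation. *)
have a0 : assigned i j l = 0.
  rewrite /assigned big1 ?mulr0 // => u _.
  by case: eqP => [/hsrc|_]; rewrite ?mulr0 // leNgt r0.
rewrite /demand a0 !mulr0 nmulr_rge0 //.
have -> : 0 = (sold i j l [::])%:R :> R by [].
apply: (expect_le (Phi := fun h => (sold i j l h)%:R) validI reserve_proper) => // h hT.
under eq_bigr => e _ do rewrite sold_rcons natrD mulrDr.
rewrite big_split /= -big_distrl /= (step_prob_total _ reserve_proper hT) mul1r.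
by rewrite sold_step a0 !mulr0 addr0.
Qed.

End Reservation.

(** * The subgradient method *)

(* The positive part of the largest of [d 0, ..., d (k - 1)] and one plus the first
   index where it is attained, or 0 if no value is positive. *)
Fixpoint scan (d : nat -> rat) (k : nat) : rat * nat :=
  if k is k'.+1 then
    let: (g, w) := scan d k' in if d k' <= g then (g, w) else (d k', k'.+1)
  else (0, 0%N).

Lemma scanP d k :
  [/\ 0 <= (scan d k).1,
      forall l, (l < k)%N -> d l <= (scan d k).1,
      (scan d k).2 = 0%N -> (scan d k).1 = 0 &
      forall l, (scan d k).2 = l.+1 ->
        [/\ (l < k)%N, d l = (scan d k).1 & 0 < (scan d k).1]].
Proof.
elim: k => [|k [IH1 IH2 IH3 IH4]] /=; first by [].
case: (scan d k) IH1 IH2 IH3 IH4 => g w /= h1 h2 h3 h4.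
case: (leP (d k) g) => hd /=; split=> //.
- by move=> l; rewrite ltnS leq_eqVlt => /orP[/eqP ->|/h2].
- by move=> l /h4[a b c]; split=> //; apply: leqW.
- exact: le_trans h1 (ltW hd).
- move=> l; rewrite ltnS leq_eqVlt => /orP[/eqP -> //|/h2 h].
  exact: le_trans h (ltW hd).
- by move=> l [<-]; split=> //; apply: le_lt_trans hd.
Qed.

(** The product with a truth value mirrors [e_pospart], as expressions of the machine have
    comparisons but no conditional. *)
Definition pospart (x : rat) : rat := (0 <= x)%R%:R * x.

Lemma pospart_ge0 x : 0 <= pospart x.
Proof. by rewrite /pospart; case: (leP 0 x) => h; rewrite ?mul1r ?mul0r. Qed.

Lemma pospart_ge x : x <= pospart x.
Proof. by rewrite /pospart; case: (leP 0 x) => h; rewrite ?mul1r ?mul0r // ltW. Qed.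

Lemma pospart_le0 x : x <= 0 -> pospart x = 0.
Proof.
by rewrite /pospart => x0; case: (leP 0 x) => h; rewrite ?mul1r ?mul0r //; lra.
Qed.

(** The positive part of [z + g] is at most the absolute value of [pospart z + g], whose square is
    then expanded. *)
Lemma pospart_sqrD z g t : -1 <= g <= t -> 1 <= t ->
  pospart (z + g) ^+ 2 <= pospart z ^+ 2 + 2 * (pospart z * g) + t ^+ 2.
Proof.
move=> /andP[g1 g2] t1.
have gt : g ^+ 2 <= t ^+ 2 by nra.
rewrite /pospart; case: (leP 0 z) => z0; case: (leP 0 (z + g)) => zg;
  rewrite ?mul1r ?mul0r; nra.
Qed.

Lemma sum_affine (J : finType) (a b : J -> rat) (c : rat) :
  \sum_x (a x + 2 * b x + c) = \sum_x a x + 2 * \sum_x b x + #|J|%:R * c.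
Proof. by rewrite !big_split /= sumr_const mulr_sumr mulr_natl. Qed.

Section Algorithm.
Variables (n m L T : nat) (I : problem rat n m L T).
Variables (opt : 'I_m -> {ffun 'I_n -> rat} -> {set 'I_n}).

Definition total_arrival (j : 'I_m) : rat := \sum_t arrival I j t.
Definition stock_cap (l : 'I_L) : rat := (capacity I l)%:R.
(* As in the input, an infinite supply is represented by 0. *)
Definition supply_cap (i : 'I_n) : rat := (odflt 0%N (supply I i))%:R.

Definition margin (p : 'I_n -> 'I_L -> rat) i j : nat -> rat :=
  at_ord (fun l => reward I i j l - p i l).
Definition gain p j i : rat := (scan (margin p i j) L).1.
Definition code p j i : nat := (scan (margin p i j) L).2.
Definition offered p j : {set 'I_n} := opt j [ffun i => gain p j i].
Definition sale p j i : rat := total_arrival j * choice_prob I i j (offered p j).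

(* The value of the relaxation without stock constraints. *)
Definition base : rat :=
  \sum_j \sum_i sale (fun _ _ => 0) j i * gain (fun _ _ => 0) j i.

(** The squared drifts of a round add up to at most [(L + n) T ^ 2]. Half of this times the step
    size is [1 / (32 T ^ 2)], the mean loss per round in units of [base], which is at most
    [1 / (32 T)] of the dual value. *)
Definition step_size : rat := (16 * T ^ 4 * (L + n))%:R^-1.

(* The prices after [s] iterations with cumulative sales [U] (per warehouse, shifted by
   one) and [V] (per product). *)
Definition stock_price (U : nat -> rat) (s : nat) (l : 'I_L) : rat :=
  step_size * base * (pospart (U l.+1 / stock_cap l - s%:R) / stock_cap l).
Definition supply_price (V : 'I_n -> rat) (s : nat) (i : 'I_n) : rat :=
  step_size * base * (pospart (V i / supply_cap i - s%:R) / supply_cap i).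
Definition price_of (x : (nat -> rat) * ('I_n -> rat)) s i l :=
  stock_price x.1 s l + supply_price x.2 s i.

Definition code_sales p (w : nat) : rat := \sum_j \sum_i sale p j i * (code p j i == w)%:R.
Definition product_sales p i : rat := \sum_j sale p j i * (code p j i != 0%N)%:R.

Fixpoint state (s : nat) : (nat -> rat) * ('I_n -> rat) :=
  if s is s'.+1 then
    let p := price_of (state s') s' in
    (fun w => (state s').1 w + code_sales p w,
     fun i => (state s').2 i + product_sales p i)
  else (fun=> 0, fun=> 0).

Definition prices (s : nat) := price_of (state s) s.

Definition cumulative (s : nat) i j (w : nat) : rat :=
  \sum_(s' < s) sale (prices s') j i * (code (prices s') j i == w)%:R.

(** The solution of [N * (33 T ^ 4 (L + n)) = (N / (16 T)) ^ 2]: the left side bounds the potential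
    after [N] rounds, the right side is the square of the tolerated overuse. *)
Definition rounds : nat := (33 * 16 * 16 * T ^ 6 * (L + n))%N.

Hypotheses (n_gt0 : (0 < n)%N) (m_gt0 : (0 < m)%N) (L_gt0 : (0 < L)%N) (T_gt0 : (0 < T)%N).
Hypotheses (validI : valid_problem I) (oracle : assortment_oracle I opt).

Let phi := choice_prob I.
Let lam := total_arrival.

Lemma total_arrival_ge0 j : 0 <= lam j.
Proof. by apply: sumr_ge0 => t _; apply: arrival_ge0. Qed.
Hint Resolve total_arrival_ge0 : core.

Lemma total_arrival_sum : \sum_j lam j <= T%:R.
Proof.
rewrite exchange_big /= -[T in leRHS]card_ord -sumr_const.
by apply: ler_sum => t _; apply: arrival_sum.
Qed.

Lemma sale_ge0 p j i : 0 <= sale p j i.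
Proof. by apply: mulr_ge0 => //; apply: choice_ge0. Qed.
Hint Resolve sale_ge0 : core.

Lemma sale_sum p j : \sum_i sale p j i <= lam j.
Proof.
by rewrite -big_distrr /= -[leRHS]mulr1 ler_wpM2l //; apply: choice_sum.
Qed.

Lemma all_sales : forall p, \sum_j \sum_i sale p j i <= T%:R.
Proof.
move=> p; apply: le_trans total_arrival_sum; apply: ler_sum => j _; exact: sale_sum.
Qed.

Lemma mul_bool_le (x : rat) (b : bool) : 0 <= x -> x * b%:R <= x.
Proof. by case: b; rewrite ?mulr1 ?mulr0. Qed.

Lemma code_sales_ge0 p w : 0 <= code_sales p w.
Proof. by do 2 (apply: sumr_ge0 => ? _); apply: mulr_ge0. Qed.

Lemma product_sales_ge0 p i : 0 <= product_sales p i.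
Proof. by apply: sumr_ge0 => ? _; apply: mulr_ge0. Qed.

Lemma code_sales_le p w : code_sales p w <= T%:R.
Proof.
apply: le_trans (all_sales p); apply: ler_sum => j _; apply: ler_sum => i _.
exact: mul_bool_le.
Qed.

Lemma product_sales_le p i : product_sales p i <= T%:R.
Proof.
apply: le_trans (all_sales p); apply: ler_sum => j _.
rewrite (bigD1 i) //= -[leLHS]addr0; apply: lerD; first exact: mul_bool_le.
exact: sumr_ge0.
Qed.

Lemma gain_ge0 p j i : 0 <= gain p j i.
Proof. by have [] := scanP (margin p i j) L. Qed.
Hint Resolve gain_ge0 : core.

Lemma gain_ge p j i l : reward I i j l - p i l <= gain p j i.
Proof.
have [_ h _ _] := scanP (margin p i j) L.
by have := h l (ltn_ord l); rewrite /margin at_ord_val.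
Qed.

Lemma code_gain p j i l : code p j i = (val l).+1 ->
  gain p j i = reward I i j l - p i l /\ 0 < gain p j i.
Proof.
have [_ _ _ h] := scanP (margin p i j) L => /h[_ e g0]; split=> //.
by rewrite /gain -e /margin at_ord_val.
Qed.

Lemma code0_gain p j i : code p j i = 0%N -> gain p j i = 0.
Proof. by have [_ _ h _] := scanP (margin p i j) L. Qed.

Lemma code_lt p j i w : code p j i = w.+1 -> (w < L)%N.
Proof. by have [_ _ _ h] := scanP (margin p i j) L => /h[]. Qed.

Lemma sum_code p j i (F : 'I_L -> rat) :
  \sum_l F l * (code p j i == (val l).+1)%:R =
  if code p j i is w.+1 then at_ord F w else 0.
Proof.
case ew: (code p j i) => [|w]; first by rewrite big1 // => l _; rewrite mulr0.
have wL := code_lt ew; rewrite /at_ord insubT /= -[RHS](sum_pred1 F).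
by apply: eq_bigr => l _; rewrite eqSS -val_eqE.
Qed.

Lemma sum_code_price p j i :
  \sum_l reward I i j l * (code p j i == (val l).+1)%:R =
  gain p j i + \sum_l p i l * (code p j i == (val l).+1)%:R.
Proof.
rewrite !sum_code; case ew: (code p j i) => [|w].
  by rewrite (code0_gain ew) addr0.
have wL := code_lt ew; rewrite /at_ord insubT /=.
by have [-> _] := code_gain (l := Ordinal wL) ew; rewrite subrK.
Qed.

Lemma sum_code_ge1 p j i :
  \sum_(l < L) ((code p j i == (val l).+1)%:R : rat) = (code p j i != 0%N)%:R.
Proof.
under eq_bigr do rewrite -[_%:R]mul1r.
rewrite (sum_code p j i (fun=> 1)); case ew: (code p j i) => [|w] //=.
by rewrite /at_ord (insubT (fun k => (k < L)%N) (code_lt ew)).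
Qed.

(** * Dual values and the profit of a round *)

Definition best p j : rat := \sum_i phi i j (offered p j) * gain p j i.

Lemma best_ge p j S : \sum_i phi i j S * gain p j i <= best p j.
Proof.
(* The oracle sums over the products in the assortment only; the others are chosen with probability
   0. *)
have supp (S' : {set 'I_n}) : \sum_i phi i j S' * gain p j i =
    \sum_(i in S') [ffun i => gain p j i] i * phi i j S'.
  rewrite (bigID (mem S')) /= [X in _ + X]big1 ?addr0.
    by apply: eq_bigr => i _; rewrite ffunE mulrC.
  by move=> i iS; rewrite /phi choice_notin ?mul0r.
by rewrite /best !supp; apply: oracle.
Qed.

Lemma best_ge0 p j : 0 <= best p j.
Proof. by apply: sumr_ge0 => i _; apply: mulr_ge0 => //; apply: choice_ge0. Qed.
Hint Resolve best_ge0 : core.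

Lemma base_best : base = \sum_j lam j * best (fun _ _ => 0) j.
Proof.
apply: eq_bigr => j _; rewrite /best big_distrr /=; apply: eq_bigr => i _.
by rewrite /sale mulrA.
Qed.

Lemma base_ge0 : 0 <= base.
Proof. by rewrite base_best; apply: sumr_ge0 => j _; apply: mulr_ge0. Qed.
Hint Resolve base_ge0 : core.

Lemma step_size_gt0 : 0 < step_size.
Proof. by rewrite invr_gt0 ltr0n !muln_gt0 T_gt0 addn_gt0 L_gt0. Qed.

Lemma stock_cap_ge1 l : 1 <= stock_cap l.
Proof. by rewrite ler1n; apply: (capacity_gt0 validI). Qed.

Lemma supply_capP i : supply I i = None /\ supply_cap i = 0 \/
  (exists s, supply I i = Some s /\ supply_cap i = s%:R) /\ 1 <= supply_cap i.
Proof.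
rewrite /supply_cap; case es: (supply I i) => [s|]; [right|by left].
by split; [exists s | rewrite ler1n; apply: (supply_gt0 validI es)].
Qed.

Lemma stock_price_ge0 U s l : 0 <= stock_price U s l.
Proof.
apply: mulr_ge0; first by rewrite mulr_ge0 // ltW // step_size_gt0.
by rewrite divr_ge0 ?pospart_ge0.
Qed.

Lemma supply_price_ge0 V s i : 0 <= supply_price V s i.
Proof.
apply: mulr_ge0; first by rewrite mulr_ge0 // ltW // step_size_gt0.
by rewrite divr_ge0 ?pospart_ge0.
Qed.

Lemma price_ge0 s i l : 0 <= prices s i l.
Proof. by rewrite addr_ge0 ?stock_price_ge0 ?supply_price_ge0. Qed.

Lemma supply_price_None V s i : supply I i = None -> supply_price V s i = 0.
Proof. by rewrite /supply_price /supply_cap => -> /=; rewrite invr0 !mulr0. Qed.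

Lemma code_reward s j i l : code (prices s) j i = (val l).+1 -> 0 <= reward I i j l.
Proof. by case/code_gain; have := price_ge0 s i l; lra. Qed.

Let P s : rat :=
  \sum_l stock_price (state s).1 s l * stock_cap l +
  \sum_i supply_price (state s).2 s i * supply_cap i.

Definition dual s : rat := P s + \sum_j lam j * best (prices s) j.

Definition value s : rat := \sum_i \sum_j \sum_l
  reward I i j l * (sale (prices s) j i * (code (prices s) j i == (val l).+1)%:R).

Definition stock_slack s l : rat := (state s).1 (val l).+1 / stock_cap l - s%:R.
Definition supply_slack s i : rat := (state s).2 i / supply_cap i - s%:R.
Definition stock_drift s l : rat := code_sales (prices s) (val l).+1 / stock_cap l - 1.
Definition supply_drift s i : rat := product_sales (prices s) i / supply_cap i - 1.

Definition drift s : rat :=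
  \sum_l pospart (stock_slack s l) * stock_drift s l +
  \sum_i pospart (supply_slack s i) * supply_drift s i.

Lemma valueE s : value s = \sum_j \sum_i sale (prices s) j i *
  \sum_l reward I i j l * (code (prices s) j i == (val l).+1)%:R.
Proof.
rewrite /value exchange_big /=; apply: eq_bigr => j _; apply: eq_bigr => i _.
by rewrite big_distrr /=; apply: eq_bigr => l _; rewrite mulrCA.
Qed.

(** The profit consists of the price-adjusted profit and the payments for the units sold. The dual
    value contains the payments for the full capacities instead, and the difference is the excess of
    sales over capacity weighted by the prices. *)
Lemma value_dual s : value s = dual s + step_size * base * drift s.
Proof.
have -> : value s = \sum_j lam j * best (prices s) j +
   (\sum_l stock_price (state s).1 s l * code_sales (prices s) (val l).+1 +
    \sum_i supply_price (state s).2 s i * product_sales (prices s) i).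
  transitivity (\sum_j \sum_i (sale (prices s) j i * gain (prices s) j i +
     \sum_l stock_price (state s).1 s l *
        (sale (prices s) j i * (code (prices s) j i == (val l).+1)%:R) +
     supply_price (state s).2 s i *
        (sale (prices s) j i * (code (prices s) j i != 0%N)%:R))).
    rewrite valueE; apply: eq_bigr => j _; apply: eq_bigr => i _.
    rewrite sum_code_price mulrDr -addrA; congr (_ + _).
    rewrite -sum_code_ge1 !big_distrr -big_split /=; apply: eq_bigr => l _.
    rewrite [prices s i l](_ : _ = stock_price (state s).1 s l +
      supply_price (state s).2 s i) //; ring.
  under eq_bigr do rewrite !big_split /=.
  rewrite !big_split /= -addrA; congr (_ + (_ + _)).
  - apply: eq_bigr => j _; rewrite /best big_distrr /=; apply: eq_bigr => i _.
    by rewrite /sale mulrA.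
  - under eq_bigr do rewrite exchange_big /=.
    rewrite exchange_big /=; apply: eq_bigr => l _.
    rewrite /code_sales big_distrr /=; apply: eq_bigr => j _.
    by rewrite big_distrr.
  - rewrite exchange_big /=; apply: eq_bigr => i _.
    by rewrite /product_sales big_distrr.
rewrite /dual addrAC [RHS]addrC; congr (_ + _).
rewrite /P /drift /stock_price /supply_price.
set a := step_size * base; clearbody a.
rewrite mulrDr addrACA !big_distrr -!big_split /=; congr (_ + _).
  apply: eq_bigr => l _; rewrite -/(stock_slack s l) /stock_drift.
  by have c1 := stock_cap_ge1 l; field; apply/eqP; lra.
apply: eq_bigr => i _; rewrite -/(supply_slack s i) /supply_drift.
have [[_ e0]|[_ c1]] := supply_capP i; last by field; apply/eqP; lra.
(* For an infinite supply the capacity is represented by 0, the quotient is 0 and the slack [- s]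
   has no positive part. *)
rewrite pospart_le0 /supply_slack e0 ?invr0 ?mulr0 ?sub0r ?oppr_le0 //.
by rewrite !(mul0r, mulr0) addr0.
Qed.

(** The reward from the chosen warehouse is at most the gain at price 0, and no assortment beats the
    oracle's at these gains. *)
Lemma value_le_base s : value s <= base.
Proof.
rewrite valueE base_best; apply: ler_sum => j _.
apply: (@le_trans _ _ (lam j * \sum_i phi i j (offered (prices s) j) * gain (fun _ _ => 0) j i)).
  rewrite big_distrr /=; apply: ler_sum => i _; rewrite mulrA.
  apply: ler_wpM2l => //; rewrite sum_code.
  case ew: (code _ j i) => [|w]; first exact: gain_ge0.
  rewrite /at_ord (insubT (fun k => (k < L)%N) (code_lt ew)) /=.
  by have := gain_ge (fun _ _ => 0) j i (Ordinal (code_lt ew)); rewrite subr0.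
by apply: ler_wpM2l => //; apply: best_ge.
Qed.

Lemma P_ge0 s : 0 <= P s.
Proof.
apply: addr_ge0; apply: sumr_ge0 => x _; apply: mulr_ge0 => //.
  exact: stock_price_ge0.
exact: supply_price_ge0.
Qed.

Lemma dual_ge0 s : 0 <= dual s.
Proof.
by apply: addr_ge0; [exact: P_ge0 | apply: sumr_ge0 => j _; apply: mulr_ge0].
Qed.

Lemma price_le_P s i l : prices s i l <= P s.
Proof.
rewrite /prices /price_of /P (bigD1 l) //= [\sum_(i0 < n) _](bigD1 i) //=.
have h1 : stock_price (state s).1 s l <= stock_price (state s).1 s l * stock_cap l.
  by rewrite ler_peMr ?stock_price_ge0 ?stock_cap_ge1.
have h2 : supply_price (state s).2 s i <= supply_price (state s).2 s i * supply_cap i.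
  have [[e0 _]|[_ c1]] := supply_capP i; first by rewrite supply_price_None // mul0r.
  by rewrite ler_peMr ?supply_price_ge0.
have h3 : 0 <= \sum_(l' | l' != l) stock_price (state s).1 s l' * stock_cap l'.
  by apply: sumr_ge0 => x _; apply: mulr_ge0 => //; exact: stock_price_ge0.
have h4 : 0 <= \sum_(i' | i' != i) supply_price (state s).2 s i' * supply_cap i'.
  by apply: sumr_ge0 => x _; apply: mulr_ge0 => //; exact: supply_price_ge0.
by lra.
Qed.

(** A customer buys at most one unit, and as capacities are at least 1 its price is at most [P s].
    Removing the prices thus raises the best profit per customer by at most [P s], and at most [T]
    customers are expected. *)
Lemma base_le_dual s : base <= T%:R * dual s.
Proof.
have T1 : (1 : rat) <= T%:R by rewrite ler1n.
have hb j : best (fun _ _ => 0) j <= best (prices s) j + P s.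
  set S := offered (fun _ _ => 0) j.
  apply: (@le_trans _ _ (\sum_i phi i j S * (gain (prices s) j i + P s))).
    apply: ler_sum => i _; apply: ler_wpM2l; first exact: choice_ge0.
    case ew: (code (fun _ _ => 0) j i) => [|w].
      by rewrite (code0_gain ew) addr_ge0 // P_ge0.
    have [-> _] := code_gain (l := Ordinal (code_lt ew)) ew.
    have := gain_ge (prices s) j i (Ordinal (code_lt ew)).
    by have := price_le_P s i (Ordinal (code_lt ew)); lra.
  under eq_bigr do rewrite mulrDr.
  rewrite big_split /= -big_distrl /=; apply: lerD; first exact: best_ge.
  by rewrite -[leRHS]mul1r ler_wpM2r ?P_ge0 //; apply: choice_sum.
rewrite base_best; apply: (@le_trans _ _ (\sum_j lam j * (best (prices s) j + P s))).
  by apply: ler_sum => j _; apply: ler_wpM2l.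
under eq_bigr do rewrite mulrDr.
rewrite big_split /= -big_distrl /= /dual.
have h1 : (\sum_j lam j) * P s <= T%:R * P s.
  by rewrite ler_wpM2r ?P_ge0 // total_arrival_sum.
have h2 : \sum_j lam j * best (prices s) j <= T%:R * \sum_j lam j * best (prices s) j.
  by rewrite ler_peMl // sumr_ge0 // => j _; rewrite mulr_ge0.
by lra.
Qed.

(** * The Lyapunov function *)

Definition potential s : rat :=
  \sum_l pospart (stock_slack s l) ^+ 2 + \sum_i pospart (supply_slack s i) ^+ 2.

(** Each of the [L + n] drifts lies between -1 and [T]: a round sells at most [T] units, and finite
    capacities are at least 1. *)
Let W : rat := (L + n)%:R * T%:R ^+ 2.

Lemma potential_step s : potential s.+1 <= potential s + 2 * drift s + W.
Proof.
have T1 : (1 : rat) <= T%:R by rewrite ler1n.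
have hl l : pospart (stock_slack s.+1 l) ^+ 2 <= pospart (stock_slack s l) ^+ 2 +
    2 * (pospart (stock_slack s l) * stock_drift s l) + T%:R ^+ 2.
  have -> : stock_slack s.+1 l = stock_slack s l + stock_drift s l.
    by rewrite /stock_slack /stock_drift /= -/(prices s) -natr1; ring.
  apply: pospart_sqrD => //; rewrite /stock_drift.
  have c1 := stock_cap_ge1 l; have c0 : 0 < stock_cap l by lra.
  have := code_sales_ge0 (prices s) (val l).+1; have := code_sales_le (prices s) (val l).+1.
  set x := code_sales _ _ => xT x0.
  have h1 : 0 <= x / stock_cap l by rewrite divr_ge0 // ltW.
  have h2 : x / stock_cap l <= T%:R.
    by rewrite ler_pdivrMr //; apply: le_trans xT _; rewrite ler_peMr.
  by apply/andP; split; lra.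
have hi i : pospart (supply_slack s.+1 i) ^+ 2 <= pospart (supply_slack s i) ^+ 2 +
    2 * (pospart (supply_slack s i) * supply_drift s i) + T%:R ^+ 2.
  have -> : supply_slack s.+1 i = supply_slack s i + supply_drift s i.
    by rewrite /supply_slack /supply_drift /= -/(prices s) -natr1; ring.
  apply: pospart_sqrD => //; rewrite /supply_drift.
  have [[_ ->]|[_ c1]] := supply_capP i.
    by rewrite invr0 mulr0 sub0r lexx /=; lra.
  have c0 : 0 < supply_cap i by lra.
  have := product_sales_ge0 (prices s) i; have := product_sales_le (prices s) i.
  set x := product_sales _ _ => xT x0.
  have h1 : 0 <= x / supply_cap i by rewrite divr_ge0 // ltW.
  have h2 : x / supply_cap i <= T%:R.
    by rewrite ler_pdivrMr //; apply: le_trans xT _; rewrite ler_peMr.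
  by apply/andP; split; lra.
have Hl : \sum_l pospart (stock_slack s.+1 l) ^+ 2 <=
    \sum_l pospart (stock_slack s l) ^+ 2 +
    2 * (\sum_l pospart (stock_slack s l) * stock_drift s l) + #|'I_L|%:R * T%:R ^+ 2.
  by rewrite -sum_affine; apply: ler_sum.
have Hi : \sum_i pospart (supply_slack s.+1 i) ^+ 2 <=
    \sum_i pospart (supply_slack s i) ^+ 2 +
    2 * (\sum_i pospart (supply_slack s i) * supply_drift s i) + #|'I_n|%:R * T%:R ^+ 2.
  by rewrite -sum_affine; apply: ler_sum.
move: Hl Hi; rewrite !card_ord /potential /drift /W natrD.
by lra.
Qed.

Lemma potential0 : potential 0 = 0.
Proof.
by rewrite /potential !big1 ?addr0 // => x _;
  rewrite /stock_slack /supply_slack /= mul0r subr0 pospart_le0 // expr0n.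
Qed.

Lemma potential_ge0 s : 0 <= potential s.
Proof. by rewrite addr_ge0 // sumr_ge0 // => x _; rewrite sqr_ge0. Qed.

Lemma potential_le s : potential s <= \sum_(k < s) (2 * drift k + W).
Proof.
elim: s => [|s IH]; first by rewrite big_ord0 potential0.
rewrite big_ord_recr /=; have := potential_step s; lra.
Qed.

(** Nonnegativity of the potential gives that twice the sum of the drifts is at least [- s W]; by
    [value_dual] this limits how far the values fall below the dual values. *)
Lemma value_sum_ge s :
  \sum_(k < s) dual k <= \sum_(k < s) value k + s%:R * (base / (32 * T%:R ^+ 2)).
Proof.
have T0 : (0 : rat) < T%:R by rewrite ltr0n.
have hW : step_size * W = (16 * T%:R ^+ 2)^-1.
  have Ln0 : (L + n)%:R != 0 :> rat by rewrite pnatr_eq0 -lt0n addn_gt0 L_gt0.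
  rewrite /step_size /W 2!natrM natrX; set x : rat := (L + n)%:R in Ln0 *.
  by clearbody x; field; rewrite Ln0 gt_eqF.
have -> : \sum_(k < s) value k =
    \sum_(k < s) dual k + step_size * base * \sum_(k < s) drift k.
  rewrite mulr_sumr -big_split /=; apply: eq_bigr => k _; exact: value_dual.
rewrite -addrA lerDl.
have h := le_trans (potential_ge0 s) (potential_le s).
rewrite big_split /= sumr_const card_ord -mulr_sumr -mulr_natl in h.
set X := \sum_(k < s) drift k in h *.
have e0 := step_size_gt0.
have h2 : 0 <= step_size * base * (2 * X + s%:R * W).
  apply: mulr_ge0; last by rewrite -/X in h; lra.
  by apply: mulr_ge0 => //; apply: ltW.
have -> : step_size * base * X + s%:R * (base / (32 * T%:R ^+ 2)) =
   step_size * base * (2 * X + s%:R * W) / 2.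
  transitivity (step_size * base * X + base * s%:R * (step_size * W) / 2).
    by rewrite hW; field; rewrite gt_eqF.
  by field.
by rewrite divr_ge0.
Qed.

(** The value is at most [base] and the dual value at least 0, so their difference
    [step_size * base * drift s] is at most [base]. *)
Lemma drift_le s : 0 < base -> drift s <= step_size^-1.
Proof.
move=> b0; have := value_le_base s; have := dual_ge0 s; rewrite value_dual => d0 hv.
have e0 := step_size_gt0.
have h : step_size * drift s <= 1 by rewrite -(ler_pM2l b0); lra.
by rewrite -(ler_pM2l e0) mulfV ?gt_eqF.
Qed.

(** The case left out by [drift_le]. All prices are 0, and a product assigned to a real warehouse
    has positive gain, so it cannot sell without making [base] positive. *)
Lemma code_sales_base0 s w : base = 0 -> code_sales (prices s) w.+1 = 0.
Proof.
move=> b0.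
have -> : prices s = fun _ _ => 0.
  apply/funext => i; apply/funext => l.
  by rewrite /prices /price_of /stock_price /supply_price b0 !mulr0 !mul0r addr0.
have h0 j i : sale (fun _ _ => 0) j i * gain (fun _ _ => 0) j i = 0.
  have pos j' i' : 0 <= sale (fun _ _ => 0) j' i' * gain (fun _ _ => 0) j' i'.
    exact: mulr_ge0.
  have /(_ j isT) h1 := psumr_eq0P (fun j' _ => sumr_ge0 _ (fun i' _ => pos j' i')) b0.
  by have /(_ i isT) := psumr_eq0P (fun i' _ => pos j i') h1.
rewrite /code_sales big1 // => j _; rewrite big1 // => i _.
case: eqP => [ew|_]; last by rewrite mulr0.
have [_ g0] := code_gain (l := Ordinal (code_lt ew)) ew.
by have /eqP := h0 j i; rewrite mulf_eq0 (gt_eqF g0) orbF => /eqP ->; rewrite mul0r.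
Qed.

Lemma product_sales_base0 s i : base = 0 -> product_sales (prices s) i = 0.
Proof.
move=> b0; rewrite /product_sales big1 // => j _.
case ew: (code (prices s) j i) => [|w] /=; first by rewrite mulr0.
have h1 : 0 <= sale (prices s) j i by [].
have := code_sales_base0 s w b0; rewrite /code_sales => h.
have pos j' i' : 0 <= sale (prices s) j' i' * (code (prices s) j' i' == w.+1)%:R.
  exact: mulr_ge0.
have /(_ j isT) h2 := psumr_eq0P (fun j' _ => sumr_ge0 _ (fun i' _ => pos j' i')) h.
have /(_ i isT) := psumr_eq0P (fun i' _ => pos j i') h2.
by rewrite ew eqxx.
Qed.

Lemma slack_le :
  (forall l, stock_slack rounds l <= rounds%:R / (16 * T%:R)) /\
  (forall i, supply_slack rounds i <= rounds%:R / (16 * T%:R)).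
Proof.
have T1 : (1 : rat) <= T%:R by rewrite ler1n.
have T0 : (0 : rat) < T%:R by rewrite ltr0n.
have r0 : 0 <= rounds%:R / (16 * T%:R) :> rat by rewrite divr_ge0 ?mulr_ge0.
have [b0|b0] := eqVneq base 0.
  have U0 s w : (state s).1 w.+1 = 0.
    by elim: s => //= s IH; rewrite IH add0r; apply: code_sales_base0.
  have V0 s i : (state s).2 i = 0.
    by elim: s => //= s IH; rewrite IH add0r; apply: product_sales_base0.
  by split=> x; rewrite /stock_slack /supply_slack ?U0 ?V0 mul0r sub0r;
    apply: le_trans r0; rewrite oppr_le0.
have bpos : 0 < base by rewrite lt_def b0 base_ge0.
have hphi : potential rounds <= (rounds%:R / (16 * T%:R)) ^+ 2.
  apply: (@le_trans _ _ (rounds%:R * (2 * step_size^-1 + W))).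
    apply: le_trans (potential_le _) _.
    rewrite mulr_natl -[in leRHS](card_ord rounds) -sumr_const.
    apply: ler_sum => k _; rewrite lerD2r ler_wpM2l //; exact: drift_le.
  (* The constant 33 absorbs [2 / step_size = 32 T ^ 4 (L + n)] and [W]. *)
  have -> : (rounds%:R / (16 * T%:R)) ^+ 2 = rounds%:R * (33 * T%:R ^+ 4 * (L + n)%:R) :> rat.
    have -> : rounds%:R = 33 * 16 * 16 * T%:R ^+ 6 * (L + n)%:R :> rat.
      by rewrite /rounds 4!natrM natrX.
    by field; rewrite pnatr_eq0 -lt0n T_gt0.
  apply: ler_wpM2l; first exact: ler0n.
  rewrite /step_size invrK /W 2!natrM natrX.
  have h1 : (1 : rat) <= T%:R ^+ 2 by rewrite expr_ge1.
  have h2 : T%:R ^+ 2 <= T%:R ^+ 4 :> rat by apply: ler_weXn2l.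
  have h3 : 0 <= (L + n)%:R :> rat by [].
  by nra.
have key z : z ^+ 2 <= potential rounds -> 0 <= z -> z <= rounds%:R / (16 * T%:R).
  move=> hz z0; rewrite -(@ler_pXn2r _ 2) ?nnegrE //; exact: le_trans hz hphi.
split=> x; apply: le_trans (pospart_ge _) (key _ _ (pospart_ge0 _)); rewrite /potential.
  rewrite (bigD1 x) //= -addrA lerDl addr_ge0 // sumr_ge0 // => *; exact: sqr_ge0.
rewrite addrC (bigD1 x) //= -addrA lerDl addr_ge0 // sumr_ge0 // => *; exact: sqr_ge0.
Qed.

Lemma state_stock s w : (state s).1 w = \sum_i \sum_j cumulative s i j w.
Proof.
elim: s => [|s IH] /=.
  by rewrite big1 // => i _; rewrite big1 // => j _; rewrite /cumulative big_ord0.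
rewrite IH /code_sales [X in _ + X]exchange_big /= -big_split /=; apply: eq_bigr => i _.
by rewrite -big_split /=; apply: eq_bigr => j _; rewrite /cumulative big_ord_recr.
Qed.

Lemma state_supply s i : (state s).2 i = \sum_j \sum_(l < L) cumulative s i j (val l).+1.
Proof.
elim: s => [|s IH] /=.
  by rewrite big1 // => j _; rewrite big1 // => l _; rewrite /cumulative big_ord0.
rewrite IH /product_sales -big_split /=; apply: eq_bigr => j _.
under [RHS]eq_bigr do rewrite /cumulative big_ord_recr /=.
by rewrite big_split /= -big_distrr /= sum_code_ge1.
Qed.

Lemma value_cumulative s :
  \sum_(k < s) value k =
  \sum_i \sum_j \sum_l reward I i j l * cumulative s i j (val l).+1.
Proof.
rewrite exchange_big /=; apply: eq_bigr => i _.
rewrite exchange_big /=; apply: eq_bigr => j _.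
rewrite exchange_big /=; apply: eq_bigr => l _.
by rewrite -big_distrr.
Qed.

(** Sales of a round are at most [T] and so within every capacity; the slacks never become positive
    and the drift vanishes. *)
Lemma value_ample s :
  (forall l, T%:R <= stock_cap l) ->
  (forall i, supply I i != None -> T%:R <= supply_cap i) ->
  value s = dual s.
Proof.
move=> hl hi.
have zl k l : stock_slack k l <= 0.
  elim: k => [|k IH]; first by rewrite /stock_slack /= mul0r subr0.
  have -> : stock_slack k.+1 l = stock_slack k l + stock_drift k l.
    by rewrite /stock_slack /stock_drift /= -/(prices k) -natr1; ring.
  have c1 := stock_cap_ge1 l; have c0 : 0 < stock_cap l by lra.
  have : stock_drift k l <= 0.
    rewrite /stock_drift subr_le0 ler_pdivrMr // mul1r.
    exact: le_trans (code_sales_le _ _) (hl l).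
  by lra.
have zi k i : supply_slack k i <= 0.
  elim: k => [|k IH]; first by rewrite /supply_slack /= mul0r subr0.
  have -> : supply_slack k.+1 i = supply_slack k i + supply_drift k i.
    by rewrite /supply_slack /supply_drift /= -/(prices k) -natr1; ring.
  have : supply_drift k i <= 0.
    rewrite /supply_drift subr_le0.
    have [[_ ->]|[[s' [es _]] c1]] := supply_capP i; first by rewrite invr0 mulr0.
    rewrite ler_pdivrMr; last by lra.
    rewrite mul1r; apply: le_trans (product_sales_le _ _) (hi i _).
    by rewrite es.
  by lra.
rewrite value_dual /drift !big1 ?addr0 ?mulr0 ?addr0 // => x _;
  by rewrite pospart_le0 ?mul0r.
Qed.

End Algorithm.

(** * The planning program *)

Declare Scope expr_scope.
Delimit Scope expr_scope with expr.
Bind Scope expr_scope with expr.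
Notation "u + v" := (Op OpAdd u v) : expr_scope.
Notation "u - v" := (Op OpSub u v) : expr_scope.
Notation "u * v" := (Op OpMul u v) : expr_scope.
Notation "u / v" := (Op OpDiv u v) : expr_scope.
Notation "u <= v" := (Op OpLeq u v) : expr_scope.
Notation "u == v" := (Op OpEq u v) : expr_scope.
Notation "# x" := (Get x [::]) (at level 2, format "# x") : expr_scope.
Notation "p ;; q" := (Then p q) (at level 60, right associativity).

Definition a_lam := 20%N.
Definition a_base := 21%N.
Definition a_price := 22%N.
Definition a_stock := 23%N.
Definition a_supply := 24%N.
Definition a_cumul := 25%N.
Definition a_gain := 26%N.
Definition a_code := 27%N.
Definition a_set := 28%N.
Definition a_sale := 29%N.
Definition a_offer := 30%N.
Definition a_source := 31%N.
Definition a_buffer := 32%N.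
Definition a_ok := 33%N.
Definition a_quota := 34%N.
Definition a_margin := 35%N.
Definition a_take := 36%N.
Definition c_s := 40%N.
Definition c_j := 41%N.
Definition c_i := 42%N.
Definition c_l := 43%N.
Definition c_t := 44%N.

Definition e_one : expr := Cst 1.
Definition e_pospart (e : expr) : expr := ((Cst 0 <= e) * e)%expr.

Definition p_arrivals : cmd :=
  For c_j in_types (For c_t in_periods
    (Do a_lam [:: #c_j] (Get a_lam [:: #c_j] + Get in_arrival [:: #c_j; #c_t])))%expr.

Definition p_rounds : cmd :=
  Do out_seeds [::]
    (Cst 33 * Cst 16 * Cst 16 *
     (#in_periods * #in_periods * #in_periods * #in_periods * #in_periods * #in_periods) *
     (#in_warehouses + #in_products))%expr.

Definition e_step : expr :=
  (e_one / (Cst 16 * (#in_periods * #in_periods * #in_periods * #in_periods) *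
          (#in_warehouses + #in_products)))%expr.

Definition e_price (usage cap : expr) : expr :=
  (e_step * #a_base * (e_pospart (usage / cap - #c_s) / cap))%expr.

Definition p_prices : cmd :=
  For c_i in_products (For c_l in_warehouses
    (Do a_price [:: #c_i; #c_l]
      (e_price (Get a_stock [:: #c_l + e_one]) (Get in_capacity [:: #c_l]) +
       e_price (Get a_supply [:: #c_i]) (Get in_supply [:: #c_i]))))%expr.

(** [cmd] has no conditional: the running maximum and its index are replaced by adding the indicator
    [a_take] times the change. *)
Definition p_scan : cmd :=
  For c_l in_warehouses
    (Do a_margin [::] (Get in_reward [:: #c_i; #c_j; #c_l] - Get a_price [:: #c_i; #c_l]) ;;
     Do a_take [::] (e_one - (#a_margin <= Get a_gain [:: #c_i])) ;;
     Do a_gain [:: #c_i]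
       (Get a_gain [:: #c_i] + #a_take * (#a_margin - Get a_gain [:: #c_i])) ;;
     Do a_code [:: #c_i]
       (Get a_code [:: #c_i] + #a_take * (#c_l + e_one - Get a_code [:: #c_i])))%expr.

Definition p_gains : cmd :=
  For c_i in_products
    (Do a_gain [:: #c_i] (Cst 0) ;; Do a_code [:: #c_i] (Cst 0) ;; p_scan)%expr.

(** Round 0 runs at price 0, so its sales accumulate [a_base] on the way. Index 0 of [a_stock] and
    [a_cumul] collects what is served virtually. *)
Definition p_sales : cmd :=
  For c_i in_products
    (AskChoice a_sale #c_i #c_j a_set ;;
     Do a_sale [::] (Get a_lam [:: #c_j] * #a_sale) ;;
     Do a_stock [:: Get a_code [:: #c_i]] (Get a_stock [:: Get a_code [:: #c_i]] + #a_sale) ;;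
     Do a_supply [:: #c_i]
       (Get a_supply [:: #c_i] + #a_sale * (e_one - (Get a_code [:: #c_i] == Cst 0))) ;;
     Do a_cumul [:: #c_i; #c_j; Get a_code [:: #c_i]]
       (Get a_cumul [:: #c_i; #c_j; Get a_code [:: #c_i]] + #a_sale) ;;
     Do a_base [::] (#a_base + #a_sale * Get a_gain [:: #c_i] * (#c_s == Cst 0)) ;;
     Do a_offer [:: #c_s; #c_j; #c_i] (Get a_set [:: #c_i]) ;;
     Do a_source [:: #c_s; #c_j; #c_i] (Get a_code [:: #c_i]))%expr.

Definition p_round : cmd :=
  p_prices ;; For c_j in_types (p_gains ;; AskAssort a_set (#c_j)%expr a_gain ;; p_sales).

Definition p_loop : cmd := For c_s out_seeds p_round.

Definition p_buffer : cmd :=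
  For c_t in_periods
    (Do a_ok [::] e_one ;;
     For c_i in_products (For c_l in_warehouses
       (Do a_ok [::]
         (#a_ok *
          ((#c_t + e_one) * (#c_t + e_one) * (#in_products * #in_types) <=
             Get in_capacity [:: #c_l]) *
          ((Get in_supply [:: #c_i] == Cst 0) +
           ((#c_t + e_one) * (#c_t + e_one) * (#in_warehouses * #in_types) <=
             Get in_supply [:: #c_i]))))) ;;
     Do a_buffer [::] (#a_buffer + #a_ok))%expr.

Definition p_quotas : cmd :=
  For c_i in_products (For c_j in_types (For c_l in_warehouses
    (Do a_quota [:: #c_i; #c_j; #c_l + e_one]
       (Floor ((#a_buffer - e_one) / #a_buffer *
               (Cst 16 * #in_periods / (Cst 16 * #in_periods + e_one)) *
               (Get a_cumul [:: #c_i; #c_j; #c_l + e_one] / #out_seeds)) + #a_buffer) ;;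
     Do out_placement [:: #c_i; #c_l]
       (Get out_placement [:: #c_i; #c_l] + Get a_quota [:: #c_i; #c_j; #c_l + e_one]))))%expr.

Definition p_plan : cmd := p_arrivals ;; p_rounds ;; p_loop ;; p_buffer ;; p_quotas.

(** * Partial sums for loop invariants *)

Lemma sum_ltS (V : nmodType) K (F : 'I_K -> V) (k : 'I_K) :
  \sum_(x < K | (x < (val k).+1)%N) F x = \sum_(x < K | (x < val k)%N) F x + F k.
Proof.
rewrite (bigD1 k) //= addrC; congr (_ + _); apply: eq_bigl => x.
by rewrite -val_eqE /= ltnS [RHS]ltn_neqAle andbC.
Qed.

Lemma for_ordinal (P : nat -> Prop) K :
  (forall k : 'I_K, P (val k)) -> forall k, (k < K)%N -> P k.
Proof. by move=> h k kK; exact: (h (Ordinal kK)). Qed.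

Lemma sum_lt0 (V : nmodType) K (F : 'I_K -> V) : \sum_(x < K | (x < 0)%N) F x = 0.
Proof. by rewrite big1. Qed.

Lemma sum_ltK (V : nmodType) K (F : 'I_K -> V) : \sum_(x < K | (x < K)%N) F x = \sum_x F x.
Proof. by apply: eq_bigl => x; rewrite ltn_ord. Qed.

Lemma small_pospart b x : small b x -> small b (pospart x).
Proof. by rewrite /pospart; case: (0 <= x); rewrite ?mul1r ?mul0r ?small0. Qed.

Lemma small_scan b d k : (forall l, small b (d l)) -> small b (scan d k).1.
Proof.
move=> hd; elim: k => [|k] /=; first exact: small0.
by case: (scan _ k) => g w /= hg; case: ifP => //= _.
Qed.

Lemma small_mul_bool b x (c : bool) : small b x -> small b (x * c%:R).
Proof. by case: c; rewrite ?mulr1 ?mulr0 ?small0. Qed.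

(* The pairs of a type and a product that precede [(j, k)] in the order of the loops. *)
Definition visited (j k j' i : nat) : bool := (j' < j)%N || ((j' == j) && (i < k)%N).

Section VisitedSums.
Variables (n m : nat) (F : 'I_m -> 'I_n -> rat).

Definition visited_sum (j k : nat) : rat :=
  \sum_(j' < m) \sum_(i < n | visited j k j' i) F j' i.

Lemma visited00 j i : visited 0 0 j i = false.
Proof. by rewrite /visited !ltn0 andbF. Qed.

Lemma visited_next j j' (i : 'I_n) : visited j n j' i = visited j.+1 0 j' i.
Proof. by rewrite /visited ltn_ord ltn0 andbT andbF orbF ltnS [RHS]leq_eqVlt orbC. Qed.

Lemma visited_all (j : 'I_m) i : visited m 0 j i.
Proof. by rewrite /visited ltn_ord. Qed.

Lemma visited_step (j : 'I_m) (i : 'I_n) (j' : 'I_m) (i' : 'I_n) :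
  visited j i.+1 j' i' = visited j i j' i' || (j' == j) && (i' == i).
Proof.
rewrite /visited -!val_eqE /= ltnS [(i' <= i)%N]leq_eqVlt.
by rewrite andb_orr [X in _ || X]orbC orbA.
Qed.

Lemma visited_irr (j : 'I_m) (i : 'I_n) : visited j i j i = false.
Proof. by rewrite /visited !ltnn andbF. Qed.

Lemma visited_sum0 : visited_sum 0 0 = 0.
Proof. by rewrite /visited_sum big1 // => j _; rewrite big1 // => i; rewrite visited00. Qed.

Lemma visited_sum_next j : visited_sum j n = visited_sum j.+1 0.
Proof. by apply: eq_bigr => j' _; apply: eq_bigl => i; rewrite visited_next. Qed.

Lemma visited_sum_all : visited_sum m 0 = \sum_j \sum_i F j i.
Proof. by apply: eq_bigr => j' _; apply: eq_bigl => i; rewrite visited_all. Qed.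

Lemma visited_sum_step (j : 'I_m) (i : 'I_n) :
  visited_sum j i.+1 = visited_sum j i + F j i.
Proof.
rewrite /visited_sum (bigD1 j) //= [in RHS](bigD1 j) //= [RHS]addrAC; congr (_ + _).
  rewrite (bigD1 i) /=; last by rewrite visited_step !eqxx orbT.
  rewrite addrC; congr (_ + _); apply: eq_bigl => i'.
  rewrite visited_step eqxx /=; case: eqVneq => [->|_]; last by rewrite orbF andbT.
  by rewrite visited_irr andbF.
apply: eq_bigr => j' /negbTE j'j; apply: eq_bigl => i'.
by rewrite visited_step j'j orbF.
Qed.

End VisitedSums.

Lemma mulr_bool (b c : bool) : b%:R * c%:R = (b && c)%:R :> rat.
Proof. by case: b; case: c; rewrite ?mulr0 ?mulr1. Qed.

Lemma floor_truncn (x : rat) : 0 <= x -> (Num.floor x)%:~R = (Num.truncn x)%:R :> rat.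
Proof.
move=> x0; rewrite truncn_floor x0; have : 0 <= Num.floor x by rewrite floor_ge0.
by case: (Num.floor x).
Qed.

Lemma natrM4 a b c d : (a * b * (c * d))%:R = a%:R * b%:R * (c%:R * d%:R) :> rat.
Proof. by rewrite !natrM. Qed.

Section VisitedAll.
Variables (n m : nat) (P : 'I_m -> 'I_n -> bool).

Definition visited_forall (j k : nat) : bool :=
  [forall j', forall i, visited j k (val j') (val i) ==> P j' i].

Lemma visited_forall0 : visited_forall 0 0.
Proof. by apply/forallP => j; apply/forallP => i; rewrite visited00. Qed.

Lemma visited_forall_next j : visited_forall j n = visited_forall j.+1 0.
Proof. by apply: eq_forallb => j'; apply: eq_forallb => i; rewrite visited_next. Qed.

Lemma visited_forall_all : visited_forall m 0 = [forall j, forall i, P j i].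
Proof. by apply: eq_forallb => j'; apply: eq_forallb => i; rewrite visited_all. Qed.

Lemma visited_forall_step (j : 'I_m) (i : 'I_n) :
  visited_forall j i.+1 = visited_forall j i && P j i.
Proof.
apply/idP/andP => [/forallP h|[/forallP h p]].
  have h' j' i' := implyP (forallP (h j') i'); split; last first.
    by apply: h'; rewrite visited_step !eqxx orbT.
  apply/forallP => j'; apply/forallP => i'; apply/implyP => hv.
  by apply: h'; rewrite visited_step hv.
apply/forallP => j'; apply/forallP => i'; apply/implyP; rewrite visited_step.
case/orP => [hv|/andP[/eqP -> /eqP ->] //].
exact: (implyP (forallP (h j') i')).
Qed.

End VisitedAll.

(** * Buffers and quotas *)

Section Buffer.
Variables (n m L T : nat) (I : problem rat n m L T).

Definition buffer_fits_at (k : nat) (i : 'I_n) (l : 'I_L) : bool :=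
  ((k * k * (n * m))%:R <= stock_cap I l) &&
  ((supply_cap I i == 0) || ((k * k * (L * m))%:R <= supply_cap I i)).

Definition buffer_fits (k : nat) : bool := [forall i, forall l, buffer_fits_at k i l].

(* The largest [k <= T] that fits, as [buffer_fits] is antitone. *)
Definition buffer : nat := \sum_(t < T) buffer_fits t.+1.

Variables (opt : 'I_m -> {ffun 'I_n -> rat} -> {set 'I_n}).

(* The ratio is 0 for an empty buffer, as x/0 = 0. *)
Definition quota_ratio : rat :=
  (buffer%:R - 1) / buffer%:R * (16 * T%:R / (16 * T%:R + 1)).

Definition quota (i : 'I_n) (j : 'I_m) (l : 'I_L) : nat :=
  (Num.truncn (quota_ratio *
     (cumulative I opt (rounds n L T) i j (val l).+1 / (rounds n L T)%:R)) + buffer)%N.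

Lemma quota_ratio_ge0 : 0 <= quota_ratio.
Proof.
rewrite /quota_ratio; case: buffer => [|b]; first by rewrite invr0 mulr0 mul0r.
have T0 : 0 <= 16 * T%:R :> rat by rewrite mulr_ge0 ?ler0n.
apply: mulr_ge0.
  by apply: divr_ge0; [rewrite subr_ge0 ler1n | exact: ler0n].
by apply: divr_ge0; [exact: T0 | exact: addr_ge0 T0 ler01].
Qed.

End Buffer.

Section Plan.
Variables (n m L T : nat) (I : problem rat n m L T).
Variables (opt : 'I_m -> {ffun 'I_n -> rat} -> {set 'I_n}).

Let Z := input_size I.

Lemma size_products : (n <= Z)%N. Proof. rewrite /Z /input_size; lia. Qed.
Lemma size_types : (m <= Z)%N. Proof. rewrite /Z /input_size; lia. Qed.
Lemma size_warehouses : (L <= Z)%N. Proof. rewrite /Z /input_size; lia. Qed.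
Lemma size_periods : (T <= Z)%N. Proof. rewrite /Z /input_size; lia. Qed.

Lemma small_arrival j t : small Z (arrival I j t).
Proof.
apply: small_le (bit_length_small _); rewrite /Z /input_size (bigD1 j) //= (bigD1 t) //=.
lia.
Qed.

Lemma small_reward i j l : small Z (reward I i j l).
Proof.
apply: small_le (bit_length_small _).
have : (bit_length (reward I i j l) <= \sum_i \sum_j \sum_l bit_length (reward I i j l))%N.
  by rewrite (bigD1 i) //= (bigD1 j) //= (bigD1 l) //=; lia.
rewrite /Z /input_size; lia.
Qed.

Lemma small_capacity l : small Z (stock_cap I l).
Proof.
apply: small_le (bit_length_small _).
have : (bit_length (capacity I l)%:R <= \sum_l bit_length (capacity I l)%:R)%N.
  by rewrite (bigD1 l) //= leq_addr.
rewrite /Z /input_size /stock_cap; lia.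
Qed.

Lemma small_supply i : small Z (supply_cap I i).
Proof.
apply: small_le (bit_length_small _).
rewrite /Z /input_size /supply_cap.
have : (bit_length (odflt 0%N (supply I i))%:R <=
  \sum_i bit_length (odflt 0%N (supply I i))%:R)%N by rewrite (bigD1 i) //= leq_addr.
lia.
Qed.

Lemma small_choice i j S : small Z (choice_prob I i j S).
Proof.
apply: small_le (bit_length_small _); rewrite /Z /input_size.
have : (bit_length (choice_prob I i j S) <=
  \max_i \max_j \max_(S : {set 'I_n}) bit_length (choice_prob I i j S))%N.
  apply: leq_trans (leq_bigmax i); apply: leq_trans (leq_bigmax j).
  exact: (leq_bigmax S).
lia.
Qed.

End Plan.

(** * Correctness of the planning program *)

Section PlanRuns.
Variables (n m L T : nat) (I : problem rat n m L T).
Variables (opt : 'I_m -> {ffun 'I_n -> rat} -> {set 'I_n}).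
Variables (B M : nat).
Hypotheses (n_le : (n <= M)%N) (m_le : (m <= M)%N) (L_le : (L <= M)%N) (T_le : (T <= M)%N).
Hypothesis (M_le : (M <= B)%N).

Notation run := (runs opt (choice_prob I) B M).

Definition inputs (mu : memory) :=
  forall z idx, (z < 8)%N -> mu z idx = input_memory I z idx.

Lemma inputs_frame ws mu mu' :
  all (leq 8) ws -> frame ws mu mu' -> inputs mu -> inputs mu'.
Proof.
move=> /allP hws f h z idx z8; rewrite f ?h //.
by apply: contraTF z8 => /hws; rewrite -leqNgt.
Qed.

Lemma inputs_update mu x idx v : (8 <= x)%N -> inputs mu -> inputs (update mu x idx v).
Proof.
by move=> hx h z idx' z8; rewrite updateN ?h //; apply: contraTF hx => /eqP <-; rewrite -ltnNge.
Qed.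

Section Inputs.
Variables (mu : memory) (hmu : inputs mu).

Lemma in_productsE : mu in_products [::] = n%:R. Proof. exact: hmu. Qed.
Lemma in_typesE : mu in_types [::] = m%:R. Proof. exact: hmu. Qed.
Lemma in_warehousesE : mu in_warehouses [::] = L%:R. Proof. exact: hmu. Qed.
Lemma in_periodsE : mu in_periods [::] = T%:R. Proof. exact: hmu. Qed.
Lemma in_arrivalE (j : 'I_m) (t : 'I_T) :
  mu in_arrival [:: val j; val t] = arrival I j t.
Proof. by rewrite hmu // /input_memory /= !at_ord_val. Qed.
Lemma in_rewardE (i : 'I_n) (j : 'I_m) (l : 'I_L) :
  mu in_reward [:: val i; val j; val l] = reward I i j l.
Proof. by rewrite hmu // /input_memory /= !at_ord_val. Qed.
Lemma in_capacityE (l : 'I_L) : mu in_capacity [:: val l] = stock_cap I l.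
Proof. by rewrite hmu // /input_memory /= !at_ord_val. Qed.
Lemma in_supplyE (i : 'I_n) : mu in_supply [:: val i] = supply_cap I i.
Proof. by rewrite hmu // /input_memory /= !at_ord_val. Qed.

End Inputs.

Hypothesis small_lam : forall j k,
  small B (\sum_(t < T | (t < k)%N) arrival I j t).

Lemma run_arrivals mu : small_memory B mu -> inputs mu ->
  (forall idx, mu a_lam idx = 0) ->
  run p_arrivals mu (fun mu' => forall j : 'I_m, mu' a_lam [:: val j] = total_arrival I j).
Proof.
move=> hmu inp h0.
pose Inv k (mu' : memory) := forall j : 'I_m,
  mu' a_lam [:: val j] = if (j < k)%N then total_arrival I j else 0.
apply: (runs_For n_le M_le (K := m) (Inv := Inv)) => //; first exact: in_typesE.
- by move=> j; rewrite updateN // h0.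
- move=> k mu1 km; move: k km mu1; apply: for_ordinal => j0 mu1 s1 f1 x1 i1.
have inp1 : inputs mu1 by apply: inputs_frame f1 inp.
pose Inv2 k' (mu' : memory) := forall j : 'I_m, mu' a_lam [:: val j] =
  if (j < j0)%N then total_arrival I j else
  if j == j0 then \sum_(t < T | (t < k')%N) arrival I j t else 0.
apply: (runs_For n_le M_le (K := T) (Inv := Inv2)) => //; first exact: in_periodsE.
- by move=> j; rewrite updateN // i1 sum_lt0; case: eqP.
- move=> k mu2 kT; move: k kT mu2; apply: for_ordinal => t mu2 s2 f2 x2 i2.
have inp2 : inputs mu2 by apply: inputs_frame f2 inp1.
have xj : mu2 c_j [::] = (val j0)%:R by rewrite f2.
have v2 : eval mu2 (Get a_lam [:: #c_j] + Get in_arrival [:: #c_j; #c_t])%expr =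
  \sum_(t' < T | (t' < (val t).+1)%N) arrival I j0 t'.
  by rewrite /= xj x2 !natrK i2 ltnn eqxx sum_ltS in_arrivalE.
apply: runs_Do => //; first by rewrite v2.
rewrite v2 /= xj natrK => j; rewrite updateN // updateE i2 !eqseq_cons andbT val_eqE.
by case: eqVneq => [->|jk] //; rewrite ltnn.
- move=> mu' _ _ h j; rewrite updateN // h ltnS sum_ltK.
  case: eqVneq => [->|jj0]; first by rewrite ltnn leqnn.
  by rewrite [(j <= j0)%N]leq_eqVlt val_eqE (negbTE jj0).
- by move=> mu' _ _ h j; rewrite h ltn_ord.
Qed.


Lemma run_rounds mu : small_memory B mu -> inputs mu -> small B (rounds n L T)%:R ->
  run p_rounds mu (fun mu' => mu' out_seeds [::] = (rounds n L T)%:R).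
Proof.
move=> hmu inp hs.
have E : eval mu (Cst 33 * Cst 16 * Cst 16 *
     (#in_periods * #in_periods * #in_periods * #in_periods * #in_periods * #in_periods) *
     (#in_warehouses + #in_products))%expr = (rounds n L T)%:R.
  rewrite /= in_periodsE // in_warehousesE // in_productsE // /rounds 4!natrM natrX natrD.
  by ring.
by apply: runs_Do; [exact: hmu | rewrite E | rewrite E updateE].
Qed.

Notation price s := (prices I opt s).

Hypotheses (n_gt0 : (0 < n)%N) (m_gt0 : (0 < m)%N) (L_gt0 : (0 < L)%N) (T_gt0 : (0 < T)%N).

Lemma pospart_start (x : rat) : pospart (0 / x - 0%:R) = 0.
Proof. by rewrite mul0r subr0 /pospart mulr0. Qed.

Lemma prices0 : price 0 = fun _ _ => 0.
Proof.
apply/funext => i; apply/funext => l.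
by rewrite /prices /price_of /stock_price /supply_price !pospart_start !mul0r !mulr0 addr0.
Qed.

Hypothesis small_price : forall s i l, (s <= rounds n L T)%N -> small B (price s i l).

(** In round 0 the array [a_base] is not yet filled, but the positive parts that it multiplies are
    0; hence its value is required only for later rounds. *)
Lemma run_prices mu s : small_memory B mu -> inputs mu -> (s <= rounds n L T)%N ->
  mu c_s [::] = s%:R ->
  (forall w, mu a_stock [:: w] = (state I opt s).1 w) ->
  (forall i : 'I_n, mu a_supply [:: val i] = (state I opt s).2 i) ->
  (s != 0%N -> mu a_base [::] = base I opt) ->
  run p_prices mu (fun mu' => forall (i : 'I_n) (l : 'I_L),
    mu' a_price [:: val i; val l] = price s i l).
Proof.
move=> hmu inp hs cs hU hV hb.
pose Inv k (mu' : memory) := forall (i : 'I_n) (l : 'I_L), (i < k)%N ->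
  mu' a_price [:: val i; val l] = price s i l.
apply: (runs_For n_le M_le (K := n) (Inv := Inv)) => //; first exact: in_productsE.
- move=> k mu1 kn; move: k kn mu1; apply: for_ordinal => i0 mu1 s1 f1 x1 i1.
have inp1 : inputs mu1 by apply: inputs_frame f1 inp.
pose Inv2 k (mu' : memory) := forall (i : 'I_n) (l : 'I_L),
  (i < i0)%N || (i == i0) && (l < k)%N -> mu' a_price [:: val i; val l] = price s i l.
apply: (runs_For n_le M_le (K := L) (Inv := Inv2)) => //; first exact: in_warehousesE.
- by move=> i l; rewrite andbF orbF => h; rewrite updateN // i1.
- move=> k mu2 kL; move: k kL mu2; apply: for_ordinal => l0 mu2 s2 f2 x2 i2.
have inp2 : inputs mu2 by apply: inputs_frame f2 inp1.
have ci : mu2 c_i [::] = (val i0)%:R by rewrite f2.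
have E : eval mu2
    (e_price (Get a_stock [:: #c_l + e_one]) (Get in_capacity [:: #c_l]) +
     e_price (Get a_supply [:: #c_i]) (Get in_supply [:: #c_i]))%expr = price s i0 l0.
  rewrite /= in_periodsE // in_warehousesE // in_productsE // x2 ci natr1 !natrK.
  rewrite in_capacityE // in_supplyE //.
  do 4 (rewrite f2 // f1 //); rewrite cs hU hV.
  have -> : 1 / (16 * (T%:R * T%:R * T%:R * T%:R) * (L%:R + n%:R)) = step_size n L T.
    by rewrite /step_size 2!natrM natrX natrD div1r; congr (_^-1); ring.
  rewrite -!/(pospart _); case: (eqVneq s 0%N) => [s0|s0]; last by rewrite hb.
  by rewrite s0 prices0 !pospart_start !mul0r !mulr0 addr0.
apply: runs_Do => //; first by rewrite E small_price.
rewrite E /= x2 ci !natrK => i l h; rewrite updateN // updateE !eqseq_cons andbT !val_eqE.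
case: eqVneq h => [->|ii0] /=; last first.
  by rewrite !orbF => h; rewrite i2 // h.
rewrite ltnn ltnS /=; case: eqVneq => [->//|ll0] h; apply: i2.
by rewrite ltnn eqxx /= ltn_neqAle h val_eqE ll0.
- move=> mu' _ _ h i l hi; rewrite updateN // h // ltn_ord andbT.
  by move: hi; rewrite ltnS leq_eqVlt val_eqE orbC.
- by move=> mu' _ _ h i l; apply: h.
Qed.


Lemma scan_code_le d k : ((scan d k).2 <= k)%N.
Proof.
by elim: k => //= k; case: (scan d k) => g w /= h; case: ifP => //= _; apply: leqW.
Qed.

Hypothesis small_margin : forall s i j l, (s <= rounds n L T)%N ->
  small B (reward I i j l - price s i l).

Lemma small_margin_scan s i j k : (s <= rounds n L T)%N ->
  small B (scan (margin I (price s) i j) k).1.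
Proof. by move=> hs; apply: small_scan => l; apply: small_at_ord => l'; apply: small_margin. Qed.

Lemma run_scan mu s (j : 'I_m) (i : 'I_n) :
  small_memory B mu -> inputs mu -> (s <= rounds n L T)%N ->
  mu c_i [::] = (val i)%:R -> mu c_j [::] = (val j)%:R ->
  (forall (i : 'I_n) (l : 'I_L), mu a_price [:: val i; val l] = price s i l) ->
  mu a_gain [:: val i] = 0 -> mu a_code [:: val i] = 0 ->
  run p_scan mu (fun mu' => forall i' : 'I_n,
    mu' a_gain [:: val i'] = (if i' == i then gain I (price s) j i else mu a_gain [:: val i']) /\
    mu' a_code [:: val i'] =
      (if i' == i then (code I (price s) j i)%:R else mu a_code [:: val i'])).
Proof.
move=> hmu inp hs ci cj hp g0 c0; set d := margin I (price s) i j.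
pose Inv k (mu' : memory) := forall i' : 'I_n,
  mu' a_gain [:: val i'] = (if i' == i then (scan d k).1 else mu a_gain [:: val i']) /\
  mu' a_code [:: val i'] = (if i' == i then (scan d k).2%:R else mu a_code [:: val i']).
apply: (runs_For n_le M_le (K := L) (Inv := Inv)) => //; first exact: in_warehousesE.
- by move=> i'; rewrite !updateN // /Inv /=; case: eqP => [->|].
- move=> k mu1 kn; move: k kn mu1; apply: for_ordinal => l mu1 s1 f1 x1 i1.
have inp1 : inputs mu1 by apply: inputs_frame f1 inp.
have [gi1 ci1] := i1 i; rewrite eqxx in gi1 ci1.
have ci' : mu1 c_i [::] = (val i)%:R by rewrite f1.
have cj' : mu1 c_j [::] = (val j)%:R by rewrite f1.
have dl : d l = reward I i j l - price s i l by rewrite /d /margin at_ord_val.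
have E1 : eval mu1 (Get in_reward [:: #c_i; #c_j; #c_l] - Get a_price [:: #c_i; #c_l])%expr
    = d l.
  by rewrite /= ci' cj' x1 !natrK in_rewardE // f1 // hp dl.
apply: runs_Do_then => //; first by rewrite E1 dl small_margin.
rewrite E1 /= => mu2 s2 e2.
set take := ~~ (d l <= (scan d l).1).
have E2 : eval mu2 (e_one - (#a_margin <= Get a_gain [:: #c_i]))%expr = take%:R.
  rewrite e2 /= updateE !updateN // eqxx ci' natrK gi1 /take.
  by case: (d l <= _); rewrite ?subrr ?subr0.
apply: runs_Do_then => //; first by rewrite E2 small_bool.
rewrite E2 /= => mu3 s3 e3.
have scanS : scan d (val l).+1 =
    if take then (d l, (val l).+1) else ((scan d l).1, (scan d l).2).
  by rewrite /= /take; case: (scan d l) => g w /=; case: (d l <= g).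
have E3 : eval mu3 (Get a_gain [:: #c_i] + #a_take * (#a_margin - Get a_gain [:: #c_i]))%expr
    = (scan d (val l).+1).1.
  rewrite e3 e2 scanS /update /= ci' natrK gi1.
  by case: (take); rewrite ?mul1r ?mul0r ?addr0 //= addrC subrK.
apply: runs_Do_then => //; first by rewrite E3 small_margin_scan.
have ci3 : mu3 c_i [::] = (val i)%:R by rewrite e3 updateN // e2 updateN.
rewrite E3 [map _ _]/= ci3 natrK => mu4 s4 e4.
have E4 : eval mu4 (Get a_code [:: #c_i] + #a_take * (#c_l + e_one - Get a_code [:: #c_i]))%expr
    = (scan d (val l).+1).2%:R.
  rewrite scanS e4 e3 e2 /update /= ci' natrK x1 natr1 ci1.
  by case: (take); rewrite ?mul1r ?mul0r ?addr0 //= addrC subrK.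
apply: runs_Do => //.
  rewrite E4; apply: small_natS; apply: leq_trans (scan_code_le _ _) _.
  by apply: leq_trans (ltn_ord l) _; apply: leq_trans L_le M_le.
rewrite E4 => i'; have [gi' ci''] := i1 i'.
rewrite e4 e3 e2 /update /= ci' natrK gi' ci'' !eqseq_cons !andbT !val_eqE.
by case: (i' == i).
Qed.

Lemma run_gains mu s (j : 'I_m) :
  small_memory B mu -> inputs mu -> (s <= rounds n L T)%N ->
  mu c_j [::] = (val j)%:R ->
  (forall (i : 'I_n) (l : 'I_L), mu a_price [:: val i; val l] = price s i l) ->
  run p_gains mu (fun mu' => forall i : 'I_n,
    mu' a_gain [:: val i] = gain I (price s) j i /\
    mu' a_code [:: val i] = (code I (price s) j i)%:R).
Proof.
move=> hmu inp hs cj hp.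
pose Inv k (mu' : memory) := forall i : 'I_n, (i < k)%N ->
    mu' a_gain [:: val i] = gain I (price s) j i /\
    mu' a_code [:: val i] = (code I (price s) j i)%:R.
apply: (runs_For n_le M_le (K := n) (Inv := Inv)) => //; first exact: in_productsE.
- move=> k mu1 kn; move: k kn mu1; apply: for_ordinal => i mu1 s1 f1 x1 i1.
have inp1 : inputs mu1 by apply: inputs_frame f1 inp.
apply: runs_Do_then => //; first exact: small0.
rewrite /= x1 natrK => mu2 s2 e2.
apply: runs_Do_then => //; first exact: small0.
have ci2 : mu2 c_i [::] = (val i)%:R by rewrite e2 updateN.
rewrite /= ci2 natrK => mu3 s3 e3.
apply: (@runs_conseq _ _ _ _ _ _ _ _ _ _ (run_scan (s := s) (j := j) (i := i) s3 _ hs _ _ _ _ _)).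
- by rewrite e3 e2; do 2 apply: inputs_update => //.
- by rewrite e3 e2 /update /= x1.
- by rewrite e3 e2 /update /= f1.
- by move=> i' l; rewrite e3 e2 /update /= f1 // hp.
- by rewrite e3 e2 /update /= eqxx.
- by rewrite e3 /update /= eqxx.
move=> mu4 s4 f4 h4 i' hi'; rewrite !updateN //.
have [-> ->] := h4 i'; case: eqVneq => [->//|i'i].
have [g1 c1] : mu1 a_gain [:: val i'] = gain I (price s) j i' /\
    mu1 a_code [:: val i'] = (code I (price s) j i')%:R.
  by apply: i1; rewrite ltn_neqAle val_eqE i'i -ltnS.
by rewrite e3 e2 /update /= eqseq_cons andbT val_eqE (negbTE i'i).
- by move=> mu' _ _ h i; apply: h.
Qed.


Definition type_sales s w (j : 'I_m) (i : 'I_n) : rat :=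
  sale I opt (price s) j i * (code I (price s) j i == w)%:R.
Definition stocked_sales s (j : 'I_m) (i : 'I_n) : rat :=
  sale I opt (price s) j i * (code I (price s) j i != 0%N)%:R.
Definition sale_gain s (j : 'I_m) (i : 'I_n) : rat :=
  sale I opt (price s) j i * gain I (price s) j i.

Definition supply_sum s j k (i : 'I_n) : rat :=
  \sum_(j' < m | visited j k j' i) stocked_sales s j' i.

(* The memory during round [s], when the pairs before [(j, k)] have been processed. *)
Record progress (s j k : nat) (mu : memory) : Prop := Progress {
  progress_stock : forall w,
    mu a_stock [:: w] = (state I opt s).1 w + visited_sum (type_sales s w) j k;
  progress_supply : forall i : 'I_n,
    mu a_supply [:: val i] = (state I opt s).2 i + supply_sum s j k i;
  progress_cumul : forall (i : 'I_n) (j' : 'I_m) w,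
    mu a_cumul [:: val i; val j'; w] =
      cumulative I opt s i j' w + (visited j k j' i)%:R * type_sales s w j' i;
  progress_base :
    mu a_base [::] = if s == 0%N then visited_sum (sale_gain 0) j k else base I opt;
  progress_decisions : forall s' (j' : 'I_m) (i : 'I_n),
    (s' < s)%N || (s' == s) && visited j k j' i ->
    mu a_offer [:: s'; val j'; val i] = (i \in offered I opt (price s') j')%:R /\
    mu a_source [:: s'; val j'; val i] = (code I (price s') j' i)%:R
}.

Lemma progress_frame ws s j k mu mu' : frame ws mu mu' ->
  all (fun x => x \notin ws) [:: a_stock; a_supply; a_cumul; a_base; a_offer; a_source] ->
  progress s j k mu -> progress s j k mu'.
Proof.
move=> f /and5P[/negbTE h1 /negbTE h2 /negbTE h3 /negbTE h4 /and3P[/negbTE h5 /negbTE h6 _]].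
case=> p1 p2 p3 p4 p5; split.
- by move=> w; rewrite f.
- by move=> i; rewrite f.
- by move=> i j' w; rewrite f.
- by rewrite f.
- by move=> s' j' i h; rewrite !f //; apply: p5.
Qed.

Lemma frame_update mu x idx v : frame [:: x] mu (update mu x idx v).
Proof. by move=> z idx'; rewrite inE => h; rewrite updateN. Qed.

Lemma progress_next_type s j mu : progress s j n mu -> progress s j.+1 0 mu.
Proof.
case=> p1 p2 p3 p4 p5; split.
- by move=> w; rewrite p1 visited_sum_next.
- move=> i; rewrite p2; congr (_ + _); apply: eq_bigl => j'; exact: visited_next.
- by move=> i j' w; rewrite p3 visited_next.
- by rewrite p4; case: eqP => // _; apply: visited_sum_next.
- by move=> s' j' i; rewrite -visited_next; apply: p5.
Qed.

Lemma progress_next_round s mu : progress s m 0 mu -> progress s.+1 0 0 mu.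
Proof.
case=> p1 p2 p3 p4 p5; split.
- by move=> w; rewrite p1 visited_sum_all visited_sum0 addr0.
- move=> i; rewrite p2 /supply_sum [in RHS]big1 ?addr0; last by move=> j'; rewrite visited00.
  by congr (_ + _); apply: eq_bigl => j'; rewrite visited_all.
- by move=> i j' w; rewrite p3 visited_all visited00 mul1r mul0r addr0 /cumulative big_ord_recr.
- rewrite p4 /=; case: eqP => // _.
  by rewrite visited_sum_all /sale_gain prices0.
- move=> s' j' i; rewrite visited00 andbF orbF ltnS leq_eqVlt => h; apply: p5.
  by rewrite visited_all andbT orbC.
Qed.

Hypothesis small_phi : forall i j S, small B (choice_prob I i j S).
Hypothesis small_sale : forall s j i, small B (sale I opt (price s) j i).
Hypothesis small_stock : forall s w j k, (s <= rounds n L T)%N ->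
  small B ((state I opt s).1 w + visited_sum (type_sales s w) j k).
Hypothesis small_supply_sum : forall s i j k, (s <= rounds n L T)%N ->
  small B ((state I opt s).2 i + supply_sum s j k i).
Hypothesis small_cumul : forall s i j w (c : bool), (s <= rounds n L T)%N ->
  small B (cumulative I opt s i j w + c%:R * type_sales s w j i).
Hypothesis small_base : forall j k, small B (visited_sum (sale_gain 0) j k).

Lemma small_base_all : small B (base I opt).
Proof. by have := small_base m 0; rewrite visited_sum_all /sale_gain prices0. Qed.

Lemma run_sales mu s (j : 'I_m) :
  small_memory B mu -> inputs mu -> (s <= rounds n L T)%N ->
  mu c_s [::] = s%:R -> mu c_j [::] = (val j)%:R ->
  mu a_lam [:: val j] = total_arrival I j ->
  (forall i : 'I_n, mu a_gain [:: val i] = gain I (price s) j i /\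
    mu a_code [:: val i] = (code I (price s) j i)%:R) ->
  (forall i : 'I_n, mu a_set [:: val i] = (i \in offered I opt (price s) j)%:R) ->
  progress s j 0 mu ->
  run p_sales mu (progress s j n).
Proof.
move=> hmu inp hs cs cj hlam hg hset h0.
apply: (runs_For n_le M_le (K := n) (Inv := progress s j)) => //; first exact: in_productsE.
- by apply: (progress_frame (frame_update mu [::] 0)) => //.
move=> k mu1 kn; move: k kn mu1; apply: for_ordinal => i mu1 s1 f1 x1 i1.
have inp1 : inputs mu1 by apply: inputs_frame f1 inp.
have [g1 code1] := hg i; rewrite -f1 // in g1; rewrite -f1 // in code1.
have cj1 : mu1 c_j [::] = (val j)%:R by rewrite f1.
have cs1 : mu1 c_s [::] = s%:R by rewrite f1.
have lam1 : mu1 a_lam [:: val j] = total_arrival I j by rewrite f1.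
have mem1 i' : mu1 a_set [:: val i'] = (i' \in offered I opt (price s) j)%:R.
  by rewrite f1 // hset.
have set1 : set_at n mu1 a_set = offered I opt (price s) j.
  by apply/setP => i'; rewrite inE mem1; case: (i' \in _); rewrite ?oner_eq0 ?eqxx.
apply: (@runs_Then _ _ _ _ _ _ _ _ _ (fun mu2 => mu2 = update mu1 a_sale [::]
    (choice_prob I i j (offered I opt (price s) j)))).
  apply: (runs_AskChoice opt n_le (i := i) (j := j)) => //.
  by rewrite set1.
set phi := choice_prob I i j _; set w := code I (price s) j i in code1.
move=> mu2 s2 _ e2.
have E2 : eval mu2 (Get a_lam [:: #c_j] * #a_sale)%expr = sale I opt (price s) j i.
  by rewrite e2 /update /= cj1 natrK lam1.
apply: runs_Do_then => //; first by rewrite E2.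
rewrite E2 => mu3 s3 e3.
have E3 : eval mu3 (Get a_stock [:: Get a_code [:: #c_i]] + #a_sale)%expr =
    (state I opt s).1 w + visited_sum (type_sales s w) j (val i).+1.
  rewrite e3 e2 /update /= x1 natrK code1 natrK (progress_stock i1) visited_sum_step.
  by rewrite /type_sales eqxx mulr1 addrA.
apply: runs_Do_then => //; first by rewrite E3 small_stock.
rewrite E3 => mu4 s4 e4.
have E4 : eval mu4 (Get a_supply [:: #c_i] +
     #a_sale * (e_one - (Get a_code [:: #c_i] == Cst 0)))%expr =
    (state I opt s).2 i + supply_sum s j (val i).+1 i.
  rewrite e4 e3 e2 /update /= x1 natrK (progress_supply i1) code1 pnatr_eq0 -addrA.
  congr (_ + _); rewrite /supply_sum [RHS](bigD1 j) /=; last by rewrite visited_step !eqxx orbT.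
  rewrite [LHS]addrC; congr (_ + _).
    by rewrite /stocked_sales -/w; case: (w == 0%N); rewrite ?subrr ?subr0.
  apply: eq_bigl => j'; rewrite visited_step eqxx andbT.
  by case: eqVneq => [->|_]; rewrite ?visited_irr ?orbF ?andbT ?andbF.
apply: runs_Do_then => //; first by rewrite E4 small_supply_sum.
rewrite E4 => mu5 s5 e5.
have E5 : eval mu5 (Get a_cumul [:: #c_i; #c_j; Get a_code [:: #c_i]] + #a_sale)%expr =
    cumulative I opt s i j w + true%:R * type_sales s w j i.
  rewrite e5 e4 e3 e2 /update /= x1 cj1 !natrK code1 !natrK (progress_cumul i1) visited_irr.
  by rewrite /type_sales eqxx mul0r addr0 mulr1 mul1r.
apply: runs_Do_then => //; first by rewrite E5 small_cumul.
rewrite E5 => mu6 s6 e6.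
have E6 : eval mu6 (#a_base + #a_sale * Get a_gain [:: #c_i] * (#c_s == Cst 0))%expr =
    if s == 0%N then visited_sum (sale_gain 0) j (val i).+1 else base I opt.
  rewrite e6 e5 e4 e3 e2 /update /= x1 natrK (progress_base i1) g1 cs1 pnatr_eq0.
  case: eqP => [s0|_]; last by rewrite mulr0 addr0.
  by rewrite mulr1 visited_sum_step /sale_gain s0.
apply: runs_Do_then => //.
  by rewrite E6; case: ifP => _; rewrite ?small_base_all ?small_base.
rewrite E6 => mu7 s7 e7.
have E7 : eval mu7 (Get a_set [:: #c_i])%expr = (i \in offered I opt (price s) j)%:R.
  by rewrite e7 e6 e5 e4 e3 e2 /update /= x1 natrK mem1.
apply: runs_Do_then => //; first by rewrite E7 small_bool.
rewrite E7 => mu8 s8 e8.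
have E8 : eval mu8 (Get a_code [:: #c_i])%expr = w%:R.
  by rewrite e8 e7 e6 e5 e4 e3 e2 /update /= x1 natrK code1.
apply: runs_Do => //.
  rewrite E8; apply: small_natS; apply: leq_trans (scan_code_le _ _) _.
  exact: leq_trans L_le M_le.
rewrite E8 [map _ _]/=.
have cs8 : mu8 c_s [::] = s%:R by rewrite e8 e7 e6 e5 e4 e3 e2 /update /=.
have cj8 : mu8 c_j [::] = (val j)%:R by rewrite e8 e7 e6 e5 e4 e3 e2 /update /=.
have ci8 : mu8 c_i [::] = (val i)%:R by rewrite e8 e7 e6 e5 e4 e3 e2 /update /= x1.
rewrite cs8 cj8 ci8 !natrK.
have [p1 p2 p3 p4 p5] := i1; split.
- move=> w'; rewrite e8 e7 e6 e5 e4 e3 e2 /update /= x1 !natrK code1 !natrK.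
  rewrite eqseq_cons andbT; case: eqVneq => [->//|w'w].
  by rewrite p1 visited_sum_step /type_sales -/w eq_sym (negbTE w'w) mulr0 addr0.
- move=> i'; rewrite e8 e7 e6 e5 e4 e3 e2 /update /= x1 !natrK.
  rewrite eqseq_cons andbT val_eqE; case: eqVneq => [->//|i'i].
  rewrite p2; congr (_ + _); apply: eq_bigl => j'.
  by rewrite visited_step (negbTE i'i) andbF orbF.
- move=> i' j' w'; rewrite e8 e7 e6 e5 e4 e3 e2 /update /= x1 cj1 !natrK code1 !natrK.
  rewrite !eqseq_cons andbT !val_eqE visited_step.
  case: eqVneq => [->|i'i] /=; last by rewrite andbF orbF p3.
  rewrite andbT; case: eqVneq => [->|j'j] /=; last by rewrite orbF p3.
  rewrite orbT; case: eqVneq => [->//|w'w].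
  by rewrite p3 visited_irr /type_sales -/w eq_sym (negbTE w'w) !mulr0.
- by rewrite e8 e7 /update /=.
- move=> s' j' i' hv; rewrite e8 e7 e6 e5 e4 e3 e2 /update /= x1 cj1 cs1 !natrK.
  rewrite !eqseq_cons andbT !val_eqE.
  move: hv; rewrite visited_step.
  case: eqVneq => [->|s's] /=; last by rewrite orbF => hv; apply: p5; rewrite hv.
  rewrite ltnn /=; case: eqVneq => [->|j'j] /=; last first.
    by rewrite orbF => hv; apply: p5; rewrite eqxx hv orbT.
  case: eqVneq => [->|i'i] //=; rewrite orbF => hv; apply: p5; by rewrite eqxx hv orbT.
Qed.


Lemma run_round mu s :
  small_memory B mu -> inputs mu -> (s <= rounds n L T)%N ->
  mu c_s [::] = s%:R ->
  (forall j : 'I_m, mu a_lam [:: val j] = total_arrival I j) ->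
  progress s 0 0 mu -> run p_round mu (progress s.+1 0 0).
Proof.
move=> hmu inp hs cs hlam h0.
apply: (runs_Then (P := fun mu' => forall (i : 'I_n) (l : 'I_L),
    mu' a_price [:: val i; val l] = price s i l)).
  have [p1 p2 _ p4 _] := h0; apply: run_prices => //.
  - by move=> w; rewrite p1 visited_sum0 addr0.
  - by move=> i; rewrite p2 /supply_sum big1 ?addr0 // => j; rewrite visited00.
  - by rewrite p4 => /negbTE ->.
move=> mu1 s1 f1 hp.
have inp1 : inputs mu1 by apply: inputs_frame f1 inp.
have p1 : progress s 0 0 mu1 by apply: progress_frame f1 _ h0.
apply: (runs_For n_le M_le (K := m) (Inv := fun j => progress s j 0)) => //.
- exact: in_typesE.
- by apply: (progress_frame (frame_update mu1 [::] 0)).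
- move=> k mu2 kn; move: k kn mu2; apply: for_ordinal => j mu2 s2 f2 x2 i2.
  have inp2 : inputs mu2 by apply: inputs_frame f2 inp1.
  have hp2 (i : 'I_n) (l : 'I_L) : mu2 a_price [:: val i; val l] = price s i l by rewrite f2.
  have lam2 : mu2 a_lam [:: val j] = total_arrival I j by rewrite f2 // f1.
  have cs2 : mu2 c_s [::] = s%:R by rewrite f2 // f1.
  apply: (runs_Then (run_gains s2 inp2 hs x2 hp2)) => mu3 s3 f3 hg.
  have inp3 : inputs mu3 by apply: inputs_frame f3 inp2.
  have p3 : progress s j 0 mu3 by apply: progress_frame f3 _ i2.
  apply: (runs_Then (P := fun mu' => forall i : 'I_n,
      mu' a_set [:: val i] = (i \in offered I opt (price s) j)%:R)).
    apply: (@runs_AskAssort _ _ _ _ _ _ n_le _ _ _ _ j) => //; first by rewrite /= f3.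
    move=> mu4 f4 h i; rewrite h /offered; congr ((_ \in opt j _)%:R).
    by apply/ffunP => i'; rewrite !ffunE; have [-> _] := hg i'.
  move=> mu4 s4 f4 hset.
  have inp4 : inputs mu4 by apply: inputs_frame f4 inp3.
  apply: (runs_conseq (Q := progress s j n)).
    apply: run_sales => //.
    - by rewrite f4 // f3.
    - by rewrite f4 // f3.
    - by rewrite f4 // f3.
    - by move=> i; rewrite !f4.
    - by apply: progress_frame f4 _ p3.
  move=> mu5 s5 f5 h5; apply: progress_next_type.
  by apply: (progress_frame (frame_update mu5 [::] (val j).+1%:R)).
- by move=> mu' _ _; apply: progress_next_round.
Qed.

Hypothesis rounds_le : (rounds n L T <= M)%N.

Lemma run_loop mu :
  small_memory B mu -> inputs mu -> mu out_seeds [::] = (rounds n L T)%:R ->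
  (forall j : 'I_m, mu a_lam [:: val j] = total_arrival I j) ->
  progress 0 0 0 mu -> run p_loop mu (progress (rounds n L T) 0 0).
Proof.
move=> hmu inp hN hlam h0.
apply: (runs_For n_le M_le (K := rounds n L T) (Inv := fun s => progress s 0 0)) => //.
- by apply: (progress_frame (frame_update mu [::] 0)).
- move=> s mu1 hs s1 f1 x1 i1.
  apply: (runs_conseq (Q := progress s.+1 0 0)).
    apply: run_round => //; first by apply: inputs_frame f1 inp.
      exact: ltnW.
    by move=> j; rewrite f1.
  move=> mu2 s2 f2 h2.
  by apply: (progress_frame (frame_update mu2 [::] s.+1%:R)).
Qed.

Lemma progress_init mu :
  (forall z idx, z \in [:: a_stock; a_supply; a_cumul; a_base] -> mu z idx = 0) ->
  progress 0 0 0 mu.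
Proof.
move=> h0; split.
- by move=> w; rewrite h0 // visited_sum0 addr0.
- by move=> i; rewrite h0 // /supply_sum big1 ?addr0 // => j; rewrite visited00.
- by move=> i j w; rewrite h0 // visited00 mul0r addr0 /cumulative big_ord0.
- by rewrite h0 // visited_sum0.
- by move=> s j i; rewrite visited00 andbF.
Qed.

Lemma run_buffer mu : small_memory B mu -> inputs mu -> mu a_buffer [::] = 0 ->
  run p_buffer mu (fun mu' => mu' a_buffer [::] = (buffer I)%:R).
Proof.
move=> hmu inp b0.
pose Inv k (mu' : memory) :=
  mu' a_buffer [::] = (\sum_(t < T | (t < k)%N) buffer_fits I t.+1)%N%:R.
apply: (runs_For n_le M_le (K := T) (Inv := Inv)) => //; first exact: in_periodsE.
- by rewrite /Inv updateN // b0 big1.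
- move=> k mu1 kn; move: k kn mu1; apply: for_ordinal => t mu1 s1 f1 x1 i1.
  have inp1 : inputs mu1 by apply: inputs_frame f1 inp.
  have sb (c : bool) : small B c%:R by apply: small_bool.
  apply: runs_Do_then => //; first exact: (sb true).
  rewrite /= => mu2 s2 e2.
  have inp2 : inputs mu2 by rewrite e2; apply: inputs_update.
  pose P := buffer_fits_at I (val t).+1.
  have c2 : mu2 c_t [::] = (val t)%:R by rewrite e2 updateN.
  apply: (runs_Then (P := fun mu' => mu' a_ok [::] = (buffer_fits I (val t).+1)%:R)).
    pose Inv2 a (mu' : memory) := mu' a_ok [::] = (visited_forall P a 0)%:R.
    apply: (runs_For n_le M_le (K := n) (Inv := Inv2)) => //; first exact: in_productsE.
    + by rewrite /Inv2 e2 /update /= visited_forall0.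
    + move=> k mu3 kn; move: k kn mu3; apply: for_ordinal => i mu3 s3 f3 x3 i3.
      have inp3 : inputs mu3 by apply: inputs_frame f3 inp2.
      pose Inv3 a (mu' : memory) := mu' a_ok [::] = (visited_forall P i a)%:R.
      apply: (runs_For n_le M_le (K := L) (Inv := Inv3)) => //; first exact: in_warehousesE.
      * move=> k mu4 kn; move: k kn mu4; apply: for_ordinal => l mu4 s4 f4 x4 i4.
        have inp4 : inputs mu4 by apply: inputs_frame f4 inp3.
        have E : eval mu4 (#a_ok *
          ((#c_t + e_one) * (#c_t + e_one) * (#in_products * #in_types) <=
             Get in_capacity [:: #c_l]) *
          ((Get in_supply [:: #c_i] == Cst 0) +
           ((#c_t + e_one) * (#c_t + e_one) * (#in_warehouses * #in_types) <=
             Get in_supply [:: #c_i])))%expr = (visited_forall P i (val l).+1)%:R.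
          rewrite /= in_productsE // in_typesE // in_warehousesE // i4 x4.
          rewrite [mu4 c_t _]f4 // [mu3 c_t _]f3 // c2 [mu4 c_i _]f4 // x3 !natrK.
          rewrite in_capacityE // in_supplyE // natr1 visited_forall_step.
          rewrite -[_ * _ * (n%:R * _)]natrM4 -[_ * _ * (L%:R * _)]natrM4.
          rewrite -[RHS]mulr_bool -mulrA; congr (_ * _).
          rewrite /P /buffer_fits_at -[RHS]mulr_bool.
          congr (_ * _); case: eqP => [->|_]; last by rewrite add0r.
          by rewrite lern0 !muln_eq0 /= !eqn0Ngt L_gt0 m_gt0 addr0.
        by apply: runs_Do => //; rewrite E // /Inv3 updateN // updateE.
      * by move=> mu4 _ _; rewrite /Inv3 /Inv2 visited_forall_next updateN.
    + by move=> mu3 _ _; rewrite /Inv2 visited_forall_all.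
  move=> mu3 s3 f3 hok.
  have E : eval mu3 (#a_buffer + #a_ok)%expr =
    (\sum_(t' < T | (t' < (val t).+1)%N) buffer_fits I t'.+1)%N%:R.
    by rewrite /= hok f3 // e2 updateN // i1 sum_ltS natrD.
  apply: runs_Do => //.
    rewrite E; apply: small_natS; apply: leq_trans M_le; apply: leq_trans T_le.
    rewrite -[leqRHS]card_ord -sum1_card big_mkcond /=.
    by apply: leq_sum => t' _; case: ifP => // _; case: buffer_fits.
- by move=> mu' _ _; rewrite /Inv /buffer sum_ltK.
Qed.


Notation quotas := (quota I opt).

Definition seen (i0 j0 l0 i j l : nat) : bool :=
  (i < i0)%N || (i == i0) && visited j0 l0 j l.

Record filled (i0 j0 l0 : nat) (mu : memory) : Prop := Filled {
  filled_quota : forall (i : 'I_n) (j : 'I_m) (l : 'I_L), seen i0 j0 l0 i j l ->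
    mu a_quota [:: val i; val j; (val l).+1] = (quotas i j l)%:R;
  filled_placement : forall (i : 'I_n) (l : 'I_L),
    mu out_placement [:: val i; val l] =
      \sum_(j < m | seen i0 j0 l0 i j l) (quotas i j l)%:R
}.

Lemma filled_update x i0 j0 l0 mu idx v : x \notin [:: a_quota; out_placement] ->
  filled i0 j0 l0 mu -> filled i0 j0 l0 (update mu x idx v).
Proof.
rewrite !inE negb_or => /andP[h1 h2] [q p]; split.
  by move=> i j l h; rewrite updateN ?q // eq_sym; apply/negbTE.
by move=> i l; rewrite updateN ?p // eq_sym; apply/negbTE.
Qed.

Lemma filled_ext i0 j0 l0 i0' j0' l0' mu :
  (forall (i : 'I_n) (j : 'I_m) (l : 'I_L), seen i0 j0 l0 i j l = seen i0' j0' l0' i j l) ->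
  filled i0 j0 l0 mu -> filled i0' j0' l0' mu.
Proof.
move=> e [q p]; split; first by move=> i j l h; apply: q; rewrite e.
by move=> i l; rewrite p; apply: eq_bigl => j; rewrite e.
Qed.

Hypothesis small_quota : forall i j l, small B (quotas i j l)%:R.
Hypothesis small_placement : forall i l (P : pred 'I_m),
  small B (\sum_(j < m | P j) (quotas i j l)%:R).
Hypothesis cumulative_ge0 : forall s i j w, 0 <= cumulative I opt s i j w.

Lemma run_quotas mu : small_memory B mu -> inputs mu ->
  mu out_seeds [::] = (rounds n L T)%:R -> mu a_buffer [::] = (buffer I)%:R ->
  (forall (i : 'I_n) (j : 'I_m) w, mu a_cumul [:: val i; val j; w] =
    cumulative I opt (rounds n L T) i j w) ->
  (forall idx, mu out_placement idx = 0) ->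
  run p_quotas mu (filled n 0 0).
Proof.
move=> hmu inp hN hb hY hp0.
apply: (runs_For n_le M_le (K := n) (Inv := fun i => filled i 0 0)) => //.
- exact: in_productsE.
- apply: filled_update => //; split; first by move=> i j l; rewrite /seen visited00 andbF.
  by move=> i l; rewrite hp0 big1 // => j; rewrite /seen visited00 andbF.
move=> k mu1 kn; move: k kn mu1; apply: for_ordinal => i mu1 s1 f1 x1 i1.
have inp1 : inputs mu1 by apply: inputs_frame f1 inp.
apply: (runs_For n_le M_le (K := m) (Inv := fun j => filled i j 0)) => //.
- exact: in_typesE.
- exact: filled_update.
- move=> k mu2 kn; move: k kn mu2; apply: for_ordinal => j mu2 s2 f2 x2 i2.
  have inp2 : inputs mu2 by apply: inputs_frame f2 inp1.
  apply: (runs_For n_le M_le (K := L) (Inv := fun l => filled i j l)) => //.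
  + exact: in_warehousesE.
  + exact: filled_update.
  + move=> k mu3 kn; move: k kn mu3; apply: for_ordinal => l mu3 s3 f3 x3 i3.
    have inp3 : inputs mu3 by apply: inputs_frame f3 inp2.
    have ci : mu3 c_i [::] = (val i)%:R by rewrite f3 // f2.
    have cj : mu3 c_j [::] = (val j)%:R by rewrite f3.
    have b3 : mu3 a_buffer [::] = (buffer I)%:R by rewrite f3 // f2 // f1.
    have N3 : mu3 out_seeds [::] = (rounds n L T)%:R by rewrite f3 // f2 // f1.
    have Y3 : mu3 a_cumul [:: val i; val j; (val l).+1] =
      cumulative I opt (rounds n L T) i j (val l).+1 by rewrite f3 // f2 // f1.
    have E : eval mu3 (Floor ((#a_buffer - e_one) / #a_buffer *
               (Cst 16 * #in_periods / (Cst 16 * #in_periods + e_one)) *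
               (Get a_cumul [:: #c_i; #c_j; #c_l + e_one] / #out_seeds)) + #a_buffer)%expr =
       (quotas i j l)%:R.
      rewrite /= ci cj x3 natr1 !natrK Y3 b3 N3 in_periodsE // /quota natrD.
      (* [Floor] yields the integer floor and [quota] the natural truncation; they agree as the
         argument is nonnegative. *)
      congr (_ + _); apply: floor_truncn.
      by rewrite mulr_ge0 ?quota_ratio_ge0 // divr_ge0 // cumulative_ge0.
    apply: runs_Do_then => //; first by rewrite E.
    rewrite E => mu4 s4 e4.
    have E2 : eval mu4
        (Get out_placement [:: #c_i; #c_l] + Get a_quota [:: #c_i; #c_j; #c_l + e_one])%expr =
      \sum_(j' < m | seen i j (val l).+1 i j' l) (quotas i j' l)%:R.
      rewrite e4 /update /= ci cj x3 natr1 !natrK eqxx.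
      rewrite (filled_placement i3) [RHS](bigD1 j) /=; last first.
        by rewrite /seen visited_step !eqxx /= !orbT.
      rewrite addrC; congr (_ + _); apply: eq_bigl => j'.
      rewrite /seen ltnn eqxx /= visited_step eqxx andbT.
      by case: eqVneq => [->|_]; rewrite ?visited_irr ?orbF ?andbT ?andbF.
    apply: runs_Do => //; first by rewrite E2.
    rewrite E2; apply: filled_update => //; have [q p] := i3.
    have step (i' : 'I_n) (j' : 'I_m) (l' : 'I_L) : seen i j (val l).+1 i' j' l' =
        seen i j l i' j' l' || [&& i' == i, j' == j & l' == l].
      by rewrite /seen visited_step andb_orr orbA val_eqE.
    split.
      move=> i' j' l'; rewrite step e4 /update /= ci cj x3 natr1 !natrK.
      rewrite !eqseq_cons eqSS andbT !val_eqE.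
      case: and3P => [[/eqP -> /eqP -> /eqP -> //]|_]; rewrite orbF; exact: q.
    move=> i' l'; rewrite e4 /update /= ci x3 !natrK.
    rewrite !eqseq_cons andbT !val_eqE.
    case: andP => [[/eqP -> /eqP -> //]|hne]; rewrite p; apply: eq_bigl => j'.
    rewrite step; case: and3P => [[/eqP ei _ /eqP el]|_]; last by rewrite orbF.
    by case: hne; rewrite ei el !eqxx.
  + move=> mu3 _ _ h; apply: filled_update => //; apply: filled_ext h => i' j' l'.
    by rewrite /seen visited_next.
- move=> mu2 _ _ h; apply: filled_update => //; apply: filled_ext h => i' j' l'.
  by rewrite /seen visited_all visited00 andbT andbF orbF ltnS [RHS]leq_eqVlt orbC.
Qed.

Lemma run_plan mu : small_memory B mu -> inputs mu ->
  (forall z idx, (8 <= z)%N -> mu z idx = 0) ->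
  run p_plan mu (fun mu' =>
    [/\ forall (i : 'I_n) (l : 'I_L),
           mu' out_placement [:: val i; val l] = (\sum_j quotas i j l)%N%:R,
        mu' out_seeds [::] = (rounds n L T)%:R,
        forall (i : 'I_n) (j : 'I_m) (l : 'I_L),
           mu' a_quota [:: val i; val j; (val l).+1] = (quotas i j l)%:R &
        forall s (j : 'I_m) (i : 'I_n), (s < rounds n L T)%N ->
           mu' a_offer [:: s; val j; val i] = (i \in offered I opt (price s) j)%:R /\
           mu' a_source [:: s; val j; val i] = (code I (price s) j i)%:R]).
Proof.
move=> hmu inp h0.
apply: (runs_Then (run_arrivals hmu inp _)) => [idx|mu1 s1 f1 hlam]; first exact: h0.
have inp1 : inputs mu1 by apply: inputs_frame f1 inp.
have sN : small B (rounds n L T)%:R by apply: small_natS; apply: leq_trans M_le.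
apply: (runs_Then (run_rounds s1 inp1 sN)) => mu2 s2 f2 hN.
have inp2 : inputs mu2 by apply: inputs_frame f2 inp1.
apply: (runs_Then (P := progress (rounds n L T) 0 0)).
  apply: run_loop => //; first by move=> j; rewrite f2.
  apply: progress_init => z idx; rewrite !inE.
  by case/or4P=> /eqP ->; rewrite f2 // f1 // h0.
move=> mu3 s3 f3 hp.
have inp3 : inputs mu3 by apply: inputs_frame f3 inp2.
apply: (runs_Then (run_buffer s3 inp3 _)); first by rewrite f3 // f2 // f1 // h0.
move=> mu4 s4 f4 hb.
have inp4 : inputs mu4 by apply: inputs_frame f4 inp3.
have hN4 : mu4 out_seeds [::] = (rounds n L T)%:R by rewrite f4 // f3.
have hp4 : progress (rounds n L T) 0 0 mu4 by apply: progress_frame f4 _ hp.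
apply: (runs_conseq (run_quotas s4 inp4 hN4 hb _ _)).
- by move=> i j w; rewrite (progress_cumul hp4) visited00 mul0r addr0.
- by move=> idx; rewrite f4 // f3 // f2 // f1 // h0.
move=> mu5 s5 f5 [q p]; split.
- move=> i l; rewrite p natr_sum; apply: eq_bigl => j.
  by rewrite /seen ltn_ord.
- by rewrite f5.
- by move=> i j l; apply: q; rewrite /seen ltn_ord.
- by move=> s j i hs; rewrite !f5 //; apply: (progress_decisions hp4); rewrite hs.
Qed.

End PlanRuns.

(** * Sizes of the computed numbers *)

Section Bounds.
Variable z : nat.

Definition rounds_bound : nat := (33 * 16 * 16 * z ^ 6 * (z + z))%N.
Definition lam_bits : nat := (z * z.+1)%N.
Definition sale_bits : nat := (lam_bits + z)%N.
Definition single_bits : nat := (z * sale_bits.+1)%N.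
Definition double_bits : nat := (z * single_bits.+1)%N.
Definition cumul_bits : nat := (rounds_bound * sale_bits.+1)%N.
Definition state_bits : nat := (z * (z * cumul_bits.+1).+1)%N.
Definition base_bits : nat := (z * (z * (sale_bits + z).+1).+1)%N.
Definition step_bits : nat := (16 * z ^ 4 * (z + z))%N.
Definition price_bits : nat :=
  (step_bits + base_bits + ((state_bits + z + rounds_bound).+1 + z))%N.
Definition quota_bits : nat :=
  (((z + 0).+1 + z + ((16 * z) + (16 * z + 1)) + (cumul_bits + rounds_bound)).+1 + z).+1%N.

Definition loop_bound : nat := (rounds_bound + z)%N.
Definition bit_bound : nat :=
  ((state_bits + double_bits).+1 + (state_bits + single_bits).+1 +
   (cumul_bits + sale_bits).+1 + base_bits + (z + (price_bits + price_bits).+1).+1 +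
   z * quota_bits.+1 + quota_bits + sale_bits + lam_bits + loop_bound)%N.

End Bounds.

Lemma poly_bounded_loop : poly_bounded loop_bound.
Proof. by rewrite /loop_bound /rounds_bound; poly_tac. Qed.

Lemma poly_bounded_bits : poly_bounded bit_bound.
Proof.
have p1 : poly_bounded rounds_bound by rewrite /rounds_bound; poly_tac.
have p2 : poly_bounded lam_bits by rewrite /lam_bits; poly_tac.
have p3 : poly_bounded sale_bits by rewrite /sale_bits; poly_tac.
have p4 : poly_bounded single_bits by rewrite /single_bits; poly_tac.
have p5 : poly_bounded double_bits by rewrite /double_bits; poly_tac.
have p6 : poly_bounded cumul_bits by rewrite /cumul_bits; poly_tac.
have p7 : poly_bounded state_bits by rewrite /state_bits; poly_tac.
have p8 : poly_bounded base_bits by rewrite /base_bits; poly_tac.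
have p9 : poly_bounded step_bits by rewrite /step_bits; poly_tac.
have p10 : poly_bounded price_bits by rewrite /price_bits; poly_tac.
have p11 : poly_bounded quota_bits by rewrite /quota_bits; poly_tac.
have p12 := poly_bounded_loop; rewrite /bit_bound; poly_tac.
Qed.

Section Sizes.
Variables (n m L T : nat) (I : problem rat n m L T).
Variables (opt : 'I_m -> {ffun 'I_n -> rat} -> {set 'I_n}).

Let Z := input_size I.
Let B := bit_bound Z.
Let M := loop_bound Z.
Let n_le : (n <= Z)%N := size_products I.
Let m_le : (m <= Z)%N := size_types I.
Let L_le : (L <= Z)%N := size_warehouses I.
Let T_le : (T <= Z)%N := size_periods I.

Notation price s := (prices I opt s).

Lemma rounds_le : (rounds n L T <= rounds_bound Z)%N.
Proof.
apply: leq_mul; last by apply: leq_add.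
by apply: leq_mul; rewrite // leq_exp2r.
Qed.

Lemma loop_bound_lt : (M < B)%N.
Proof. rewrite /M /B /bit_bound; lia. Qed.

Lemma small_sum_size k (P : pred 'I_k) (F : 'I_k -> rat) b c : (k <= c)%N ->
  (forall i, P i -> small b (F i)) -> small (c * b.+1) (\sum_(i | P i) F i).
Proof.
by move=> kc h; apply: small_le (small_sum_ord h); rewrite leq_mul2r kc orbT.
Qed.

Lemma small_arrivals j (P : pred 'I_T) :
  small (lam_bits Z) (\sum_(t < T | P t) arrival I j t).
Proof. by apply: small_sum_size => // t _; apply: small_arrival. Qed.

Lemma small_sale p j i : small (sale_bits Z) (sale I opt p j i).
Proof. by apply: smallM; [apply: small_arrivals | apply: small_choice]. Qed.

(** The size of a sale does not depend on the prices that led to it, so sizes do not compound from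
    round to round. *)
Lemma small_cumulative s i j w : (s <= rounds n L T)%N ->
  small (cumul_bits Z) (cumulative I opt s i j w).
Proof.
move=> hs; apply: small_sum_size; first exact: leq_trans hs rounds_le.
by move=> s' _; apply: small_mul_bool; apply: small_sale.
Qed.

Lemma small_state1 s w : (s <= rounds n L T)%N -> small (state_bits Z) ((state I opt s).1 w).
Proof.
by move=> hs; rewrite state_stock; do 2 (apply: small_sum_size => // ? _); apply: small_cumulative.
Qed.

Lemma small_state2 s i : (s <= rounds n L T)%N -> small (state_bits Z) ((state I opt s).2 i).
Proof.
by move=> hs; rewrite state_supply; do 2 (apply: small_sum_size => // ? _); apply: small_cumulative.
Qed.

Lemma small_base_sum j k : small (base_bits Z) (visited_sum (sale_gain I opt 0) j k).
Proof.
do 2 (apply: small_sum_size => // ? _); apply: smallM; first exact: small_sale.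
rewrite prices0; apply: small_scan => l; apply: small_at_ord => l'.
by rewrite subr0; apply: small_reward.
Qed.

Lemma small_price s i l : (s <= rounds n L T)%N ->
  small (price_bits Z + price_bits Z).+1 (price s i l).
Proof.
move=> hs; have hst : small (step_bits Z) (step_size n L T).
  apply: smallV; apply: small_natS; apply: leq_mul; last by apply: leq_add.
  by apply: leq_mul; rewrite // leq_exp2r.
have hb : small (base_bits Z) (base I opt).
  by have := small_base_sum m 0; rewrite visited_sum_all /sale_gain prices0.
have hs' : small (rounds_bound Z) s%:R.
  by apply: small_natS; apply: leq_trans hs rounds_le.
apply: smallD.
  apply: smallM; first exact: smallM.
  apply: small_div; last exact: small_capacity.
  apply: small_pospart; apply: smallB hs'.
  by apply: small_div; [apply: small_state1 | apply: small_capacity].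
apply: smallM; first exact: smallM.
apply: small_div; last exact: small_supply.
apply: small_pospart; apply: smallB hs'.
by apply: small_div; [apply: small_state2 | apply: small_supply].
Qed.

Lemma buffer_le : (buffer I <= T)%N.
Proof.
rewrite -[leqRHS]card_ord -sum1_card; apply: leq_sum => t _; exact: leq_b1.
Qed.

Lemma small_input_memory : small_memory B (input_memory I).
Proof.
have hZ : (Z <= B)%N by rewrite /B /bit_bound /loop_bound; lia.
have sn k : (k <= Z)%N -> small B k%:R.
  by move=> h; apply: small_natS; apply: leq_trans h hZ.
move=> x idx; rewrite /input_memory.
do 4 (case: ifP => _; first exact: sn).
case: ifP => _.
  case: idx => [|j [|t [|? ?]]]; rewrite ?small0 //.
  by do 2 (apply: small_at_ord => ?); apply: small_le hZ _; apply: small_arrival.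
case: ifP => _.
  case: idx => [|i [|j [|l [|? ?]]]]; rewrite ?small0 //.
  by do 3 (apply: small_at_ord => ?); apply: small_le hZ _; apply: small_reward.
case: ifP => _.
  case: idx => [|l [|? ?]]; rewrite ?small0 //.
  by apply: small_at_ord => ?; apply: small_le hZ _; apply: small_capacity.
case: ifP => _; last exact: small0.
case: idx => [|i [|? ?]]; rewrite ?small0 //.
by apply: small_at_ord => ?; apply: small_le hZ _; apply: small_supply.
Qed.

Hypothesis cumulative_ge0 : forall s i j w, 0 <= cumulative I opt s i j w.

Lemma small_quota i j l : small (quota_bits Z) (quota I opt i j l)%:R.
Proof.
have hb : small Z (buffer I)%:R by apply: small_natS; apply: leq_trans buffer_le T_le.
rewrite /quota natrD; apply: smallD => //.
rewrite -floor_truncn; last first.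
  by rewrite mulr_ge0 ?quota_ratio_ge0 // divr_ge0 // cumulative_ge0.
apply: small_floor; apply: smallM; last first.
  apply: small_div; first exact: small_cumulative.
  by apply: small_natS; apply: rounds_le.
apply: smallM; first by apply: small_div => //; apply: smallB => //; apply: (@small_nat 0 1).
apply: small_div; first by rewrite -natrM; apply: small_natS; rewrite leq_mul2l T_le orbT.
by rewrite -natrM natr1; apply: small_natS; rewrite addn1 ltnS leq_mul2l T_le orbT.
Qed.

Hypotheses (n_gt0 : (0 < n)%N) (m_gt0 : (0 < m)%N) (L_gt0 : (0 < L)%N) (T_gt0 : (0 < T)%N).

Lemma plan_runs mu : small_memory B mu -> inputs I mu ->
  (forall x idx, (8 <= x)%N -> mu x idx = 0) ->
  runs opt (choice_prob I) B M p_plan mu (fun mu' =>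
    [/\ forall (i : 'I_n) (l : 'I_L),
           mu' out_placement [:: val i; val l] = (\sum_j quota I opt i j l)%N%:R,
        mu' out_seeds [::] = (rounds n L T)%:R,
        forall (i : 'I_n) (j : 'I_m) (l : 'I_L),
           mu' a_quota [:: val i; val j; (val l).+1] = (quota I opt i j l)%:R &
        forall s (j : 'I_m) (i : 'I_n), (s < rounds n L T)%N ->
           mu' a_offer [:: s; val j; val i] = (i \in offered I opt (price s) j)%:R /\
           mu' a_source [:: s; val j; val i] = (code I (price s) j i)%:R]).
Proof.
move=> hmu inp h0.
have leM k : (k <= Z)%N -> (k <= M)%N.
  by move=> h; apply: leq_trans h _; rewrite leq_addl.
have leB b q : small b q -> (b <= B)%N -> small B q by move=> h1 h2; apply: small_le h1.
apply: run_plan => //; try by apply: leM.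
- exact/ltnW/loop_bound_lt.
- move=> j k; apply: leB (small_arrivals _ _) _; rewrite /B /bit_bound; lia.
- move=> s i l hs; apply: leB (small_price _ _ hs) _; rewrite /B /bit_bound; lia.
- move=> s i j l hs.
  apply: leB (smallB (small_reward I i j l) (small_price i l hs)) _.
  rewrite /B /bit_bound; lia.
- move=> i j S; apply: leB (small_choice _ _ _ _) _; rewrite -/Z /B /bit_bound; lia.
- move=> s j i; apply: leB (small_sale _ _ _) _; rewrite /B /bit_bound; lia.
- move=> s w j k hs; apply: leB (smallD (small_state1 _ hs) _) _; last first.
    by apply: (_ : (_.+1 <= B)%N); rewrite /B /bit_bound; instantiate (1 := double_bits Z); lia.
  do 2 (apply: small_sum_size => // ? _); apply: small_mul_bool; exact: small_sale.
- move=> s i j k hs; apply: leB (smallD (small_state2 _ hs) _) _; last first.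
    by apply: (_ : (_.+1 <= B)%N); rewrite /B /bit_bound; instantiate (1 := single_bits Z); lia.
  apply: small_sum_size => // ? _; apply: small_mul_bool; exact: small_sale.
- move=> s i j w c hs; apply: leB (smallD (small_cumulative _ _ _ hs) _) _; last first.
    by apply: (_ : (_.+1 <= B)%N); rewrite /B /bit_bound; instantiate (1 := sale_bits Z); lia.
  rewrite mulrC; apply: small_mul_bool; apply: small_mul_bool; exact: small_sale.
- move=> j k; apply: leB (small_base_sum _ _) _; rewrite /B /bit_bound; lia.
- exact: (leq_trans rounds_le (leq_addr _ _)).
- move=> i j l; apply: leB (small_quota _ _ _) _; rewrite /B /bit_bound; lia.
- move=> i l P; apply: (leB (Z * (quota_bits Z).+1)%N).
    by apply: small_sum_size => // j _; apply: small_quota.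
  rewrite /B /bit_bound; lia.
Qed.

End Sizes.

(** * The policy program *)

Definition a_wh := 45%N.
Definition a_own := 46%N.
Definition a_all := 47%N.
Definition a_hit := 48%N.

(** The policy program receives no stock levels; it recovers them from the history by counting past
    sales of the product from the warehouse, in total and for the present type. *)
Definition p_count : cmd :=
  For c_t in_now
    (Do a_hit [::] ((Get past_choice [:: #c_t] == #c_i + e_one) *
                    (Get past_warehouse [:: #c_t; #c_i] == #a_wh)) ;;
     Do a_all [::] (#a_all + #a_hit) ;;
     Do a_own [::] (#a_own + #a_hit * (Get past_type [:: #c_t] == #in_type + e_one)))%expr.

(** For the virtual warehouse [a_wh] is 0: the index [a_wh - 1] is truncated to 0, and whatever is
    read there is multiplied by 0. *)
Definition p_act : cmd :=
  For c_i in_products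
    (Do a_wh [::] (Get a_source [:: #in_seed; #in_type; #c_i]) ;;
     Do a_own [::] (Cst 0) ;;
     Do a_all [::] (Cst 0) ;;
     p_count ;;
     Do out_offer [:: #c_i] (Get a_offer [:: #in_seed; #in_type; #c_i]) ;;
     Do out_warehouse [:: #c_i]
       (#a_wh * (#a_own + e_one <= Get a_quota [:: #c_i; #in_type; #a_wh]) *
        (#a_all + e_one <= Get out_placement [:: #c_i; #a_wh - e_one])))%expr.

Definition code_source (L : nat) (w : nat) : option 'I_L :=
  if w is w'.+1 then insub w' else None.

Section Act.
Variables (n m L T : nat) (I : problem rat n m L T).
Variables (opt : 'I_m -> {ffun 'I_n -> rat} -> {set 'I_n}).
Variables (B M : nat).
Hypotheses (n_le : (n <= M)%N) (m_le : (m <= M)%N) (L_le : (L <= M)%N) (T_le : (T <= M)%N).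
Hypothesis (M_lt : (M < B)%N).

Let M_le : (M <= B)%N. Proof. exact: ltnW. Qed.

Notation run := (runs opt (choice_prob I) B M).

Lemma small_query mu (h : history n m L) (j : 'I_m) (u : nat) :
  small_memory B mu -> (size h <= M)%N -> (u <= M)%N ->
  small_memory B (query_memory mu h j u).
Proof.
move=> hmu hM uM x idx; have sm k : (k <= M)%N -> small B k%:R.
  by move=> kM; apply: small_natS; apply: leq_trans M_le.
rewrite /query_memory; case: ifP => _; first exact: sm.
case: ifP => _; first exact/sm/(leq_trans _ m_le)/ltnW/ltn_ord.
case: ifP => _; first exact: sm.
case: ifP => _.
  case: idx => [|s [|? ?]]; rewrite ?small0 // /past_type_value.
  by case: (nth _ _ _) => [[[j' _] _]|]; rewrite ?small0 // sm //;
    exact: leq_trans (ltn_ord _) m_le.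
case: ifP => _.
  case: idx => [|s [|i [|? ?]]]; rewrite ?small0 //; apply: small_at_ord => i'.
  by rewrite /past_offer_value; case: (nth _ _ _) => [[[j' [A f]] _]|]; rewrite ?small0 ?small_bool.
case: ifP => _.
  case: idx => [|s [|i [|? ?]]]; rewrite ?small0 //; apply: small_at_ord => i'.
  rewrite /past_warehouse_value; case: (nth _ _ _) => [[[j' [A f]] _]|]; rewrite ?small0 //.
  by case: (f i') => [l|]; rewrite ?small0 // sm //;
    exact: leq_trans (ltn_ord _) L_le.
case: ifP => _ //.
case: idx => [|s [|? ?]]; rewrite ?small0 // /past_choice_value.
by case: (nth _ _ _) => [[[j' a] [i|]]|]; rewrite ?small0 // sm //;
    exact: leq_trans (ltn_ord _) n_le.
Qed.

Definition past_hit (i : 'I_n) (w : nat) (e : event n m L) : bool :=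
  (past_choice_value e == (val i).+1%:R) && (past_warehouse_value e i == w%:R).
Definition past_own (i : 'I_n) (j : 'I_m) (w : nat) (e : event n m L) : bool :=
  past_hit i w e && (past_type_value e == (val j).+1%:R).

(** The shift by one keeps real warehouses and products apart from the 0 that encodes their
    absence. *)
Lemma past_hitE i (l : 'I_L) e : past_hit i (val l).+1 e = served i l e.
Proof.
rewrite /past_hit /served; case: e => [[[j [A f]] [i'|]]|] /=;
  try by rewrite eq_sym pnatr_eq0.
rewrite eqr_nat eqSS val_eqE; case: eqVneq => //= _.
case: (f i) => [l'|]; last by rewrite eq_sym pnatr_eq0.
by rewrite eqr_nat eqSS val_eqE.
Qed.

Lemma past_ownE i j (l : 'I_L) e : past_own i j (val l).+1 e = sold_in i j l e.
Proof.
rewrite /past_own past_hitE /served /sold_in; case: e => [[[j' [A f]] [i'|]]|] //=.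
by rewrite eqr_nat eqSS val_eqE andbAC -andbA.
Qed.

Lemma sum_count (p : pred (event n m L)) (h : history n m L) :
  (\sum_(t < size h) p (nth None h t) = count p h)%N.
Proof. by rewrite -sum1_count (big_nth None) big_mkord [RHS]big_mkcond. Qed.

Lemma sum_bool_le k (f : 'I_k -> bool) : (\sum_(t < k) f t <= k)%N.
Proof.
rewrite -[leqRHS]card_ord -sum1_card; apply: leq_sum => t _; exact: leq_b1.
Qed.

Lemma run_count mu (h : history n m L) (i : 'I_n) (j : 'I_m) (w : nat) :
  small_memory B mu -> (size h <= M)%N ->
  mu in_now [::] = (size h)%:R -> mu in_type [::] = (val j)%:R ->
  mu c_i [::] = (val i)%:R -> mu a_wh [::] = w%:R ->
  (forall s, mu past_choice [:: s] = past_choice_value (nth None h s)) ->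
  (forall s, mu past_type [:: s] = past_type_value (nth None h s)) ->
  (forall s (i : 'I_n), mu past_warehouse [:: s; val i] =
    past_warehouse_value (nth None h s) i) ->
  mu a_own [::] = 0 -> mu a_all [::] = 0 ->
  run p_count mu (fun mu' => mu' a_own [::] = (count (past_own i j w) h)%:R /\
    mu' a_all [::] = (count (past_hit i w) h)%:R).
Proof.
move=> hmu hM hn ht hi hw pc pt pw o0 a0.
pose Inv k (mu' : memory) :=
  mu' a_own [::] = (\sum_(t < k) past_own i j w (nth None h t))%N%:R /\
  mu' a_all [::] = (\sum_(t < k) past_hit i w (nth None h t))%N%:R.
apply: (runs_For n_le M_le (K := size h) (Inv := Inv)) => //.
- by rewrite /Inv !updateN // !big_ord0.
- move=> k mu1 kh s1 f1 x1 [io ia].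
  have sb (f : 'I_k.+1 -> bool) : small B (\sum_(t < k.+1) f t)%N%:R.
    apply: small_natS; apply: leq_trans (sum_bool_le _) _.
    by apply: leq_trans kh _; apply: leq_trans hM M_le.
  have E1 : eval mu1 ((Get past_choice [:: #c_t] == #c_i + e_one) *
      (Get past_warehouse [:: #c_t; #c_i] == #a_wh))%expr = (past_hit i w (nth None h k))%:R.
    have ci : mu1 c_i [::] = (val i)%:R by rewrite f1.
    have wi : mu1 a_wh [::] = w%:R by rewrite f1.
    rewrite /= x1 ci wi !natrK natr1 [mu1 past_choice _]f1 // [mu1 past_warehouse _]f1 //.
    by rewrite pc pw mulr_bool.
  apply: runs_Do_then => //; first by rewrite E1 small_bool.
  rewrite E1 => mu2 s2 e2.
  have E2 : eval mu2 (#a_all + #a_hit)%expr =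
    (\sum_(t < k.+1) past_hit i w (nth None h t))%N%:R.
    by rewrite e2 /update /= ia big_ord_recr natrD.
  apply: runs_Do_then => //; first by rewrite E2.
  rewrite E2 => mu3 s3 e3.
  have E3 : eval mu3 (#a_own + #a_hit * (Get past_type [:: #c_t] == #in_type + e_one))%expr =
    (\sum_(t < k.+1) past_own i j w (nth None h t))%N%:R.
    have tj : mu1 in_type [::] = (val j)%:R by rewrite f1.
    rewrite e3 e2 /update /= io big_ord_recr natrD /= x1 natrK tj natr1 f1 // pt.
    by rewrite mulr_bool.
  apply: runs_Do => //; first by rewrite E3.
  by rewrite E3 /Inv e3 /update /=.
- by move=> mu' _ _ [-> ->]; rewrite !sum_count.
Qed.


Notation quotas := (quota I opt).

Definition plan_offer (u : 'I_(rounds n L T)) (j : 'I_m) : {set 'I_n} :=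
  offered I opt (prices I opt u) j.
Definition plan_source (u : 'I_(rounds n L T)) (j : 'I_m) (i : 'I_n) : option 'I_L :=
  code_source L (code I (prices I opt u) j i).

Hypothesis rounds_le : (rounds n L T <= M)%N.

Lemma run_act mu (h : history n m L) (j : 'I_m) (u : 'I_(rounds n L T)) :
  small_memory B mu -> inputs I mu -> (size h < T)%N ->
  (forall (i : 'I_n) (l : 'I_L),
     mu out_placement [:: val i; val l] = (\sum_j quotas i j l)%N%:R) ->
  (forall (i : 'I_n) (j : 'I_m) (l : 'I_L),
     mu a_quota [:: val i; val j; (val l).+1] = (quotas i j l)%:R) ->
  (forall (i : 'I_n),
     mu a_offer [:: val u; val j; val i] = (i \in plan_offer u j)%:R /\
     mu a_source [:: val u; val j; val i] = (code I (prices I opt u) j i)%:R) ->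
  run p_act (query_memory mu h j u) (fun mu' =>
    output_action n L mu' = reserve_action plan_offer plan_source quotas h j u).
Proof.
move=> hmu inp hT hp hq hd; set mu0 := query_memory mu h j u.
have hM : (size h <= M)%N by apply: leq_trans T_le; apply: ltnW.
have s0 : small_memory B mu0.
  by apply: small_query => //; apply: leq_trans rounds_le; apply/ltnW/ltn_ord.
have inp0 : inputs I mu0.
  move=> z idx z8; rewrite -inp // /mu0 /query_memory.
  by do 7 (rewrite ifF; last by apply/eqP => zz; rewrite zz in z8).
have hp0 (i : 'I_n) (l : 'I_L) :
  mu0 out_placement [:: val i; val l] = (\sum_j quotas i j l)%N%:R by exact: hp.
have hq0 (i : 'I_n) (j' : 'I_m) (l : 'I_L) :
  mu0 a_quota [:: val i; val j'; (val l).+1] = (quotas i j' l)%:R by exact: hq.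
pose act := reserve_action plan_offer plan_source quotas h j u.
pose Inv k (mu' : memory) := forall i : 'I_n, (i < k)%N ->
  mu' out_offer [:: val i] = (i \in act.1)%:R /\
  mu' out_warehouse [:: val i] = (oapp (fun l : 'I_L => l.+1) 0%N (act.2 i))%:R.
apply: (runs_For n_le M_le (K := n) (Inv := Inv)) => //.
- exact: (in_productsE inp0).
- move=> k mu1 kn; move: k kn mu1; apply: for_ordinal => i mu1 s1 f1 x1 i1.
  have [hoff hsrc] := hd i; set w := code _ _ _ _ in hsrc.
  have seed1 : mu1 in_seed [::] = (val u)%:R by rewrite f1.
  have type1 : mu1 in_type [::] = (val j)%:R by rewrite f1.
  have source1 : mu1 a_source [:: val u; val j; val i] = w%:R by rewrite f1.
  have w_le : (w <= L)%N by exact: scan_code_le.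
  have sL k : (k <= L)%N -> small B k%:R.
    by move=> kL; apply: small_natS; apply: leq_trans M_le; apply: leq_trans L_le.
  have E1 : eval mu1 (Get a_source [:: #in_seed; #in_type; #c_i])%expr = w%:R.
    by rewrite /= seed1 type1 x1 !natrK.
  apply: runs_Do_then => //; first by rewrite E1 sL.
  rewrite E1 => mu2 s2 e2.
  apply: runs_Do_then => //; first exact: small0.
  move=> mu3 s3 e3.
  apply: runs_Do_then => //; first exact: small0.
  move=> mu4 s4 e4.
  apply: (runs_Then (run_count (h := h) (i := i) (j := j) (w := w) s4 hM _ _ _ _ _ _ _ _ _)).
  - by rewrite e4 e3 e2 /update /= f1.
  - by rewrite e4 e3 e2 /update /=.
  - by rewrite e4 e3 e2 /update /=.
  - by rewrite e4 e3 e2 /update /=.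
  - by move=> s; rewrite e4 e3 e2 /update /= f1.
  - by move=> s; rewrite e4 e3 e2 /update /= f1.
  - by move=> s i'; rewrite e4 e3 e2 /update /= f1 // /mu0 /query_memory /= at_ord_val.
  - by rewrite e4 e3 e2 /update /=.
  - by rewrite e4 e3 e2 /update /=.
  move=> mu5 s5 f5 [own5 all5].
  (* The plan, the seed and the history still have their values from the start of the period. *)
  have mem5 z idx : z \notin writes p_act -> mu5 z idx = mu0 z idx.
    move=> hz; have ne x : x \in writes p_act -> (z == x) = false.
      by move=> hx; apply: contraNF hz => /eqP ->.
    have sub x : x \in writes p_count -> x \in writes p_act.
      by rewrite !inE => /or4P[] /eqP ->.
    rewrite f5; last by apply: contraNF hz; apply: sub.
    by rewrite e4 e3 e2 !updateN ?ne // f1 //; apply/negbTE.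
  have ci5 : mu5 c_i [::] = (val i)%:R by rewrite f5 // e4 e3 e2 /update /= x1.
  have wh5 : mu5 a_wh [::] = w%:R by rewrite f5 // e4 e3 e2 /update /=.
  have seed5 : mu5 in_seed [::] = (val u)%:R by rewrite mem5.
  have type5 : mu5 in_type [::] = (val j)%:R by rewrite mem5.
  have E5 : eval mu5 (Get a_offer [:: #in_seed; #in_type; #c_i])%expr = (i \in act.1)%:R.
    by rewrite /= seed5 type5 ci5 !natrK mem5.
  apply: runs_Do_then => //; first by rewrite E5 small_bool.
  rewrite E5 => mu6 s6 e6.
  have E6 : eval mu6 (#a_wh * (#a_own + e_one <= Get a_quota [:: #c_i; #in_type; #a_wh]) *
      (#a_all + e_one <= Get out_placement [:: #c_i; #a_wh - e_one]))%expr =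
      (oapp (fun l : 'I_L => l.+1) 0%N (act.2 i))%:R.
    rewrite e6 /update /= own5 all5 wh5 ci5 type5 !natrK !natr1 /act /reserve_action /= ffunE.
    rewrite /plan_source -/w; case ew: w => [|w'] /=; first by rewrite !mul0r.
    have w'L : (w' < L)%N by rewrite -ew.
    rewrite insubT /=; set l := Sub w' w'L.
    have -> : w'.+1%:R - 1 = (val l)%:R :> rat by rewrite -natr1 addrK.
    rewrite natrK -[w'.+1]/((val l).+1) !mem5 // hp0 hq0.
    rewrite (eq_count (a1 := past_own i j (val l).+1) (a2 := sold_in i j l));
      last by move=> e; apply: past_ownE.
    rewrite (eq_count (a1 := past_hit i (val l).+1) (a2 := served i l));
      last by move=> e; apply: past_hitE.
    rewrite !ler_nat -mulrA mulr_bool -/(sold i j l h) /available /inventory subn_gt0.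
    by case: (_ && _); rewrite ?mulr1 ?mulr0.
  apply: runs_Do => //.
    rewrite E6 sL //; case: (act.2 i) => [l|] //=; exact: ltn_ord.
  rewrite E6 => i' hi'.
  rewrite e6 /update /= ci5 natrK !eqseq_cons !andbT !val_eqE.
  case: eqVneq => [->//|i'i].
  have [-> ->] : mu5 out_offer [:: val i'] = (i' \in act.1)%:R /\
    mu5 out_warehouse [:: val i'] = (oapp (fun l : 'I_L => l.+1) 0%N (act.2 i'))%:R.
    rewrite !f5 // e4 e3 e2 /update /=; apply: i1.
    by rewrite ltn_neqAle val_eqE i'i -ltnS.
  by [].
- move=> mu' _ _ hI; rewrite -/act /output_action [act]surjective_pairing; congr pair.
    apply/setP => i; rewrite inE; have [-> _] := hI i (ltn_ord i).
    by case: (i \in _); rewrite ?oner_eq0 ?eqxx.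
  apply/ffunP => i; rewrite ffunE; have [_ ->] := hI i (ltn_ord i).
  case: (act.2 i) => [l|] /=; case: pickP => [l'|hn] //=.
  - by rewrite eqr_nat eqSS => /eqP/val_inj ->.
  - by have := hn l; rewrite eqxx.
  - by rewrite eq_sym pnatr_eq0.
Qed.

End Act.

(** * The optimum and the guarantee *)

Lemma valid_map (R : realType) n m L T (I : problem rat n m L T) :
  valid_problem I -> valid_problem (map_problem ratr I : problem R n m L T).
Proof.
case=> h1 h2 h3 h4 h5 h6 h7 h8; split => //=.
- by move=> j t; rewrite ler0q.
- by move=> t; rewrite -rmorph_sum -[leRHS](rmorph1 ratr) ler_rat.
- by move=> i j S; rewrite ler0q.
- by move=> j S; rewrite -rmorph_sum -[leRHS](rmorph1 ratr) ler_rat.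
- by move=> i j S iS; rewrite h5 // rmorph0.
- by move=> S i j k iS kS; rewrite ler_rat h6.
Qed.

Section Optimum.
Variables (R : realType) (n m L T : nat) (I : problem R n m L T).

Lemma feasible_empty : feasible_placement I (fun _ _ => 0%N).
Proof. by split=> [l|i s _]; rewrite big1. Qed.

Lemma admissible_exists (c : placement n L) : exists pi : policy R n m L, admissible T c pi.
Proof.
pose a0 : action n L := (finset.set0, [ffun=> None]).
exists (fun _ _ a => (a0 == a)%:R) => h j _; split=> [a||a].
- by [].
- by under eq_bigr do rewrite -[_%:R]mul1r; rewrite sum_pred1.
- case: eqP => [<-|]; last by rewrite ltxx.
  by move=> _ i l; rewrite inE.
Qed.

Variable bound : R.
Hypothesis boundP : forall c pi, feasible_placement I c -> admissible T c pi ->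
  expected_profit I pi <= bound.

Lemma J1_opt_le c : feasible_placement I c -> J1_opt I c <= bound.
Proof.
move=> fc; apply: ge_sup; last by move=> _ [pi hpi <-]; apply: boundP hpi.
by have [pi hpi] := admissible_exists c; exists (expected_profit I pi); exists pi.
Qed.

Lemma OPT_le : OPT I <= bound.
Proof.
apply: ge_sup; last by move=> _ [c fc <-]; apply: J1_opt_le.
by exists (J1_opt I (fun _ _ => 0%N)); exists (fun _ _ => 0%N) => //; apply: feasible_empty.
Qed.

(** A supremum dominates its members only for sets that are bounded above; [boundP] serves both the
    set of policies and the set of placements. *)
Lemma OPT_ge c pi : feasible_placement I c -> admissible T c pi ->
  expected_profit I pi <= OPT I.
Proof.
move=> fc hpi; apply: (@le_trans _ _ (J1_opt I c)).
  apply: ub_le_sup; last by exists pi.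
  by exists bound => _ [pi' hpi' <-]; apply: boundP hpi'.
apply: ub_le_sup; last by exists c.
by exists bound => _ [c' fc' <-]; apply: J1_opt_le.
Qed.

End Optimum.

Section Beta.
Variables (R : realType) (n m L T : nat) (I : problem R n m L T).
Hypothesis validI : valid_problem I.

Lemma fine_div_ge (a c : R) (x : \bar R) : 0 <= a -> (1%:E <= x)%E -> (x <= c%:E)%E ->
  a / c <= fine (a%:E / x)%E.
Proof.
move=> a0; case: x => [r| |] //; rewrite !lee_fin => r1 rc.
rewrite inver gt_eqF /=; last by apply: lt_le_trans r1.
by apply: ler_wpM2l => //; rewrite lef_pV2 // posrE; lra.
Qed.

Lemma K_min_ge1 : (1%:E <= K_min I)%E.
Proof.
apply: le_bigmin => [|l _]; first exact: leey.
by rewrite lee_fin ler1n; apply: (capacity_gt0 validI).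
Qed.

Lemma K_min_le l : (K_min I <= (capacity I l)%:R%:E)%E.
Proof. exact: (bigmin_le _ l). Qed.

Lemma C_min_ge1 : (1%:E <= C_min I)%E.
Proof.
apply: le_bigmin => [|i _]; first exact: leey.
case es: (supply I i) => [s|]; last exact: leey.
by rewrite lee_fin ler1n; apply: (supply_gt0 validI es).
Qed.

Lemma C_min_le i s : supply I i = Some s -> (C_min I <= s%:R%:E)%E.
Proof.
move=> es; have := bigmin_le +oo%E i
  (fun i => if supply I i is Some s then s%:R%:E else +oo%E : \bar R).
by rewrite es.
Qed.

Lemma beta_le1 : beta I <= 1.
Proof.
by rewrite /beta lerBlDr lerDl mulr_ge0 // le_max sqrtr_ge0.
Qed.

Lemma sqrt_inv_le (a c : R) (k : nat) : 0 < c -> c <= (k.+1 * k.+1)%:R * a ->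
  k.+1%:R^-1 <= Num.sqrt (a / c).
Proof.
move=> c0 h; have k0 : (0 : R) < k.+1%:R by rewrite ltr0n.
rewrite -[leLHS]ger0_norm ?invr_ge0 // -sqrtr_sqr ler_wsqrtr //.
rewrite exprVn ler_pdivlMr // mulrC ler_pdivrMr ?exprn_gt0 //.
by rewrite mulrC expr2 -natrM.
Qed.

(** If a buffer of [k + 1] does not strictly fit some resource, the corresponding square root in
    [beta] is at least [1 / (k + 1)]. *)
Lemma beta_le (k : nat) :
  (exists l, ((capacity I l)%:R <= (k.+1 * k.+1 * (n * m))%:R :> R)) \/
  (exists i s, supply I i = Some s /\ (s%:R <= (k.+1 * k.+1 * (L * m))%:R :> R)) ->
  beta I <= 1 - 2 / k.+1%:R.
Proof.
move=> h; rewrite /beta lerD2l lerN2 ler_wpM2l // le_max.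
case: h => [[l hl]|[i [s [es hs]]]]; apply/orP; [left|right].
  apply: (@le_trans _ _ (Num.sqrt ((n * m)%:R / (capacity I l)%:R))).
    apply: sqrt_inv_le; first by rewrite ltr0n; apply: (capacity_gt0 validI).
    by rewrite -natrM.
  by rewrite ler_wsqrtr //; apply: fine_div_ge; rewrite // ?K_min_ge1 ?K_min_le.
apply: (@le_trans _ _ (Num.sqrt ((L * m)%:R / s%:R))).
  apply: sqrt_inv_le; first by rewrite ltr0n; apply: (supply_gt0 validI es).
  by rewrite -natrM.
by rewrite ler_wsqrtr //; apply: fine_div_ge; rewrite // ?C_min_ge1 ?(C_min_le es).
Qed.

End Beta.

(** The true values of an antitone predicate form an initial segment, so their number is the largest
    index where it holds; the program can count instead of search. *)
Lemma antitone_count (f : nat -> bool) k :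
  (forall t, f t.+1 -> f t) ->
  forall t, (t < k)%N -> f t.+1 = (t < \sum_(t' < k) f t'.+1)%N.
Proof.
move=> hf; have le_sum k' : (\sum_(t' < k') f t'.+1 <= k')%N.
  by rewrite -[leqRHS]card_ord -sum1_card; apply: leq_sum => t _; exact: leq_b1.
have down t d : f (t + d)%N -> f t.
  by elim: d => [|d IH]; rewrite ?addn0 // addnS => /hf.
elim: k => [//|k IH] t; rewrite big_ord_recr /= ltnS leq_eqVlt.
case fk: (f k.+1) => /=; last first.
  case/orP => [/eqP ->|tk]; last by rewrite addn0 IH.
  by rewrite fk addn0 ltnNge le_sum.
have full t' : (t' <= k)%N -> f t'.+1.
  by move=> h; apply: (down _ (k - t')%N); rewrite addSn subnKC.
have -> : (\sum_(t' < k) f t'.+1)%N = k.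
  rewrite -[RHS]card_ord -sum1_card; apply: eq_bigr => t' _.
  by rewrite full // ltnW.
by rewrite addn1 ltnS -leq_eqVlt => tk; rewrite tk full.
Qed.

Section BufferSpec.
Variables (n m L T : nat) (I : problem rat n m L T).

Lemma buffer_fits_antitone k : buffer_fits I k.+1 -> buffer_fits I k.
Proof.
move=> /forallP h; apply/forallP => i; apply/forallP => l.
have le_sq a : ((k * k * a)%:R <= (k.+1 * k.+1 * a)%:R :> rat).
  by rewrite ler_nat leq_mul2r leq_mul ?orbT.
have /forallP /(_ l) /andP[h1 h2] := h i; apply/andP; split.
  exact: le_trans (le_sq _) h1.
by case/orP: h2 => [->//|h2]; rewrite (le_trans (le_sq _) h2) orbT.
Qed.

Lemma buffer_max : (buffer I < T)%N -> ~~ buffer_fits I (buffer I).+1.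
Proof.
move=> h; rewrite (antitone_count buffer_fits_antitone h) -/(buffer I).
by rewrite ltnn.
Qed.

Lemma buffer_fitsP : (0 < buffer I)%N -> buffer_fits I (buffer I).
Proof.
have bT : (buffer I <= T)%N by exact: buffer_le.
case eb: (buffer I) => [//|b] _; rewrite eb in bT.
by rewrite (antitone_count buffer_fits_antitone bT) -/(buffer I) eb.
Qed.

End BufferSpec.

Lemma sold_ge0 (R : realType) n m L T (I : problem R n m L T) (D : nat)
    (offer : 'I_D -> 'I_m -> {set 'I_n}) source (quota : 'I_n -> 'I_m -> 'I_L -> nat) i j l :
  valid_problem I -> (0 < D)%N ->
  0 <= expect I (reserve_policy R offer source quota) T (fun h => (sold i j l h)%:R) [::].
Proof.
move=> validI D0.
apply: (expect_ge (P := fun=> True) (Phi := fun=> 0) validI) => //.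
  exact: reserve_proper.
by move=> h _ _; rewrite big1 // => e _; rewrite mulr0.
Qed.

Lemma sum2_affine (A C : finType) (a r c : rat) (F : A -> C -> rat) :
  \sum_x \sum_y (a * (F x y / r) + c) =
  a * ((\sum_x \sum_y F x y) / r) + (#|A| * #|C|)%:R * c.
Proof.
under eq_bigr do rewrite big_split /= -mulr_sumr -mulr_suml sumr_const.
rewrite big_split /= -mulr_sumr -mulr_suml sumr_const.
by congr (_ + _); rewrite mulr_natl mulnC mulrnA.
Qed.

(* A resource of capacity [c] is shared by [k] triples, each with a buffer [b]. *)
Lemma share_le_real (F : realFieldType) (c y r t b k : F) :
  0 < r -> 1 <= c -> 1 <= t -> 1 <= b ->
  y / c - r <= r / (16 * t) -> b * b * k <= c ->
  (1 - b^-1) * (16 * t / (16 * t + 1)) * (y / r) + k * b <= c.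
Proof.
move=> r0 c1 t1 b1 hy hb.
have kb : k * b <= c / b by rewrite ler_pdivlMr; lra.
(* The factor is the inverse of the overuse [1 + 1 / (16 t)] left by the subgradient method. *)
have yr : 16 * t / (16 * t + 1) * (y / r) <= c.
  have h1 : y <= c * (r / (16 * t) + r).
    by rewrite -ler_pdivrMl; [rewrite mulrC; lra | lra].
  rewrite mulrA ler_pdivrMr // mulrAC ler_pdivrMr; last by lra.
  have t16 : 0 <= 16 * t by lra.
  have h2 := ler_wpM2l t16 h1.
  have e : 16 * t * (c * (r / (16 * t) + r)) = c * r * (16 * t + 1).
    by field; rewrite gt_eqF; lra.
  by rewrite -e.
have b2 : 0 <= 1 - b^-1 by rewrite subr_ge0 invf_le1; lra.
have h2 := ler_wpM2l b2 yr.
have e : (1 - b^-1) * c = c - c / b by ring.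
rewrite -mulrA; lra.
Qed.

(** * Feasibility and guarantee of the computed plan *)

Section Final.
Variables (R : realType) (n m L T : nat) (I : problem rat n m L T).
Variables (opt : 'I_m -> {ffun 'I_n -> rat} -> {set 'I_n}).
Hypotheses (n_gt0 : (0 < n)%N) (m_gt0 : (0 < m)%N) (L_gt0 : (0 < L)%N) (T_gt0 : (0 < T)%N).
Hypotheses (validI : valid_problem I) (oracle : assortment_oracle I opt).

Let J : problem R n m L T := map_problem ratr I.
Let validJ : valid_problem J := valid_map R validI.
Let N := rounds n L T.
Let b := buffer I.
Notation price s := (prices I opt s).
Notation quotas := (quota I opt).
Notation Y i j l := (cumulative I opt N i j (val l).+1).

Lemma cumulative_ge0 s i j w : 0 <= cumulative I opt s i j w.
Proof.
by apply: sumr_ge0 => s' _; apply: mulr_ge0 => //; apply: sale_ge0.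
Qed.

Lemma rounds_gt0 : (0 < N)%N.
Proof. by rewrite /N /rounds !muln_gt0 T_gt0 addn_gt0 L_gt0. Qed.

Let N0 : (0 : rat) < N%:R. Proof. by rewrite ltr0n rounds_gt0. Qed.

Lemma quota_ratioE : (0 < b)%N ->
  quota_ratio I = (1 - b%:R^-1) * (16 * T%:R / (16 * T%:R + 1)).
Proof.
by move=> b0; rewrite /quota_ratio -/b mulrBl divff ?mul1r // pnatr_eq0 -lt0n.
Qed.

Lemma quota_le i j l : (quotas i j l)%:R <= quota_ratio I * (Y i j l / N%:R) + b%:R.
Proof.
rewrite /quota natrD lerD2r truncn_le.
by rewrite mulr_ge0 ?quota_ratio_ge0 // divr_ge0 ?cumulative_ge0.
Qed.

(** Truncation costs less than one unit, so a buffer of [b] counts as [b - 1] in the variance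
    bound. *)
Lemma quota_ge i j l : quota_ratio I * (Y i j l / N%:R) + b%:R - 1 <= (quotas i j l)%:R.
Proof.
rewrite /quota natrD; set x := quota_ratio I * _.
have := truncnS_gt x; rewrite -natr1; lra.
Qed.

Lemma share_le (c y : rat) (k : nat) : 1 <= c ->
  y / c - N%:R <= N%:R / (16 * T%:R) ->
  ((0 < b)%N -> (b * b * k)%:R <= c) ->
  (* For [b = 0] the ratio is 0 by division by zero, and nothing is placed. *)
  quota_ratio I * (y / N%:R) + (k * b)%:R <= c.
Proof.
move=> c1 hy hb; have [b0|b0] := posnP b.
  by rewrite /quota_ratio -/b b0 muln0 invr0 mulr0 !mul0r addr0; apply: le_trans c1.
rewrite quota_ratioE // [(k * b)%:R]natrM; apply: share_le_real => //.
- by rewrite ler1n.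
- by rewrite ler1n.
- by rewrite -!natrM; apply: hb.
Qed.

Lemma plan_feasible : feasible_placement I (quota_placement quotas).
Proof.
have [sl si] := slack_le L_gt0 T_gt0 validI oracle.
have fits i l := forallP (forallP (buffer_fitsP (I := I) _) i) l.
split=> [l|i s es]; rewrite -(ler_nat rat).
  have -> : (\sum_i quota_placement quotas i l)%:R = \sum_i \sum_j (quotas i j l)%:R :> rat.
    by rewrite natr_sum; apply: eq_bigr => i _; rewrite natr_sum.
  apply: (@le_trans _ _ (\sum_i \sum_j (quota_ratio I * (Y i j l / N%:R) + b%:R))).
    by do 2 (apply: ler_sum => ? _); apply: quota_le.
  have -> : \sum_i \sum_j (quota_ratio I * (Y i j l / N%:R) + b%:R) =
    quota_ratio I * ((state I opt N).1 (val l).+1 / N%:R) + (n * m * b)%:R.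
    by rewrite state_stock sum2_affine !card_ord -natrM.
  rewrite -/(stock_cap I l); apply: share_le; [exact: stock_cap_ge1 | exact: sl | move=> b0].
  (* [buffer_fits] ranges over pairs of a product and a warehouse; any product gives the condition
     on [l]. *)
  by have /andP[h _] := fits b0 (Ordinal n_gt0) l.
have [[e0 _]|[[s' [es' cs]] c1]] := supply_capP validI i; first by rewrite e0 in es.
move: es'; rewrite es => -[ss']; rewrite -ss' in cs.
rewrite -cs.
have -> : (\sum_l quota_placement quotas i l)%:R = \sum_j \sum_l (quotas i j l)%:R :> rat.
  rewrite natr_sum exchange_big /=; apply: eq_bigr => l _; exact: natr_sum.
apply: (@le_trans _ _ (\sum_j \sum_(l < L) (quota_ratio I * (Y i j l / N%:R) + b%:R))).
  by do 2 (apply: ler_sum => ? _); apply: quota_le.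
have -> : \sum_j \sum_(l < L) (quota_ratio I * (Y i j l / N%:R) + b%:R) =
  quota_ratio I * ((state I opt N).2 i / N%:R) + (L * m * b)%:R.
  by rewrite state_supply sum2_affine !card_ord -natrM (mulnC m).
apply: share_le => //; first exact: si.
move=> b0; have /andP[_ /orP[/eqP h|//]] := fits b0 i (Ordinal L_gt0).
by move: c1; rewrite h; lra.
Qed.

Lemma OPT_le_dual s c pi : feasible_placement J c -> admissible T c pi ->
  expected_profit J pi <= ratr (dual I opt s).
Proof.
move=> [fl fi] hpi.
have := weak_duality (I := J) validJ hpi (p := fun i l => ratr (price s i l))
  (g := fun i j => ratr (gain I (price s) j i)) (best := fun j => ratr (best I opt (price s) j)).
move=> h; apply: le_trans (h _ _ _ _) _.
- by move=> i l; rewrite ler0q price_ge0.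
- by move=> i j; rewrite ler0q gain_ge0.
- by move=> i j l; rewrite -rmorphB ler_rat; apply: gain_ge.
- move=> j S; rewrite /J /=.
  under eq_bigr do rewrite -rmorphM.
  by rewrite -rmorph_sum ler_rat; apply: best_ge.
have -> : \sum_i \sum_l ratr (price s i l) * (c i l)%:R +
    \sum_j (\sum_t arrival J j t) * ratr (best I opt (price s) j) =
  ratr (\sum_i \sum_l price s i l * (c i l)%:R +
    \sum_j total_arrival I j * best I opt (price s) j) :> R.
  rewrite rmorphD !rmorph_sum /=; congr (_ + _); apply: eq_bigr => i _.
    by rewrite rmorph_sum; apply: eq_bigr => l _; rewrite rmorphM /= ratr_nat.
  by rewrite rmorphM /=; congr (_ * _); rewrite /total_arrival rmorph_sum.
rewrite ler_rat lerD2r.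
have -> : \sum_i \sum_l price s i l * (c i l)%:R =
  \sum_l stock_price I opt (state I opt s).1 s l * (\sum_i c i l)%:R +
  \sum_i supply_price I opt (state I opt s).2 s i * (\sum_l c i l)%:R.
  under [X in _ = X + _]eq_bigr do rewrite natr_sum mulr_sumr.
  under [X in _ = _ + X]eq_bigr do rewrite natr_sum mulr_sumr.
  rewrite [X in _ = X + _]exchange_big -big_split /=; apply: eq_bigr => i _.
  by rewrite -big_split /=; apply: eq_bigr => l _; rewrite mulrDl.
apply: lerD; apply: ler_sum => x _.
  by apply: ler_wpM2l; [apply: stock_price_ge0 | rewrite ler_nat; apply: fl].
(* An infinite supply has price 0, so its conventional capacity 0 does no harm. *)
have [[e0 _]|[[s' [es' cs]] c1]] := supply_capP validI x.
  by rewrite supply_price_None // !mul0r.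
apply: ler_wpM2l; first exact: supply_price_ge0.
by rewrite cs ler_nat; apply: fi.
Qed.

Let pi : policy R n m L := reserve_policy R (plan_offer I opt) (plan_source I opt) quotas.

(** A seed is a round, so averaging over seeds yields the sales of the averaged subgradient
    solution. *)
Lemma plan_demand i j l :
  demand J (plan_offer I opt) (plan_source I opt) i j l = ratr (Y i j l / N%:R).
Proof.
rewrite /demand /assigned mulrCA [RHS]rmorphM /= [RHS]mulrC; congr (_ * _).
  by rewrite fmorphV /= ratr_nat.
rewrite mulr_sumr /cumulative rmorph_sum; apply: eq_bigr => u _.
rewrite /sale !rmorphM /= ratr_nat /total_arrival rmorph_sum mulrA /=; congr (_ * _).
rewrite /plan_source; case ew: (code _ _ _ _) => [|w] //=.
rewrite eqSS; congr (_%:R); case: insubP => [l' _ <-|hw] //=.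
by rewrite (code_lt ew) in hw.
Qed.

Lemma plan_source_reward u j i l : plan_source I opt u j i = Some l -> 0 <= reward J i j l.
Proof.
rewrite /plan_source /J /= ler0q; case ew: (code _ _ _ _) => [|w] //=.
case: insubP => [l' _ el [ll']|//] ; apply: (@code_reward _ _ _ _ _ opt L_gt0 T_gt0 validI u) => //.
by rewrite ew -ll' el.
Qed.

Definition average : rat := (\sum_(k < N) value I opt k) / N%:R.

Lemma plan_profit (ratio : R) :
  (forall i j l, ratio * demand J (plan_offer I opt) (plan_source I opt) i j l <=
     expect J pi T (fun h => (sold i j l h)%:R) [::]) ->
  ratio * ratr average <= expected_profit J pi.
Proof.
move=> h; have := reserve_profit validJ rounds_gt0 plan_source_reward h.
congr (_ * _ <= _); rewrite /average value_cumulative mulr_suml rmorph_sum.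
apply: eq_bigr => i _; rewrite mulr_suml rmorph_sum; apply: eq_bigr => j _.
rewrite mulr_suml rmorph_sum; apply: eq_bigr => l _.
by rewrite plan_demand -mulrA rmorphM.
Qed.

Definition dual_average : rat := (\sum_(k < N) dual I opt k) / N%:R.

Let feasible_J : feasible_placement J (quota_placement quotas) := plan_feasible.
Let admissible_pi : admissible T (quota_placement quotas) pi.
Proof. exact: reserve_admissible rounds_gt0. Qed.

Lemma OPT_le_dual_average : OPT J <= ratr dual_average.
Proof.
have h s : OPT J <= ratr (dual I opt s).
  by apply: OPT_le => c pi' fc hpi; apply: OPT_le_dual fc hpi.
rewrite /dual_average rmorphM /= fmorphV /= ratr_nat rmorph_sum ler_pdivlMr ?ltr0n ?rounds_gt0 //.
rewrite mulr_natr -[N in leLHS]card_ord -sumr_const.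
by apply: ler_sum => k _; apply: h.
Qed.

Lemma dual_average_le : dual_average <= average + base I opt / (32 * T%:R ^+ 2).
Proof.
rewrite /dual_average ler_pdivrMr // mulrDl /average divfK ?gt_eqF //.
by rewrite [X in _ + X]mulrC; apply: value_sum_ge.
Qed.

Lemma base_le_average : base I opt <= T%:R * dual_average.
Proof.
rewrite /dual_average mulrA ler_pdivlMr // mulr_natr -[N in leLHS]card_ord -sumr_const mulr_sumr.
by apply: ler_sum => k _; apply: base_le_dual.
Qed.

Lemma plan_profit_ge0 : 0 <= expected_profit J pi.
Proof.
have := plan_profit (ratio := 0); rewrite mul0r; apply=> i j l.
by rewrite mul0r; apply: sold_ge0 => //; apply: rounds_gt0.
Qed.

Lemma profit_le_OPT c pi' : feasible_placement J c -> admissible T c pi' ->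
  expected_profit J pi' <= OPT J.
Proof.
move=> fc hpi; apply: (OPT_ge (bound := ratr (dual I opt 0))) fc hpi => c' pi'' fc' hpi'.
exact: OPT_le_dual fc' hpi'.
Qed.

Lemma OPT_ge0 : 0 <= OPT J.
Proof. exact: le_trans plan_profit_ge0 (profit_le_OPT feasible_J admissible_pi). Qed.

(** All finite capacities are at least [T], so values and dual values coincide, and every quota is
    at least the buffer [T], so nothing is lost in fulfillment. *)
Lemma profit_ample : b = T -> OPT J <= expected_profit J pi.
Proof.
move=> bT; have b0 : (0 < b)%N by rewrite bT.
have fits i l := forallP (forallP (buffer_fitsP b0) i) l.
have TT k : (0 < k)%N -> T%:R <= (b * b * k)%:R :> rat.
  by move=> k0; rewrite ler_nat bT -mulnA leq_pmulr // muln_gt0 T_gt0.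
have ample s : value I opt s = dual I opt s.
  apply: value_ample => // [l|i hi].
    have /andP[h _] := fits (Ordinal n_gt0) l.
    by apply: le_trans h; apply: TT; rewrite muln_gt0 n_gt0.
  have [[e0 _]|[_ c1]] := supply_capP validI i; first by rewrite e0 in hi.
  have /andP[_ /orP[/eqP h|h]] := fits i (Ordinal L_gt0).
    by move: c1; rewrite h; lra.
  by apply: le_trans h; apply: TT; rewrite muln_gt0 L_gt0.
apply: le_trans OPT_le_dual_average _.
have -> : dual_average = average.
  by rewrite /dual_average /average; congr (_ / _); apply: eq_bigr => k _; rewrite ample.
have := plan_profit (ratio := 1); rewrite mul1r; apply=> i j l; rewrite mul1r.
apply: sold_ample => //; first exact: rounds_gt0.
exact: leq_trans (eq_leq (esym bT)) (leq_addl _ _).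
Qed.

Lemma profit_buffered : (1 < b)%N ->
  (1 - 5 / (4 * b%:R)) * (16 * T%:R / (16 * T%:R + 1)) * ratr average <=
  expected_profit J pi :> R.
Proof.
move=> b1; have bR : (1 : R) < b%:R by rewrite ltr1n.
have T0 : (0 : R) < T%:R by rewrite ltr0n.
have b0 : (0 < b)%N by exact: ltnW.
pose gam : R := ratr (quota_ratio I).
have gamE : gam = (1 - b%:R^-1) * (16 * T%:R / (16 * T%:R + 1)).
  rewrite /gam quota_ratioE // rmorphM rmorphB rmorph1 /= fmorphV /= ratr_nat.
  by rewrite rmorphM /= fmorphV /= rmorphD rmorph1 /= rmorphM /= !ratr_nat.
(* [(1 - 1/b) (1 - 1/(4 (b - 1))) = (4 b - 5)/(4 b)]. *)
have -> : (1 - 5 / (4 * b%:R)) * (16 * T%:R / (16 * T%:R + 1)) =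
    gam * (1 - (4 * (b%:R - 1))^-1) :> R.
  by rewrite gamE; field; rewrite !gt_eqF //; lra.
apply: plan_profit => i j l; apply: sold_buffered => //.
- exact: rounds_gt0.
- have i1 : (b%:R : R)^-1 <= 1 by rewrite invf_le1; lra.
  have i0 : 0 <= (b%:R : R)^-1 by rewrite invr_ge0.
  have t1 : 16 * T%:R / (16 * T%:R + 1) <= 1 :> R by rewrite ler_pdivrMr; lra.
  have t0 : 0 <= 16 * T%:R / (16 * T%:R + 1) :> R by rewrite divr_ge0; lra.
  rewrite gamE; apply/andP; split; first by rewrite mulr_ge0 // subr_ge0.
  by rewrite mulr_ile1 // ?subr_ge0 // lerBlDr lerDl.
- by rewrite subr_gt0.
- rewrite plan_demand -rmorphM addrA.
  have := quota_ge i j l; rewrite -(ler_rat R) rmorphB rmorphD /= rmorph1 !ratr_nat.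
  done.
Qed.

Lemma OPT_le_average : OPT J * (1 - (32 * T%:R)^-1) <= ratr average.
Proof.
have T1 : (1 : rat) <= T%:R by rewrite ler1n.
have T1R : (1 : R) <= T%:R by rewrite ler1n.
have h : dual_average * (1 - (32 * T%:R)^-1) <= average.
  have h1 : base I opt / (32 * T%:R ^+ 2) <= dual_average / (32 * T%:R).
    rewrite ler_pdivrMr; last by rewrite mulr_gt0 // exprn_gt0; lra.
    rewrite [leRHS](_ : _ = T%:R * dual_average); first exact: base_le_average.
    by move: dual_average => x; field; rewrite gt_eqF; lra.
  rewrite mulrBr mulr1 lerBlDr; apply: le_trans dual_average_le _.
  by rewrite lerD2l.
apply: (@le_trans _ _ (ratr (dual_average * (1 - (32 * T%:R)^-1)))); last by rewrite ler_rat.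
have ratrE x : ratr (x * (1 - (32 * T%:R)^-1)) = ratr x * (1 - (32 * T%:R)^-1) :> R.
  by rewrite rmorphM rmorphB rmorph1 /= fmorphV /= rmorphM /= !ratr_nat.
rewrite ratrE; apply: ler_wpM2r; last exact: OPT_le_dual_average.
by rewrite subr_ge0 invf_le1; lra.
Qed.

(* The losses from the buffers and from the approximate optimization together stay below
   [2 / (k + 1)]. *)
Lemma loss_le (k t : R) : 2 <= k -> k + 1 <= t ->
  1 - 2 / (k + 1) <=
  (1 - 5 / (4 * k)) * (16 * t / (16 * t + 1)) * (1 - (32 * t)^-1).
Proof.
move=> k2 kt; set s := (k + 1)^-1.
have s0 : 0 < s by rewrite invr_gt0; lra.
have s1 : s <= 1 by rewrite invf_le1; lra.
have ts : t^-1 <= s by rewrite lef_pV2 // posrE; lra.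
have t0 : 0 < t^-1 by rewrite invr_gt0; lra.
have e1 : 1 - t^-1 / 16 <= 16 * t / (16 * t + 1).
  rewrite ler_pdivlMr; last by lra.
  have -> : (1 - t^-1 / 16) * (16 * t + 1) = 16 * t - t^-1 / 16 by field; rewrite gt_eqF; lra.
  by lra.
have e2 : (32 * t)^-1 = t^-1 / 32 by field; rewrite gt_eqF; lra.
(* The optimization losses are at most [1/(16 t) + 1/(32 t)], which is below [s / 8]. *)
have e3 : 1 - s / 8 <= 16 * t / (16 * t + 1) * (1 - (32 * t)^-1).
  apply: (@le_trans _ _ ((1 - t^-1 / 16) * (1 - t^-1 / 32))).
    by set x := t^-1 in ts t0 *; have := sqr_ge0 x; lra.
  by rewrite e2; apply: ler_wpM2r => //; lra.
have a0 : 0 <= 1 - 5 / (4 * k).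
  by rewrite subr_ge0 ler_pdivrMr; lra.
rewrite -mulrA; apply: le_trans (ler_wpM2l a0 e3).
have -> : 5 / (4 * k) = 5 / 4 * k^-1 by field; rewrite gt_eqF; lra.
(* Here [2 <= k] enters. The buffers then cost at most [5/4 * 3/2 * s = 15/8 * s], and
   [15/8 + 1/8 = 2]. *)
have ks : k^-1 <= 3 / 2 * s.
  by rewrite /s ler_pdivlMr ?ler_pdivrMl; lra.
have k0 : 0 < k^-1 by rewrite invr_gt0; lra.
by nra.
Qed.

Theorem plan_approximation : is_approximation J (beta J) (quota_placement quotas) pi.
Proof.
split; [exact: feasible_J | exact: admissible_pi |].
have O0 := OPT_ge0.
have bT : (b <= T)%N by exact: buffer_le.
move: bT; rewrite leq_eqVlt => /orP[/eqP bT|bT].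
  apply: le_trans (profit_ample bT).
  by rewrite -[leRHS]mul1r ler_wpM2r // beta_le1.
(* By maximality of [b], a buffer of [b + 1] fails at some warehouse or at some finite supply. *)
have hbeta : beta J <= 1 - 2 / b.+1%:R.
  apply: beta_le; first exact: validJ.
  have := buffer_max bT; rewrite -/b negb_forall => /existsP[i].
  rewrite negb_forall => /existsP[l]; rewrite negb_and => /orP[h|].
    left; exists l; move: h; rewrite -ltNge => /ltW.
    by rewrite ler_nat => h; rewrite /J /= ler_nat.
  rewrite negb_or => /andP[c0 h]; right; exists i.
  have [[_ e0]|[[s [es cs]] _]] := supply_capP validI i; first by rewrite e0 eqxx in c0.
  exists s; split=> //; move: h; rewrite -ltNge cs => /ltW.
  by rewrite !ler_nat.
have [b1|b1] := leqP b 1.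
  apply: le_trans plan_profit_ge0; apply: mulr_le0_ge0 => //.
  apply: le_trans hbeta _; rewrite subr_le0 ler_pdivlMr ?ltr0n // mul1r.
  by rewrite ler_nat.
apply: (@le_trans _ _ ((1 - 2 / b.+1%:R) * OPT J)); first exact: ler_wpM2r.
apply: le_trans (profit_buffered b1).
have bR : (2 : R) <= b%:R by rewrite ler_nat.
have bTR : (b%:R + 1 : R) <= T%:R by rewrite natr1 ler_nat.
have a0 : 0 <= (1 - 5 / (4 * b%:R)) * (16 * T%:R / (16 * T%:R + 1)) :> R.
  apply: mulr_ge0; first by rewrite subr_ge0 ler_pdivrMr; lra.
  by rewrite divr_ge0 //; lra.
apply: le_trans (ler_wpM2l a0 OPT_le_average).
rewrite [OPT J * _]mulrC mulrA; apply: ler_wpM2r => //.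
by have := loss_le bR bTR; rewrite natr1.
Qed.

End Final.

Lemma input_memory_out n m L T (I : problem rat n m L T) x idx :
  (8 <= x)%N -> input_memory I x idx = 0.
Proof.
move=> x8; rewrite /input_memory.
by do 8 (rewrite ifF; last by apply: contraTF x8 => h; rewrite -ltnNge; case: eqP h => // ->).
Qed.

Theorem theorem4p2 (R : realType) :
  exists (plan act : program) (d : nat),
    forall (n m L T : nat) (I : problem rat n m L T)
           (opt : 'I_m -> {ffun 'I_n -> rat} -> {set 'I_n}),
      (0 < n)%N -> (0 < m)%N -> (0 < L)%N -> (0 < T)%N ->
      valid_problem I ->
      assortment_oracle I opt ->
      exists (c : placement n L) (D : nat)
             (a : history n m L -> 'I_m -> 'I_D -> action n L),
        [/\ (0 < D)%N,
            computes I opt plan act (d * input_size I ^ d)%N c a &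
            is_approximation (map_problem ratr I : problem R n m L T)
              (beta (map_problem ratr I : problem R n m L T))
              c (seeded_policy R a)].
Proof.
(* Bounding the sum of the two costs gives a single [d] for both programs. *)
have [d hd] := poly_bounded_exponent (poly_boundedD
  (poly_bounded_cost p_plan poly_bounded_bits poly_bounded_loop)
  (poly_bounded_cost p_act poly_bounded_bits poly_bounded_loop)).
exists (compile p_plan), (compile p_act), d => n m L T I opt n0 m0 L0 T0 validI oracle.
exists (quota_placement (quota I opt)), (rounds n L T).
exists (reserve_action (plan_offer I opt) (plan_source I opt) (quota I opt)).
split; [exact: rounds_gt0 | | exact: plan_approximation].
have Z0 : (0 < input_size I)%N by apply: leq_trans (size_products I).
have sm := small_input_memory I; have inp : inputs I (input_memory I) by [].
have ge0 := @cumulative_ge0 _ _ _ _ I opt validI.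
have [k [mu [e hk smu f [hp hN hq hd']]]] :=
  plan_runs ge0 n0 m0 L0 T0 sm inp (@input_memory_out _ _ _ _ I).
exists k, mu; split=> //.
- split=> //; apply: leq_trans hk _; apply: leq_trans (hd _ Z0); exact: leq_addr.
- move=> h j u hT.
  have inp' : inputs I mu by apply: inputs_frame f inp.
  have leM a : (a <= input_size I)%N -> (a <= loop_bound (input_size I))%N.
    by move=> ha; apply: leq_trans ha (leq_addl _ _).
  have [k' [mu' [e' hk' _ _ hout]]] := run_act
    (leM _ (size_products I)) (leM _ (size_types I)) (leM _ (size_warehouses I))
    (leM _ (size_periods I)) (loop_bound_lt I)
    (leq_trans (rounds_le I) (leq_addr _ _)) smu inp' hT hp hq
    (fun i => hd' u j i (ltn_ord u)).
  exists k', mu'; split=> //.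
  by apply: leq_trans hk' _; apply: leq_trans (hd _ Z0); exact: leq_addl.
Qed.
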